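(* Let $\Omega$ be a finitely open set in $\mathbb{M}^d$. Then the cone \[ \mathcal{P}=\{\,u(\mu)^*u(\lambda)\;:\; u\in\mathrm{Hol}_{\mathcal{H}}(\Omega)\text{ for some Hilbert space }\mathcal{H}\,\} \] (each element being regarded as the function $(\lambda,\mu)\mapsto u(\mu)^*u(\lambda)$ on $\Omega\boxtimes\Omega$) is closed in $\mathrm{Her}(\Omega)$.
   Context: Hilbert spaces are complex. $\mathbb{M}_n^d$ is the set of $d$-tuples of $n\times n$ complex matrices, $\mathbb{M}^d=\bigcup_{n\ge1}\mathbb{M}^d_n$, and $E_n=E\cap\mathbb{M}^d_n$ for $E\subseteq\mathbb{M}^d$. A set $\Omega\subseteq\mathbb{M}^d$ is finitely open iff $\Omega_n$ is open in $\mathbb{M}^d_n$ for every $n$. For a Hilbert space $\mathcal{H}$ and finitely open $\Omega$, $\mathrm{Hol}_{\mathcal{H}}(\Omega)$ is the set of functions $f$ on $\Omega$ such that for every $n$, $f(\lambda)\in\mathcal{B}(\mathbb{C}^n,\mathbb{C}^n\otimes\mathcal{H})$ for $\lambda\in\Omega_n$ and $f|\Omega_n$ is holomorphic. Let $\Omega\boxtimes\Omega=\bigcup_{n\ge1}\Omega_n\times\Omega_n$. A subset $K$ of $\Omega\boxtimes\Omega$ is finitely compact if $K\cap(\Omega_n\times\Omega_n)$ is compact for every $n$ and empty for all large $n$. Consider the functions $A$ on $\Omega\boxtimes\Omega$ of the form $A(\lambda,\mu)=v(\mu)^*u(\lambda)$ with $u,v\in\mathrm{Hol}_{\mathcal{H}}(\Omega)$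 for some finite dimensional Hilbert space $\mathcal{H}$ (so $A(\lambda,\mu)$ is an $n\times n$ matrix when $\lambda,\mu\in\Omega_n$). The space $\mathrm{Her}(\Omega)$ of hereditary holomorphic functions on $\Omega$ is the completion of this space of functions in the topology of uniform convergence on finitely compact subsets of $\Omega\boxtimes\Omega$, realized as a space of functions on $\Omega\boxtimes\Omega$ (the locally uniform limits) and carrying that topology. *)

(* Defs.v *)
From HB Require Import structures.
From mathcomp Require Import all_boot all_order all_algebra.
From mathcomp Require Import complex.
From mathcomp Require Import all_classical all_reals all_analysis.

Set Implicit Arguments.
Unset Strict Implicit.
Unset Printing Implicit Defensive.

Import Order.TTheory GRing.Theory Num.Theory.
Import numFieldNormedType.Exports.

Local Open Scope ring_scope.
Local Open Scope classical_set_scope.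

(* Finite families in a normed module.  The sum norm is one of the equivalent
   norms inducing the product topology; only that topology and the notion of
   Frechet differentiability it determines are used below. *)
Definition family_of (I : finType) (V : Type) := {ffun I -> V}.

Definition family_fun I V (x : family_of I V) : I -> V := (x : {ffun I -> V}).

Coercion family_fun : family_of >-> Funclass.

Section FamilyNormedModule.
Context {K : numFieldType} (I : finType) (V : normedModType K).

HB.instance Definition _ := GRing.Lmodule.copy (family_of I V) {ffun I -> V}.

Definition family_norm (x : family_of I V) : K :=
  \sum_i `|x i|.

Lemma ler_family_normD x y :
  family_norm (x + y) <= family_norm x + family_norm y.
Proof.
by rewrite -big_split; apply: ler_sum => i _; rewrite /family_fun ffunE ler_normD.
Qed.

Lemma family_normZ (l : K) x : family_norm (l *: x) = `|l| * family_norm x.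
Proof.
rewrite /family_norm mulr_sumr; apply: eq_bigr => i _.
by rewrite /family_fun ffunE normrZ.
Qed.

Lemma family_norm_eq0 x : family_norm x = 0 -> x = 0.
Proof.
move=> /psumr_eq0P x0; apply/ffunP => i; rewrite ffunE; apply/normr0_eq0.
by apply: x0 => // j _; exact: normr_ge0.
Qed.

HB.instance Definition _ := Lmodule_isNormed.Build K (family_of I V)
  ler_family_normD family_normZ family_norm_eq0.

End FamilyNormedModule.

(* The inner product is linear in the first argument and conjugate-linear in
   the second one. *)
Record hilbert (R : realType) := Hilbert {
  hilbert_sort :> completeNormedModType R[i] ;
  inner : {dot hilbert_sort for (@Num.conj R[i])} ;
  inner_norm : forall x, inner x x = `|x| ^+ 2 }.

Definition finite_dim (R : realType) (H : hilbert R) :=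
  exists (k : nat) (e : 'I_k -> H),
    forall x : H, exists c : 'I_k -> R[i], x = \sum_i c i *: e i.

Section HereditaryFunctions.
Context {R : realType}.
Local Notation C := R[i].

Definition mxtuple (d n : nat) := family_of 'I_d 'M[C]_n.

(* B(C^n, C^n (x) H): since C^n (x) H is the direct sum of n copies of H, an
   operator T is given by its n x n matrix of entries in H, the entry (i, j)
   being the i-th component of T e_j. *)
Definition hop (n : nat) (H : hilbert R) := family_of ('I_n * 'I_n)%type H.

Definition hop_app n (H : hilbert R) (T : hop n H) (x : 'cV[C]_n) :
  {ffun 'I_n -> H} :=
  [ffun i => \sum_j x j 0 *: T (i, j)].

(* The n x n matrix of S^* T, whose entry (i, j) is <T e_j, S e_i>. *)
Definition adj_mul n (H : hilbert R) (S T : hop n H) : 'M[C]_n :=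
  \matrix_(i, j)
    \sum_k inner H (T (k, j)) (S (k, i)).

Lemma adj_mulP n (H : hilbert R) (S T : hop n H) (x y : 'cV[C]_n) :
  \sum_k inner H (hop_app T x k) (hop_app S y k) =
  \sum_i (adj_mul S T *m x) i 0 * (y i 0)^*%R.
Proof.
transitivity (\sum_k \sum_i \sum_j
    inner H (T (k, j)) (S (k, i)) * x j 0 * (y i 0)^*%R).
  apply: eq_bigr => k _; rewrite !ffunE linear_sumr; apply: eq_bigr => i _.
  rewrite linear_sumlz; apply: eq_bigr => j _.
  by rewrite linearZr_LR linearZl_LR /= mulrC (mulrC (x j 0)).
rewrite exchange_big; apply: eq_bigr => i _; rewrite !mxE mulr_suml.
rewrite exchange_big; apply: eq_bigr => j _.
by rewrite mxE !mulr_suml.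
Qed.

(* Matrices are nonempty: the level n of a subset of M^d consists of d-tuples
   of square matrices of size n.+1. *)
Definition finitely_open d (Om : forall n, set (mxtuple d n.+1)) :=
  forall n, open (Om n).

(* Only the values on Om of an element of Hol matter. *)
Definition Hol d (Om : forall n, set (mxtuple d n.+1)) (H : hilbert R) :
  set (forall n, mxtuple d n.+1 -> hop n.+1 H) :=
  [set u | forall n x, Om n x -> differentiable (u n) x].
#[global] Arguments Hol {d} Om H.

Definition finitely_compact d (Om : forall n, set (mxtuple d n.+1))
    (K : forall n, set (mxtuple d n.+1 * mxtuple d n.+1)) :=
  [/\ forall n, K n `<=` Om n `*` Om n,
      forall n, compact (K n) &
      exists N, forall n, (N <= n)%N -> K n = set0].

(* Graded matrix-valued functions (lambda, mu) |-> A(lambda, mu) on the box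
   product of Om with itself. *)
Definition box_fun d (Om : forall n, set (mxtuple d n.+1)) :=
  forall n, Om n -> Om n -> 'M[C]_n.+1.

Section UniformConvergence.
Context {d : nat} (Om : forall n, set (mxtuple d n.+1)).
Arguments Om : clear implicits.

HB.instance Definition _ := gen_eqMixin (box_fun Om).
HB.instance Definition _ := gen_choiceMixin (box_fun Om).

Definition unif_close
    (K : forall n, set (mxtuple d n.+1 * mxtuple d n.+1)) (e : C) : set (box_fun Om * box_fun Om) :=
  [set AB : box_fun Om * box_fun Om | forall n (x y : Om n), K n (val x, val y) ->
     `|AB.1 n x y - AB.2 n x y| < e].

Definition box_ent : set_system (box_fun Om * box_fun Om) :=
  [set E | exists K (e : C),
     [/\ finitely_compact Om K, 0 < e & unif_close K e `<=` E]].

Lemma box_ent_filter : Filter box_ent.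
Proof.
split.
- exists (fun=> set0), 1; split=> //; split=> [n x []|n|]; first exact: compact0.
  by exists 0%N.
- move=> P Q [K1 [e1 [[K1Om cK1 [N1 N1K]] e10 KP]]].
  move=> [K2 [e2 [[K2Om cK2 [N2 N2K]] e20 KQ]]].
  have [e [e0 ee1 ee2]] : exists e : C, [/\ 0 < e, e <= e1 & e <= e2].
    have /orP[le12|le21] : e1 >=< e2 by apply: real_comparable; exact: gtr0_real.
      by exists e1.
    by exists e2.
  exists (fun n => K1 n `|` K2 n), e; split=> //.
    split=> [n x [/K1Om|/K2Om]//|n|]; first exact: compactU.
    exists (maxn N1 N2) => n; rewrite geq_max => /andP[n1 n2].
    by rewrite N1K// N2K// setU0.
  move=> AB closeAB; split.
    by apply: KP => n x y Kxy; apply: lt_le_trans ee1; apply: closeAB; left.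
  by apply: KQ => n x y Kxy; apply: lt_le_trans ee2; apply: closeAB; right.
- move=> P Q PQ [K [e [fK e0 KP]]]; exists K, e; split=> //.
  exact: subset_trans PQ.
Qed.

Lemma box_ent_diagonal E : box_ent E -> diagonal `<=` E.
Proof.
move=> [K [e [_ e0 KE]]] [A B] /= AB; apply: KE => n x y _ /=.
by rewrite (AB : A = B) subrr normr0.
Qed.

Lemma box_ent_inv E : box_ent E -> box_ent (E^-1)%relation.
Proof.
move=> [K [e [fK e0 KE]]]; exists K, e; split=> // -[A B] AB.
by apply: KE => n x y Kxy /=; rewrite distrC; exact: AB.
Qed.

Lemma box_ent_split E : box_ent E ->
  exists2 B, box_ent B & (B \; B `<=` E)%relation.
Proof.
move=> [K [e [fK e0 KE]]]; exists (unif_close K (e / 2)).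
  by exists K, (e / 2); split=> //; rewrite divr_gt0.
move=> [A B] [D /= AD DB]; apply: KE => n x y Kxy /=.
rewrite (le_lt_trans (ler_distD (D n x y) _ _))// [ltRHS]splitr.
by rewrite ltrD//; [exact: AD|exact: DB].
Qed.

HB.instance Definition _ := isUniform.Build (box_fun Om)
  box_ent_filter box_ent_diagonal box_ent_inv box_ent_split.

End UniformConvergence.

Definition hereditary d (Om : forall n, set (mxtuple d n.+1)) (H : hilbert R)
    (v u : forall n, mxtuple d n.+1 -> hop n.+1 H) : box_fun Om :=
  fun n x y => adj_mul (v n (val y)) (u n (val x)).
#[global] Arguments hereditary {d} Om {H} v u.

Definition pre_Her d (Om : forall n, set (mxtuple d n.+1)) :
  set (box_fun Om) :=
  [set A | exists H : hilbert R, finite_dim H /\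
     exists u v, [/\ Hol Om H u, Hol Om H v & A = hereditary Om v u]].
#[global] Arguments pre_Her {d} Om.

(* All functions on the box product form a complete Hausdorff space, so that
   the completion of pre_Her is its closure. *)
Definition Her d (Om : forall n, set (mxtuple d n.+1)) : set (box_fun Om) :=
  closure (pre_Her Om).
#[global] Arguments Her {d} Om.

Definition pos_cone d (Om : forall n, set (mxtuple d n.+1)) :
  set (box_fun Om) :=
  [set A | exists (H : hilbert R) u, Hol Om H u /\ A = hereditary Om u u].
#[global] Arguments pos_cone {d} Om.

End HereditaryFunctions.

(* Main.v *)
(* Each u in Hol(Om) satisfies, on a ball where it is bounded by M, Cauchy-type
   estimates: a Lipschitz bound and bounds on second differences and on the
   failure of homogeneity of increments.  These bound the norm of finite linear
   combinations of values of u, hence only involve the kernel u(y)^* u(x), and so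
   they pass to locally uniform limits of such kernels.  A limit A is a positive
   semidefinite kernel; iterated Schur complements along a dense sequence factor
   it through l2, and the inherited estimates make the factor holomorphic.  The
   same factorization, truncated to finitely many coordinates, approximates A
   locally uniformly by finite-dimensional kernels, so that A lies in Her(Om).
   As holomorphy is mere differentiability, the Cauchy estimate rests on
   Goursat's bisection, applied to midpoint sums instead of integrals. *)

Require Import Defs.
From HB Require Import structures.
From mathcomp Require Import all_boot all_order all_algebra.
From mathcomp Require Import complex.
From mathcomp Require Import all_classical all_reals all_analysis.
From mathcomp Require Import ring lra.

Set Implicit Arguments.
Unset Strict Implicit.
Unset Printing Implicit Defensive.

Import Order.TTheory GRing.Theory Num.Theory.
Import numFieldNormedType.Exports.

Local Open Scope ring_scope.
Local Open Scope classical_set_scope.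

(** * Norms and bisection of squares *)

(** The approximants of [A] take values in unrelated Hilbert spaces, so there is no sequence of maps
    whose limit could be taken: only inequalities between norms of finite combinations survive, and
    their constants must depend on nothing but a radius and a bound. A common bound exists because
    diagonal entries of a kernel are squared norms of columns: one approximant, bounded on a compact
    ball, controls every other one there. Derivatives of the approximants are not such combinations,
    which is why differences and defects are estimated instead. Midpoint sums obey the subdivision
    identity of integrals exactly, at the price of doubling the number of nodes, so Goursat's
    argument needs no integral of a function that is merely differentiable. The levels never
    interact, since a kernel pairs points of one level only; each is factored on its own into the
    same l2. Truncation of l2 is a contraction, and this equicontinuity turns pointwise convergence
    of the truncated kernels into locally uniform convergence. *)

Section RealNorm.
Context {R : realType}.
Local Notation C := R[i].

(* Real-valued, because [lra] does not apply to the partial order of R[i]. *)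
Definition rnorm (V : normedZmodType C) (v : V) : R := complex.Re `|v|.

Lemma rnormE (V : normedZmodType C) (v : V) : `|v| = (rnorm v)%:C%C.
Proof. by rewrite RRe_real// normr_real. Qed.

Lemma rnorm_ge0 (V : normedZmodType C) (v : V) : 0 <= rnorm v.
Proof. by rewrite -ler0c -rnormE. Qed.

Lemma ler_rnormD (V : normedZmodType C) (v w : V) :
  rnorm (v + w) <= rnorm v + rnorm w.
Proof. by rewrite -lecR rmorphD /= -!rnormE ler_normD. Qed.

Lemma rnormN (V : normedZmodType C) (v : V) : rnorm (- v) = rnorm v.
Proof. by rewrite /rnorm normrN. Qed.

Lemma ler_rnormB (V : normedZmodType C) (v w : V) :
  rnorm (v - w) <= rnorm v + rnorm w.
Proof. by rewrite -(rnormN w) ler_rnormD. Qed.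

Lemma rdistC (V : normedZmodType C) (v w : V) : rnorm (v - w) = rnorm (w - v).
Proof. by rewrite /rnorm distrC. Qed.

Lemma ler_rdistD (V : normedZmodType C) (u v w : V) :
  rnorm (v - w) <= rnorm (v - u) + rnorm (u - w).
Proof. by rewrite -lecR rmorphD /= -!rnormE ler_distD. Qed.

Lemma rnorm0 (V : normedZmodType C) : rnorm (0 : V) = 0.
Proof. by rewrite /rnorm normr0. Qed.

Lemma rnorm_eq0 (V : normedZmodType C) (v : V) : rnorm v = 0 -> v = 0.
Proof. by move=> v0; apply/normr0_eq0; rewrite rnormE v0. Qed.

Lemma rnorm_gt0 (V : normedZmodType C) (v : V) : v != 0 -> 0 < rnorm v.
Proof.
by move=> v0; rewrite lt0r rnorm_ge0 andbT; apply: contra v0 => /eqP/rnorm_eq0->.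
Qed.

Lemma rnormM (x y : C) : rnorm (x * y) = rnorm x * rnorm y.
Proof. by apply: complexI; rewrite rmorphM /= -!rnormE normrM. Qed.

Lemma rnormV (x : C) : rnorm x^-1 = (rnorm x)^-1.
Proof. by apply: complexI; rewrite -rnormE normfV rnormE fmorphV. Qed.

Lemma rnormC (x : R) : rnorm x%:C%C = `|x|.
Proof.
by apply: complexI; rewrite -rnormE normc_def/= expr0n addr0 sqrtr_sqr.
Qed.

Lemma rnormZ (V : normedModType C) (c : C) (v : V) :
  rnorm (c *: v) = rnorm c * rnorm v.
Proof. by apply: complexI; rewrite rmorphM /= -!rnormE normrZ. Qed.

Lemma rnorm_sum (V : normedZmodType C) (I : Type) (r : seq I) (P : pred I) (F : I -> V) :
  rnorm (\sum_(i <- r | P i) F i) <= \sum_(i <- r | P i) rnorm (F i).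
Proof.
elim/big_rec2: _ => [|i x y _ le_yx]; first by rewrite rnorm0.
by rewrite (le_trans (ler_rnormD _ _))// lerD2l.
Qed.

Lemma rnormi : rnorm ('i%C : C) = 1.
Proof. by rewrite /rnorm normc_def/= expr0n expr1n add0r sqrtr1. Qed.

Lemma ler_rnormReIm (z : C) : rnorm z <= `|complex.Re z| + `|complex.Im z|.
Proof.
rewrite {1}[z]complexE (le_trans (ler_rnormD _ _))//.
by rewrite rnormM rnormi mul1r !rnormC.
Qed.

Lemma ger_rnormRe (z : C) : `|complex.Re z| <= rnorm z.
Proof. by rewrite -lecR -rnormE normc_ge_Re. Qed.

Lemma ger_rnormIm (z : C) : `|complex.Im z| <= rnorm z.
Proof.
by have := ger_rnormRe (z * 'i%C); rewrite ReiNIm normrN rnormM rnormi mulr1.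
Qed.

Lemma ReB (z w : C) : complex.Re (z - w) = complex.Re z - complex.Re w.
Proof. by case: z; case: w. Qed.

Lemma ImB (z w : C) : complex.Im (z - w) = complex.Im z - complex.Im w.
Proof. by case: z; case: w. Qed.

End RealNorm.

Section Bisection.
Context {R : realType}.
Local Notation C := R[i].

Definition square (a : C) (h : R) : set C :=
  [set z | [/\ complex.Re a <= complex.Re z <= complex.Re a + h &
               complex.Im a <= complex.Im z <= complex.Im a + h]].

(** Lower-left corners of the four subsquares of side h/2. The order matters: the quarters of
    indices j and 3 - j are diagonally opposite. *)
Definition quarters (a : C) (h : R) : seq C :=
  [:: a; a + (h / 2)%:C%C; a + 'i%C * (h / 2)%:C%C;
      a + (h / 2)%:C%C + 'i%C * (h / 2)%:C%C].

Lemma quarterP a h a' : 0 <= h -> a' \in quarters a h ->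
  [/\ complex.Re a <= complex.Re a', complex.Re a' + h / 2 <= complex.Re a + h,
      complex.Im a <= complex.Im a' & complex.Im a' + h / 2 <= complex.Im a + h].
Proof.
case: a => x y h0; rewrite !inE => /or4P[] /eqP-> /=; split; lra.
Qed.

(** Nested squares, for any property that passes from a square to one of its quarters. It serves
    Goursat's theorem and, with a property of the bottom side only, the mean value inequality. *)
Lemma bisection (P : C -> R -> Prop) (a0 : C) (h0 : R) :
  0 < h0 -> P a0 h0 ->
  (forall a h, 0 < h -> P a h -> exists2 a', a' \in quarters a h & P a' (h / 2)) ->
  exists2 z, square a0 h0 z & forall e, 0 < e -> exists a h,
    [/\ 0 < h < e, square a h `<=` square a0 h0, square a h z & P a h].
Proof.
move=> h00 P0 step.
have [f fP] : {f : C * R -> C & forall p, 0 < p.2 -> P p.1 p.2 ->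
    f p \in quarters p.1 p.2 /\ P (f p) (p.2 / 2)}.
  apply: (@choice _ _ (fun (p : C * R) q => 0 < p.2 -> P p.1 p.2 ->
    q \in quarters p.1 p.2 /\ P q (p.2 / 2))) => -[a h] /=.
  have [h_gt0|] := pselect (0 < h); last by exists 0.
  have [Pah|] := pselect (P a h); last by exists 0.
  by have [a' ? ?] := step a h h_gt0 Pah; exists a'.
pose s := fix s n := if n is n'.+1 then (f (s n'), (s n').2 / 2) else (a0, h0).
have s2 n : (s n).2 = h0 / 2 ^+ n.
  elim: n => [|n IH] /=; first by rewrite divr1.
  by rewrite IH exprS invfM mulrA mulrAC.
have s2_gt0 n : 0 < (s n).2 by rewrite s2 divr_gt0// exprn_gt0.
have sP n : P (s n).1 (s n).2.
  by elim: n => [//|n IH] /=; have [] := fP (s n) (s2_gt0 n) IH.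
have sq n := quarterP (ltW (s2_gt0 n)) (proj1 (fP (s n) (s2_gt0 n) (sP n))).
have mono m n : (m <= n)%N ->
    [/\ complex.Re (s m).1 <= complex.Re (s n).1,
        complex.Re (s n).1 + (s n).2 <= complex.Re (s m).1 + (s m).2,
        complex.Im (s m).1 <= complex.Im (s n).1 &
        complex.Im (s n).1 + (s n).2 <= complex.Im (s m).1 + (s m).2].
  elim: n => [|n IH]; first by rewrite leqn0 => /eqP->.
  rewrite leq_eqVlt => /predU1P[->//|/IH[? ? ? ?]].
  have [/= ? ? ? ?] := sq n; split => /=; lra.
have bnd (g : C -> R) : (forall m n, (m <= n)%N -> g (s m).1 <= g (s n).1 /\
       g (s n).1 + (s n).2 <= g (s m).1 + (s m).2) ->
    forall n, g (s n).1 <= sup (range (g \o fst \o s)) <= g (s n).1 + (s n).2.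
  move=> gP n.
  have ub m k : g (s k).1 <= g (s m).1 + (s m).2.
    have := s2_gt0 k; have := s2_gt0 m; case: (leqP m k) => [|/ltnW] /gP[]; lra.
  apply/andP; split.
    by apply: ub_le_sup; [exists (g (s 0).1 + (s 0).2) => _ [k _ <-]; exact: (ub 0%N)|exists n].
  apply: ge_sup; first by exists (g (s 0).1), 0%N.
  by move=> _ [k _ <-]; exact: ub.
pose z : C := Complex (sup (range (@complex.Re R \o fst \o s)))
                      (sup (range (@complex.Im R \o fst \o s))).
have zs n : square (s n).1 (s n).2 z.
  split; apply: bnd => i j /mono[]; lra.
exists z; first exact: zs 0%N.
move=> e e0.
have [n ne] : exists n, h0 / 2 ^+ n < e.
  have [n hn] : exists n : nat, h0 / e < n%:R.
    by eexists; exact: truncnS_gt.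
  exists n; rewrite ltr_pdivrMr ?exprn_gt0// mulrC -ltr_pdivrMr//.
  by rewrite (lt_le_trans hn)// -natrX ler_nat ltnW// ltn_expl.
exists (s n).1, (s n).2; rewrite s2_gt0 s2 ne; split=> //.
  move=> w [/andP[? ?] /andP[? ?]]; have [/= ? ? ? ?] := mono 0%N n (leq0n n).
  have := s2 n; split; lra.
all: by rewrite -s2.
Qed.

Lemma square_rdist a h z w : square a h z -> square a h w -> rnorm (z - w) <= 2 * h.
Proof.
move=> [/andP[? ?] /andP[? ?]] [/andP[? ?] /andP[? ?]].
rewrite (le_trans (ler_rnormReIm _))//.
rewrite ReB ImB.
have ? : `|complex.Re z - complex.Re w| <= h by rewrite ler_distl; lra.
have ? : `|complex.Im z - complex.Im w| <= h by rewrite ler_distl; lra.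
lra.
Qed.

End Bisection.

(** * Goursat's theorem and the Cauchy estimate *)

(** Here x, y, z, w stand for the four inner half-sides of a subdivided square: each is traversed
    once in each direction. *)
Lemma boundary_cancel (U : zmodType) (a b c d e f p q x y z w : U) :
  (a + b) + (c + d) - (e + f) - (p + q) =
  (a + x - y - p) + (b + c - z - x) + (y + w - e - q) + (z + d - f - w).
Proof.
transitivity ((a + b) + (c + d) - (e + f) - (p + q) +
    ((x - x) + (y - y) + (z - z) + (w - w))); first by rewrite !subrr !addr0.
rewrite !opprD !addrA.
by rewrite (ACl (1*9*12*7*2*3*14*10*11*15*5*8*13*4*6*16))/=.
Qed.

Section BoundarySums.
Context {R : realType} {V : normedModType R[i]}.
Local Notation C := R[i].
Implicit Types (g : C -> V) (a h : C).

(* Midpoint sum for the integral of g along the segment from a to a + h; it is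
   exact for affine functions. *)
Definition side_sum g a (h : C) (N : nat) : V :=
  \sum_(k < N) (h / N%:R) *: g (a + h * ((k%:R + 2^-1) / N%:R)).

Definition boundary_sum g a (h : C) (N : nat) : V :=
  side_sum g a h N + side_sum g (a + h) ('i%C * h) N
  - side_sum g (a + 'i%C * h) h N - side_sum g a ('i%C * h) N.

(** The 2N midpoints of a segment are the N midpoints of each of its halves. This equality plays the
    role of the additivity of integrals. *)
Lemma side_sum_split g a h N :
  side_sum g a h (N + N) = side_sum g a (h / 2) N + side_sum g (a + h / 2) (h / 2) N.
Proof.
rewrite /side_sum; case: N => [|N]; first by rewrite !big_ord0 addr0.
rewrite big_split_ord.
have N0 : N.+1%:R != 0 :> C by rewrite pnatr_eq0.
have two0 : 2 != 0 :> C by rewrite pnatr_eq0.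
have D0 : (N.+1 + N.+1)%:R = N.+1%:R * 2 :> C by rewrite natrD mulr_natr mulr2n.
rewrite D0; congr (_ + _); apply: eq_bigr => k _ /=; congr (_ *: g _).
all: rewrite ?natrD; move: (N.+1%:R) N0 => n n0.
all: by field.
Qed.

Lemma boundary_sum_split g a h N :
  boundary_sum g a h (N + N) =
  boundary_sum g a (h / 2) N + boundary_sum g (a + h / 2) (h / 2) N +
  boundary_sum g (a + 'i%C * (h / 2)) (h / 2) N +
  boundary_sum g (a + h / 2 + 'i%C * (h / 2)) (h / 2) N.
Proof.
rewrite /boundary_sum !side_sum_split.
have -> : 'i%C * h / 2 = 'i%C * (h / 2) by rewrite mulrA.
have -> : a + h + 'i%C * (h / 2) = a + h / 2 + 'i%C * (h / 2) + h / 2.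
  by rewrite {1}[h]splitr; ring.
have -> : a + 'i%C * (h / 2) + h / 2 = a + h / 2 + 'i%C * (h / 2) by ring.
have -> : a + h / 2 + h / 2 = a + h by rewrite {3}[h]splitr; ring.
have -> : a + 'i%C * (h / 2) + 'i%C * (h / 2) = a + 'i%C * h.
  by rewrite {3}[h]splitr; ring.
have -> : a + h / 2 + 'i%C * (h / 2) + 'i%C * (h / 2) = a + 'i%C * h + h / 2.
  by rewrite {4}[h]splitr; ring.
exact: boundary_cancel.
Qed.

Lemma side_sumB g1 g2 a h N :
  side_sum (fun z => g1 z - g2 z) a h N = side_sum g1 a h N - side_sum g2 a h N.
Proof.
by rewrite /side_sum -sumrB; apply: eq_bigr => k _; rewrite scalerBr.
Qed.

Lemma boundary_sumB g1 g2 a h N :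
  boundary_sum (fun z => g1 z - g2 z) a h N =
  boundary_sum g1 a h N - boundary_sum g2 a h N.
Proof.
rewrite /boundary_sum !side_sumB !opprD !opprK !addrA.
by rewrite (ACl (1*3*5*7*2*4*6*8)).
Qed.

Lemma sum_midpoints N : \sum_(k < N) (k%:R + 2^-1 : C) = N%:R ^+ 2 / 2.
Proof.
elim: N => [|N IH]; first by rewrite big_ord0 expr0n mul0r.
by rewrite big_ord_recr/= IH -natr1; field.
Qed.

Lemma side_sum_affine (A B : V) a h N : (0 < N)%N ->
  side_sum (fun z => A + z *: B) a h N = h *: A + (a * h + h ^+ 2 / 2) *: B.
Proof.
case: N => // N _; have := sum_midpoints N.+1.
have : N.+1%:R != 0 :> C by rewrite pnatr_eq0.
rewrite /side_sum => N0 S.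
have -> : \sum_(k < N.+1) h / N.+1%:R *:
    (A + (a + h * ((k%:R + 2^-1) / N.+1%:R)) *: B) =
  (\sum_(k < N.+1) h / N.+1%:R) *: A +
  (\sum_(k < N.+1) ((h / N.+1%:R) * a + (h / N.+1%:R) ^+ 2 * (k%:R + 2^-1))) *: B.
  rewrite !scaler_suml -big_split; apply: eq_bigr => k _ /=.
  rewrite scalerDr scalerA; congr (_ + _ *: _).
  by move: (N.+1%:R) N0 => n n0; field.
rewrite big_split/= !sumr_const -mulr_sumr S card_ord -(mulr_natr (h / _)) -(mulr_natr (h / _ * a)).
by move: (N.+1%:R) N0 => n n0; congr (_ *: _ + _ *: _); field.
Qed.

Lemma boundary_sum_affine (A B : V) a h N : (0 < N)%N ->
  boundary_sum (fun z => A + z *: B) a h N = 0.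
Proof.
move=> N0; rewrite /boundary_sum !side_sum_affine//.
have -> (x y z t x' y' z' t' : C) : x *: A + y *: B + (z *: A + t *: B) -
    (x' *: A + y' *: B) - (z' *: A + t' *: B) =
    (x + z - x' - z') *: A + (y + t - y' - t') *: B.
  rewrite !scalerBl !scalerDl !opprD !addrA.
  by rewrite (ACl (1*3*5*7*2*4*6*8)).
have i2 : 'i%C * 'i%C = -1 :> C by rewrite -expr2 sqr_i.
have -> : a * h + h ^+ 2 / 2 + ((a + h) * ('i%C * h) + ('i%C * h) ^+ 2 / 2) -
   ((a + 'i%C * h) * h + h ^+ 2 / 2) - (a * ('i%C * h) + ('i%C * h) ^+ 2 / 2) = 0.
  by ring.
by rewrite scale0r addr0 (_ : _ - _ - _ = 0) ?scale0r//; ring.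
Qed.

Lemma rnorm_side_sum g a h N (M : R) :
  (forall t : R, 0 <= t <= 1 -> rnorm (g (a + h * t%:C%C)) <= M) ->
  rnorm (side_sum g a h N) <= rnorm h * M.
Proof.
move=> gM; have M0 : 0 <= M.
  by rewrite (le_trans _ (gM 0 _)) ?rnorm_ge0// lexx ler01.
rewrite (le_trans (rnorm_sum _ _ _))//.
case: N => [|N]; first by rewrite big_ord0 mulr_ge0// rnorm_ge0.
apply: (@le_trans _ _ (\sum_(k < N.+1) (rnorm h / N.+1%:R * M))); last first.
  by rewrite sumr_const card_ord -(mulr_natr (_ * M)) mulrAC divfK ?pnatr_eq0.
apply: ler_sum => k _; rewrite rnormZ ler_pM ?rnorm_ge0//.
  by rewrite rnormM rnormV -(rmorph_nat (real_complex R)) rnormC normr_nat.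
have -> : (k%:R + 2^-1) / N.+1%:R = ((k%:R + 2^-1) / N.+1%:R)%:C%C :> C.
  by rewrite rmorphM rmorphD !fmorphV !rmorph_nat.
apply: gM; rewrite divr_ge0 ?addr_ge0//= ler_pdivrMr ?ltr0n// mul1r.
rewrite -(natr1 N) lerD ?ler_nat//; first by rewrite -ltnS ltn_ord.
lra.
Qed.

Definition square_boundary a (r : R) : set C :=
  [set z | square a r z /\
    [\/ complex.Re z = complex.Re a, complex.Re z = complex.Re a + r,
        complex.Im z = complex.Im a | complex.Im z = complex.Im a + r]].

Lemma rnorm_boundary_sum g a (r : R) N (M : R) : 0 <= r ->
  (forall z, square_boundary a r z -> rnorm (g z) <= M) ->
  rnorm (boundary_sum g a r%:C%C N) <= 4 * r * M.
Proof.
move=> r0 gM.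
have rr : rnorm (r%:C%C : C) = r by rewrite rnormC ger0_norm.
have ri : rnorm ('i%C * r%:C%C : C) = r by rewrite rnormM rnormi mul1r rr.
have -> : 4 * r * M = r * M + r * M + r * M + r * M by ring.
have bd a' h' : rnorm h' = r -> (forall t : R, 0 <= t <= 1 ->
    rnorm (g (a' + h' * t%:C%C)) <= M) -> rnorm (side_sum g a' h' N) <= r * M.
  by move=> <-; exact: rnorm_side_sum.
have rt (t : R) : 0 <= t <= 1 -> 0 <= r * t <= r by move=> /andP[? ?]; nra.
rewrite /boundary_sum (le_trans (ler_rnormB _ _))// lerD//; last first.
  apply: bd ri _ => t /rt ?; apply: gM.
  case: a => x y; split; last by apply: Or41 => /=; ring.
  by split => /=; lra.
rewrite (le_trans (ler_rnormB _ _))// lerD//; last first.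
  apply: bd rr _ => t /rt ?; apply: gM.
  case: a => x y; split; last by apply: Or44 => /=; ring.
  by split => /=; lra.
rewrite (le_trans (ler_rnormD _ _))// lerD//.
  apply: bd rr _ => t /rt ?; apply: gM.
  case: a => x y; split; last by apply: Or43 => /=; ring.
  by split => /=; lra.
apply: bd ri _ => t /rt ?; apply: gM.
case: a => x y; split; last by apply: Or42 => /=; ring.
by split => /=; lra.
Qed.

End BoundarySums.

Section Goursat.
Context {R : realType} {V : normedModType R[i]}.
Local Notation C := R[i].
Implicit Types (f g : C -> V) (z : C).

Lemma nbhs_rnormP (W : normedModType C) (w : W) (P : set W) :
  nbhs w P <-> exists2 d : R, 0 < d & forall v, rnorm (v - w) < d -> P v.
Proof.
split=> [/nbhs_normP[e /= e0 eP]|[d d0 dP]].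
  exists (complex.Re e); first by move: e0; rewrite ltcE => /andP[].
  move=> v vw; apply: eP; rewrite /= distrC rnormE.
  by rewrite -(RRe_real (gtr0_real e0)) ltcR.
apply/nbhs_normP; exists d%:C%C; rewrite /= ?ltcR//.
by move=> v /=; rewrite distrC rnormE ltcR => /dP.
Qed.

Lemma cvg_rnormP (T : Type) (F : set_system T) {FF : Filter F}
    (W : normedModType C) (f : T -> W) (w : W) :
  f @ F --> w <-> forall e : R, 0 < e -> \forall t \near F, rnorm (f t - w) < e.
Proof.
split=> [fw e e0|fP P /nbhs_rnormP[d d0 dP]].
  by apply: (fw [set v | rnorm (v - w) < e]); apply/nbhs_rnormP; exists e.
by apply: filterS (fP d d0) => t /dP.
Qed.

(* R[i] has its normed topology only through its alias R[i]^o. *)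
Definition cnbhs z : set_system C := nbhs (z : C^o).

#[local] Instance cnbhs_filter z : ProperFilter (cnbhs z).
Proof. exact: (@nbhs_pfilter R[i]^o z). Qed.

Lemma cnbhs_rnormP z (P : set C) :
  cnbhs z P <-> exists2 d : R, 0 < d & forall v, rnorm (v - z) < d -> P v.
Proof. exact: (@nbhs_rnormP C^o). Qed.

(* Caratheodory's form of differentiability. *)
Definition cdiff f z (B : V) : Prop := exists2 phi : C -> V,
  phi w @[w --> cnbhs z] --> B &
  \forall w \near cnbhs z, f w = f z + (w - z) *: phi w.

Lemma cdiffP f z B : cdiff f z B -> forall e : R, 0 < e -> exists2 d : R, 0 < d &
  forall w, rnorm (w - z) < d -> rnorm (f w - f z - (w - z) *: B) <= e * rnorm (w - z).
Proof.
move=> [phi /cvg_rnormP phiB fphi] e e0.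
have /cnbhs_rnormP[d d0 dP] : cnbhs z
   [set w | f w = f z + (w - z) *: phi w /\ rnorm (phi w - B) < e].
  by apply: filterI fphi _; exact: phiB.
exists d => // w /dP[-> /ltW wB].
by rewrite [f z + _]addrC addrK -scalerBr rnormZ mulrC ler_wpM2r// rnorm_ge0.
Qed.

Lemma cdiffB_cst f z B (v : V) : cdiff f z B -> cdiff (fun w => f w - v) z B.
Proof.
move=> [phi phiB fphi]; exists phi => //.
by apply: filterS fphi => w ->; rewrite addrAC.
Qed.

Lemma cdiff_invZ f z B : z != 0 -> cdiff f z B ->
  cdiff (fun w => w^-1 *: f w) z (z^-1 *: (B - z^-1 *: f z)).
Proof.
move=> z0 [phi phiB fphi].
(* From f(w)/w - f(z)/z = (w - z) (phi(w) - f(z)/z)/w. *)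
exists (fun w => w^-1 *: (phi w - z^-1 *: f z)).
  have zid : (w : C^o) @[w --> cnbhs z] --> (z : C^o) by exact: cvg_id.
  have zV : (w^-1 : C^o) @[w --> cnbhs z] --> (z^-1 : C^o) by apply: cvgV.
  apply: cvgZ => //; apply: cvgB => //; exact: cvg_cst.
have w0 : \forall w \near cnbhs z, w != 0.
  apply/cnbhs_rnormP; exists (rnorm z); first exact: rnorm_gt0.
  by move=> w; apply: contraTneq => ->; rewrite sub0r rnormN ltxx.
apply: filterS2 w0 fphi => w w0 ->.
rewrite scalerDr !scalerA scalerBr !scalerA addrCA [LHS]addrC [w^-1 * _]mulrC.
by rewrite -scalerBl; congr (_ + _ *: _); field; rewrite z0 w0.
Qed.

(** Subtracting the tangent affine map at z does not change the boundary sum; what remains is at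
    most e * 2h on a perimeter of length 4h. *)
Lemma boundary_sum_small f z B a (h e d : R) N : 0 < h -> 0 <= e -> (0 < N)%N ->
  square a h z -> 2 * h < d ->
  (forall w, rnorm (w - z) < d -> rnorm (f w - f z - (w - z) *: B) <= e * rnorm (w - z)) ->
  rnorm (boundary_sum f a h%:C%C N) <= 8 * e * h ^+ 2.
Proof.
move=> h0 e0 N0 az hd fP.
have -> : boundary_sum f a h%:C%C N =
    boundary_sum (fun w => f w - ((f z - z *: B) + w *: B)) a h%:C%C N.
  by rewrite boundary_sumB boundary_sum_affine// subr0.
rewrite (_ : 8 * e * h ^+ 2 = 4 * h * (e * (2 * h))); last by ring.
apply: rnorm_boundary_sum; first exact: ltW.
move=> w [aw _].
have wz : rnorm (w - z) <= 2 * h by exact: square_rdist aw az.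
rewrite (_ : _ - _ = f w - f z - (w - z) *: B).
  by rewrite (le_trans (fP _ _)) ?ler_wpM2l// (le_lt_trans wz).
by rewrite scalerBl !opprD !opprK !addrA addrAC.
Qed.

(** The property bisected is that, for every m, some N makes the sum at resolution N * 2^m exceed
    e/h^2 times the squared side. Raising m only replaces N by a multiple, so thresholds for the
    four quarters combine into their sum; a square all of whose quarters are good is therefore
    good. *)
Lemma goursat f a (h : R) : 0 < h ->
  (forall z, square a h z -> exists B, cdiff f z B) ->
  forall e, 0 < e -> exists m, forall N, (0 < N)%N ->
    rnorm (boundary_sum f a h%:C%C (N * 2 ^ m)) <= e.
Proof.
move=> h0 fdiff e e0; apply: contrapT => /forallNP bad.
pose P a' h' := forall m, exists2 N, (0 < N)%N &
  e / h ^+ 2 * h' ^+ 2 < rnorm (boundary_sum f a' h'%:C%C (N * 2 ^ m)).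
have P0 : P a h.
  move=> m; have /existsNP[N /not_implyP[N0 /negP]] := bad m.
  by rewrite -ltNge => ?; exists N => //; rewrite divfK// gt_eqF// exprn_gt0.
have [|z az zP] := @bisection R P a h h0 P0.
  move=> a' h' h'0 Pah; apply: contrapT => noq.
  have good a'' : a'' \in quarters a' h' -> exists m, forall N, (0 < N)%N ->
     rnorm (boundary_sum f a'' (h' / 2)%:C%C (N * 2 ^ m)) <= e / h ^+ 2 * (h' / 2) ^+ 2.
    move=> qa''; apply: contrapT => /forallNP nogood; apply: noq; exists a'' => //.
    move=> m; have /existsNP[N /not_implyP[N0 /negP]] := nogood m.
    by rewrite -ltNge => ?; exists N.
  have [|m1 m1P] := good a'; first by rewrite !inE eqxx.
  have [|m2 m2P] := good (a' + (h' / 2)%:C%C); first by rewrite !inE eqxx !orbT.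
  have [|m3 m3P] := good (a' + 'i%C * (h' / 2)%:C%C); first by rewrite !inE eqxx !orbT.
  have [|m4 m4P] := good (a' + (h' / 2)%:C%C + 'i%C * (h' / 2)%:C%C).
    by rewrite !inE eqxx !orbT.
  pose m := (m1 + m2 + m3 + m4)%N.
  (* One doubling more than [m], spent on splitting the square into its quarters. *)
  have [N N0] := Pah m.+1; apply/negP; rewrite -leNgt.
  have pw i j : (0 < N * 2 ^ (m - i) + j)%N by rewrite addn_gt0 muln_gt0 N0 expn_gt0.
  have mE i : (i <= m)%N -> (N * 2 ^ m = (N * 2 ^ (m - i)) * 2 ^ i)%N.
    by move=> im; rewrite -mulnA -expnD subnK.
  have NE i : (0 < N * 2 ^ (m - i))%N by rewrite muln_gt0 N0 expn_gt0.
  have -> : (N * 2 ^ m.+1 = N * 2 ^ m + N * 2 ^ m)%N by rewrite expnS mulnCA mul2n addnn.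
  have h2 : h'%:C%C / 2 = (h' / 2)%:C%C :> C by rewrite rmorphM fmorphV rmorph_nat.
  rewrite boundary_sum_split h2.
  have -> : e / h ^+ 2 * h' ^+ 2 = e / h ^+ 2 * (h' / 2) ^+ 2 + e / h ^+ 2 * (h' / 2) ^+ 2
     + e / h ^+ 2 * (h' / 2) ^+ 2 + e / h ^+ 2 * (h' / 2) ^+ 2.
    by field; rewrite gt_eqF.
  rewrite (le_trans (ler_rnormD _ _))// lerD//; last first.
    by rewrite (mE m4) ?m4P// /m leq_addl.
  rewrite (le_trans (ler_rnormD _ _))// lerD//; last first.
    by rewrite (mE m3) ?m3P// /m addnAC leq_addl.
  rewrite (le_trans (ler_rnormD _ _))// lerD//.
    by rewrite (mE m1) ?m1P// /m -!addnA leq_addr.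
  by rewrite (mE m2) ?m2P// /m -!addnA addnCA leq_addr.
have [B fB] := fdiff z az.
(* [boundary_sum_small] multiplies this by 8, which leaves half of what a bad square exceeds. *)
have [|d d0 dP] := cdiffP fB (e := e / h ^+ 2 / 16).
  by rewrite !divr_gt0// exprn_gt0.
have [|a' [h' [/andP[h'0 h'd] _ a'z]]] := zP (d / 2); first by rewrite divr_gt0.
move=> /(_ 0%N)[N N0]; apply/negP; rewrite -leNgt muln1.
have k0 : 0 <= e / h ^+ 2 by rewrite divr_ge0 ?exprn_ge0 ?ltW.
rewrite (le_trans (@boundary_sum_small f z B a' h' _ d N h'0 _ N0 a'z _ dP))//.
- by rewrite divr_ge0.
- by rewrite mulrC -ltr_pdivlMr.
have : 0 <= e / h ^+ 2 * h' ^+ 2 by rewrite mulr_ge0// exprn_ge0// ltW.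
rewrite (_ : 8 * _ * _ = e / h ^+ 2 * h' ^+ 2 / 2); first lra.
by field; rewrite gt_eqF.
Qed.

End Goursat.

Section Small.
Context {R : realType} {V : normedModType R[i]}.
Local Notation C := R[i].
Implicit Types (F G : nat -> V).

(* Convergence to 0 along the powers of 2, uniformly in their odd multiples. *)
Definition dyadic_small F := forall e : R, 0 < e ->
  exists m, forall N, (0 < N)%N -> rnorm (F (N * 2 ^ m)%N) <= e.

Lemma dyadic_smallD F G : dyadic_small F -> dyadic_small G ->
  dyadic_small (fun N => F N + G N).
Proof.
move=> sF sG e e0; have e20 : 0 < e / 2 by rewrite divr_gt0.
have [m mP] := sF _ e20; have [n nP] := sG _ e20; exists (m + n)%N => N N0.
rewrite (le_trans (ler_rnormD _ _))// [leRHS]splitr lerD//.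
  by rewrite addnC expnD mulnA mP// muln_gt0 N0 expn_gt0.
by rewrite expnD mulnA nP// muln_gt0 N0 expn_gt0.
Qed.

Lemma dyadic_smallMn F k : (0 < k)%N -> dyadic_small F ->
  dyadic_small (fun N => F (k * N)%N).
Proof.
move=> k0 sF e /sF[m mP]; exists m => N N0.
by rewrite mulnA mP// muln_gt0 k0.
Qed.

Lemma dyadic_small_double F :
  dyadic_small (fun N => F (N + N)%N) -> dyadic_small F.
Proof.
move=> sF e /sF[m mP]; exists m.+1 => N N0.
by rewrite expnS mulnCA mul2n -addnn mP.
Qed.

Lemma eq_dyadic_small F G : F =1 G -> dyadic_small F -> dyadic_small G.
Proof. by move=> FG sF e /sF[m mP]; exists m => N /mP; rewrite FG. Qed.

End Small.

Lemma sumB4 (U : zmodType) (p q p' q' s t s' t' : U) :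
  p - q + (p' - q') + (s - t) + (s' - t') = p + p' + s + s' - (q + q' + t + t').
Proof. by rewrite !opprD !addrA [LHS](ACl (1*3*5*7*2*4*6*8)). Qed.

(** * Shrinking squares around an exceptional point, and Cauchy's formula *)

Section Annulus.
Context {R : realType} {V : normedModType R[i]}.
Local Notation C := R[i].
Implicit Types (f g : C -> V) (z : C).

(** Lower-left corner of the square of half-side r centred at 0. *)
Definition corner (r : R) : C := Complex (- r) (- r).

Definition centered_sum g (r : R) N := boundary_sum g (corner r) (2 * r)%:C%C N.

(** Goursat's theorem disposes of three quarters; quarter j is the one that may contain the
    exceptional point. *)
Lemma quarter_diff g a (h : R) j : 0 < h -> (j < 4)%N ->
  (forall i, (i < 4)%N -> i != j -> forall z, square (quarters a h)`_i (h / 2) z ->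
    exists B, cdiff g z B) ->
  dyadic_small (fun N => boundary_sum g a h%:C%C (N + N)
                       - boundary_sum g (quarters a h)`_j (h / 2)%:C%C N).
Proof.
move=> h0 j4 gQ; have h20 : 0 < h / 2 by rewrite divr_gt0.
have sm i : (i < 4)%N -> i != j ->
    dyadic_small (boundary_sum g (quarters a h)`_i (h / 2)%:C%C).
  by move=> i4 ij; apply: goursat => //; exact: gQ.
have h2 : h%:C%C / 2 = (h / 2)%:C%C :> C by rewrite rmorphM fmorphV rmorph_nat.
have E := boundary_sum_split g a h%:C%C; rewrite h2 in E.
case: j j4 gQ sm => [|[|[|[|//]]]] _ _ sm.
- apply: eq_dyadic_small (dyadic_smallD (dyadic_smallD (sm 1%N _ _) (sm 2%N _ _)) (sm 3%N _ _)) => // N.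
  by rewrite E /= [RHS](ACl ((1*5)*2*3*4))/= subrr add0r.
- apply: eq_dyadic_small (dyadic_smallD (dyadic_smallD (sm 0%N _ _) (sm 2%N _ _)) (sm 3%N _ _)) => // N.
  by rewrite E /= [RHS](ACl (1*3*4*(2*5))) /= subrr addr0.
- apply: eq_dyadic_small (dyadic_smallD (dyadic_smallD (sm 0%N _ _) (sm 1%N _ _)) (sm 3%N _ _)) => // N.
  by rewrite E /= [RHS](ACl (1*2*4*(3*5))) /= subrr addr0.
- apply: eq_dyadic_small (dyadic_smallD (dyadic_smallD (sm 0%N _ _) (sm 1%N _ _)) (sm 2%N _ _)) => // N.
  by rewrite E /= addrK.
Qed.

(** The point 0 is a corner of all four quarters, so one subdivision does not isolate it. Quarter j
    meets 0 only through its own quarter 3 - j, and these four small squares are the quarters of the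
    centred square of half the size. *)
Lemma annulus_step g (r : R) : 0 < r ->
  (forall z, square (corner r) (2 * r) z -> z != 0 -> exists B, cdiff g z B) ->
  dyadic_small (fun N => centered_sum g r (N + N) - centered_sum g (r / 2) N).
Proof.
move=> r0 gdiff.
have Q j i : (j < 4)%N -> (i < 4)%N -> i != (3 - j)%N ->
    forall z, square (quarters (quarters (corner r) (2 * r))`_j r)`_i (r / 2) z ->
    exists B, cdiff g z B.
  move=> j4 i4 ij [x y] zQ; apply: gdiff.
    move: j4 i4 ij zQ; case: j => [|[|[|[|//]]]] _; case: i => [|[|[|[|//]]]] _ //= _;
    rewrite /square/=; move=> [/andP[? ?] /andP[? ?]]; split; apply/andP; split; lra.
  apply/eqP => -[x0 y0]; rewrite {}x0 {}y0 in zQ; move: zQ.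
  move: j4 i4 ij; case: j => [|[|[|[|//]]]] _; case: i => [|[|[|[|//]]]] _ //= _;
    rewrite /square/=; move=> [/andP[? ?] /andP[? ?]]; lra.
(* The large square is split twice and the small one once, so the resolution must be doubled. *)
apply: dyadic_small_double.
have h2 : (2 * r)%:C%C / 2 = r%:C%C :> C by rewrite rmorphM/= rmorph_nat mulrC mulKf// pnatr_eq0.
have r2 : r%:C%C / 2 = (r / 2)%:C%C :> C by rewrite rmorphM fmorphV rmorph_nat.
have D j : (j < 4)%N -> dyadic_small (fun N =>
    boundary_sum g (quarters (corner r) (2 * r))`_j r%:C%C (N + N) -
    boundary_sum g (quarters (quarters (corner r) (2 * r))`_j r)`_(3 - j) (r / 2)%:C%C N).
  move=> j4; apply: quarter_diff => //; first by rewrite ltnS leq_subr.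
  by move=> i i4 ij; exact: Q.
apply: eq_dyadic_small (dyadic_smallD (dyadic_smallD (dyadic_smallD
  (D 0%N isT) (D 1%N isT)) (D 2%N isT)) (D 3%N isT)) => N.
rewrite /centered_sum (_ : 2 * (r / 2) = r); last by field.
have rr : 2 * r / 2 = r by field.
have cE j : (j < 4)%N -> (quarters (quarters (corner r) (2 * r))`_j r)`_(3 - j) =
    (quarters (corner (r / 2)) r)`_j.
  by case: j => [|[|[|[|//]]]] _; apply/eqP; rewrite /= eq_complex/=;
    apply/andP; split; apply/eqP; field.
rewrite !cE// (boundary_sum_split g (corner r)) (boundary_sum_split g (corner (r / 2))).
rewrite h2 r2 /= rr; exact: sumB4.
Qed.

(** Both sums have the same mesh: dividing the side by 2^j goes with dividing the number of nodes
    per side by 2^j. *)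
Lemma annulus_iter g (r : R) j : 0 < r ->
  (forall z, square (corner r) (2 * r) z -> z != 0 -> exists B, cdiff g z B) ->
  dyadic_small (fun N => centered_sum g r (2 ^ j * N) - centered_sum g (r / 2 ^+ j) N).
Proof.
elim: j r => [|j IH] r r0 gdiff.
  move=> e e0; exists 0%N => N _.
  by rewrite mul1n divr1 subrr rnorm0 ltW.
have r20 : 0 < r / 2 by rewrite divr_gt0.
have gdiff2 z : square (corner (r / 2)) (2 * (r / 2)) z -> z != 0 -> exists B, cdiff g z B.
  rewrite /square/= => -[/andP[? ?] /andP[? ?]] z0; apply: gdiff => //=.
  by split => /=; apply/andP; split; lra.
have k0 : (0 < 2 ^ j)%N by rewrite expn_gt0.
apply: eq_dyadic_small (dyadic_smallD (dyadic_smallMn k0 (annulus_step r0 gdiff))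
  (IH _ r20 gdiff2)) => N /=.
by rewrite addrA subrK addnn -mul2n mulnA -expnS exprS invfM mulrA.
Qed.

(** On the boundary |z| >= r, and the perimeter is 8r: the bound is independent of r, so it can be
    used on a shrinking square. *)
Lemma centered_sum_invZ_le g (r : R) N (M : R) : 0 < r ->
  (forall z, square_boundary (corner r) (2 * r) z -> rnorm (g z) <= M) ->
  rnorm (centered_sum (fun z => z^-1 *: g z) r N) <= 8 * M.
Proof.
move=> r0 gM; have -> : 8 * M = 4 * (2 * r) * (r^-1 * M) by field; rewrite gt_eqF.
apply: rnorm_boundary_sum => [|z zb]; first by rewrite mulr_ge0// ltW.
rewrite rnormZ ler_pM ?rnorm_ge0 ?gM// rnormV.
have rz : r <= rnorm z.
  have r2 : - r + 2 * r = r by ring.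
  have re := ger_rnormRe z; have im := ger_rnormIm z.
  case: zb => _ /= [] zr; [apply: le_trans re|apply: le_trans re|apply: le_trans im|apply: le_trans im];
    by rewrite zr ?r2 ?normrN ger0_norm// ltW.
by rewrite lef_pV2 ?posrE// (lt_le_trans r0).
Qed.

End Annulus.

Section Winding.
Context {R : realType}.
Local Notation C := R[i].

(* The exact value tends to 2 pi i; a lower bound independent of N suffices. *)
Lemma winding_lb (r : R) N : 0 < r -> (0 < N)%N ->
  4 <= rnorm (centered_sum (fun z : C => (z^-1 : C^o)) r N : C).
Proof.
move=> r0; case: N => // N _.
pose x k : R := - r + 2 * r * ((k%:R + 2^-1) / N.+1%:R).
(* The k-th nodes of the four sides are grouped: their real parts cancel, and each side contributes
   i r / (x_k^2 + r^2) times the mesh. *)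
have -> : centered_sum (fun z : C => (z^-1 : C^o)) r N.+1 =
    'i%C * (\sum_(k < N.+1) (2 * r / N.+1%:R) * (4 * r / (x k ^+ 2 + r ^+ 2)))%:C%C :> C.
  rewrite /centered_sum /boundary_sum /side_sum -big_split -2!sumrB.
  rewrite rmorph_sum mulr_sumr; apply: eq_bigr => k _ /=.
  have N0 : N.+1%:R != 0 :> R by rewrite pnatr_eq0.
  have tE : (k%:R + 2^-1) / N.+1%:R = ((k%:R + 2^-1) / N.+1%:R)%:C%C :> C.
    by rewrite rmorphM rmorphD !fmorphV !rmorph_nat.
  have hE : (2 * r)%:C%C / N.+1%:R = (2 * r / N.+1%:R)%:C%C :> C.
    by rewrite [RHS]rmorphM fmorphV rmorph_nat.
  have D : x k ^+ 2 + r ^+ 2 != 0 by rewrite gt_eqF// ltr_wpDl ?sqr_ge0 ?exprn_gt0.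
  have D' : r ^+ 2 + x k ^+ 2 != 0 by rewrite addrC.
  rewrite -(mulrA 'i%C) hE tE /corner.
  have -> : Complex (- r) (- r) + (2 * r)%:C%C * ((k%:R + 2^-1) / N.+1%:R)%:C%C =
            Complex (x k) (- r).
    by apply/eqP; rewrite eq_complex/= /x; apply/andP; split; apply/eqP; ring.
  set t := (k%:R + 2^-1) / N.+1%:R.
  have -> : Complex (- r) (- r) + (2 * r)%:C%C + 'i%C * (2 * r)%:C%C * t%:C%C =
            Complex r (x k).
    by apply/eqP; rewrite eq_complex/= /x -/t; apply/andP; split; apply/eqP; ring.
  have -> : Complex (- r) (- r) + 'i%C * (2 * r)%:C%C + (2 * r)%:C%C * t%:C%C =
            Complex (x k) r.
    by apply/eqP; rewrite eq_complex/= /x -/t; apply/andP; split; apply/eqP; ring.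
  have -> : Complex (- r) (- r) + 'i%C * (2 * r)%:C%C * t%:C%C = Complex (- r) (x k).
    by apply/eqP; rewrite eq_complex/= /x -/t; apply/andP; split; apply/eqP; ring.
  have iE (a b : R) : (Complex a b)^-1 =
    Complex (a / (a ^+ 2 + b ^+ 2)) (- (b / (a ^+ 2 + b ^+ 2))) by [].
  rewrite !iE; apply/eqP; rewrite eq_complex/= !sqrrN.
  move: (x k) D D' => y D D'; clear x tE hE t.
  move: (N.+1%:R) N0 => n N0.
  by apply/andP; split; apply/eqP; field; rewrite ?D ?D' ?N0.
rewrite rnormM rnormi mul1r rnormC ger0_norm; last first.
  apply: sumr_ge0 => k _.
  by rewrite mulr_ge0 ?divr_ge0 ?mulr_ge0 ?addr_ge0 ?sqr_ge0// ltW.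
(* As x_k^2 <= r^2, each summand is at least (8 r^2 / (2 r^2)) / (N + 1). *)
rewrite [leLHS](_ : 4 = \sum_(k < N.+1) 4 / N.+1%:R); last first.
  by rewrite sumr_const card_ord -(mulr_natr (4 / _)) divfK// pnatr_eq0.
apply: ler_sum => k _.
have t01 : 0 <= (k%:R + 2^-1 : R) / N.+1%:R <= 1.
  rewrite divr_ge0 ?addr_ge0//= ler_pdivrMr ?ltr0n// mul1r.
  rewrite -(natr1 N) lerD ?ler_nat//; first by rewrite -ltnS ltn_ord.
  lra.
have xr : x k ^+ 2 <= r ^+ 2.
  move: t01; rewrite /x; set t := (_ / _) => /andP[t0 t1].
  have -> : (- r + 2 * r * t) ^+ 2 = r ^+ 2 - 4 * r ^+ 2 * (t * (1 - t)) by ring.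
  by rewrite gerBl !mulr_ge0 ?subr_ge0// ltW.
have -> : 2 * r / N.+1%:R * (4 * r / (x k ^+ 2 + r ^+ 2)) =
   8 * r ^+ 2 / (x k ^+ 2 + r ^+ 2) / N.+1%:R by ring.
rewrite ler_wpM2r ?invr_ge0// ler_pdivlMr ?ltr_wpDl ?sqr_ge0 ?exprn_gt0//.
lra.
Qed.

End Winding.

Section CauchyEstimate.
Context {R : realType} {V : normedModType R[i]}.
Local Notation C := R[i].
Implicit Types (f g : C -> V) (z : C).

Lemma centered_sum_scale (v : V) (r : R) N :
  centered_sum (fun z => z^-1 *: v) r N =
  centered_sum (fun z : C => (z^-1 : C^o)) r N *: v.
Proof.
have sE a (h : C) : side_sum (fun z => z^-1 *: v) a h N =
    side_sum (fun z : C => (z^-1 : C^o)) a h N *: v.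
  by rewrite /side_sum scaler_suml; apply: eq_bigr => k _; rewrite scalerA.
by rewrite /centered_sum /boundary_sum !sE -scalerDl -!scalerBl.
Qed.

(** Cauchy's formula for g(0), up to a constant: the sum of g(z)/z is at most 8M on the outer
    square, and the sum of 1/z is at least 4 in modulus on the inner one. Only continuity is asked
    at 0, because g will be a difference quotient there. *)
Lemma rnorm_center_le g (r M : R) : 0 < r ->
  (forall z, square (corner r) (2 * r) z -> z != 0 -> exists B, cdiff g z B) ->
  (forall e, 0 < e -> exists2 d : R, 0 < d &
    forall w, rnorm w < d -> rnorm (g w - g 0) <= e) ->
  (forall z, square_boundary (corner r) (2 * r) z -> rnorm (g z) <= M) ->
  rnorm (g 0) <= 2 * M.
Proof.
move=> r0 gdiff g0 gM; rewrite -(ler_pM2l (ltr0Sn R 3)).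
(* One ninth for the passage between the two squares, eight for replacing g by g(0) on the inner
   one, by [centered_sum_invZ_le]. *)
apply/ler_addgt0Pl => e e0; have e90 : 0 < e / 9 by rewrite divr_gt0.
have [d d0 dP] := g0 _ e90.
have [j jd] : exists j, r / 2 ^+ j * 2 < d.
  have [j jP] : exists j : nat, r * 2 / d < j%:R by eexists; exact: truncnS_gt.
  exists j; rewrite mulrAC ltr_pdivrMr ?exprn_gt0// [d * _]mulrC -ltr_pdivrMr//.
  by rewrite (lt_trans jP)// -natrX ltr_nat ltn_expl.
set s := r / 2 ^+ j in jd; have s0 : 0 < s by rewrite divr_gt0// exprn_gt0.
have gZ z : square (corner r) (2 * r) z -> z != 0 ->
    exists B, cdiff (fun z => z^-1 *: g z) z B.
  by move=> zr z0; have [B gB] := gdiff z zr z0; eexists; exact: (cdiff_invZ z0 gB).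
have [m mP] := annulus_iter j r0 gZ e90.
have N0 : (0 < 2 ^ m)%N by rewrite expn_gt0.
have {mP} := mP 1%N isT; rewrite mul1n -/s; set N := (2 ^ m)%N in N0 *.
have W := winding_lb s0 N0; move: W (centered_sum_scale (g 0) s N).
set c : C := centered_sum (fun z : C => (z^-1 : C^o)) s N => W cE cr.
have cg0 : rnorm (centered_sum (fun z => z^-1 *: (g z - g 0)) s N) <= 8 * (e / 9).
  apply: (@centered_sum_invZ_le _ _ (fun z => g z - g 0)) => // z [zs _].
  apply: dP; rewrite (le_lt_trans _ jd)// mulrC -[z]subr0.
  have -> : 2 * s = s + s by ring.
  rewrite (le_trans (ler_rnormReIm _))// subr0.
  by move: zs; rewrite /square/= => -[/andP[? ?] /andP[? ?]]; rewrite lerD// ler_norml; lra.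
have cE' : c *: g 0 = centered_sum (fun z => z^-1 *: g z) r (2 ^ j * N) -
  (centered_sum (fun z => z^-1 *: g z) r (2 ^ j * N) - centered_sum (fun z => z^-1 *: g z) s N)
  - centered_sum (fun z => z^-1 *: (g z - g 0)) s N.
  rewrite subKr -cE /centered_sum -boundary_sumB.
  congr (boundary_sum _ _ _ _); apply/funext => z.
  by rewrite scalerBr subKr.
apply: (@le_trans _ _ (rnorm (c *: g 0))); first by rewrite rnormZ ler_wpM2r// rnorm_ge0.
rewrite cE' (le_trans (ler_rnormB _ _))//.
have -> : e + 4 * (2 * M) = 8 * M + e / 9 + 8 * (e / 9) by field.
rewrite lerD// (le_trans (ler_rnormB _ _))// lerD//.
exact: centered_sum_invZ_le.
Qed.

Lemma near_cdiff f g z B : (\forall w \near cnbhs z, f w = g w) -> f z = g z ->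
  cdiff f z B -> cdiff g z B.
Proof.
move=> fg fgz [phi phiB fphi]; exists phi => //.
by apply: filterS2 fg fphi => w <- ->; rewrite fgz.
Qed.

Lemma cdiff_shift f z B : cdiff (fun t => f (z + t)) 0 B -> cdiff f z B.
Proof.
move=> [phi /cvg_rnormP phiB /cnbhs_rnormP[d d0 fphi]].
exists (fun w => phi (w - z)).
  apply/cvg_rnormP => e /phiB/cnbhs_rnormP[d' d'0 dP].
  by apply/cnbhs_rnormP; exists d' => // w wz; apply: dP; rewrite subr0.
apply/cnbhs_rnormP; exists d => // w wz.
by have := fphi (w - z); rewrite subr0 addr0 subrKC; apply.
Qed.

(** The difference quotient at 0, completed by the value B, is at most 2M/r on the boundary;
    [rnorm_center_le] doubles this. *)
Lemma cauchy_derivative f (r M : R) B : 0 < r ->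
  (forall z, square (corner r) (2 * r) z -> exists B, cdiff f z B) ->
  (forall z, square (corner r) (2 * r) z -> rnorm (f z) <= M) ->
  cdiff f 0 B -> rnorm B <= 4 * M / r.
Proof.
move=> r0 fdiff fM fB.
pose g z := if z == 0 then B else z^-1 *: (f z - f 0).
have g0 : g 0 = B by rewrite /g eqxx.
have s0 : square (corner r) (2 * r) 0 by split => /=; apply/andP; split; lra.
rewrite -g0 (_ : 4 * M / r = 2 * (2 * M / r)); last by ring.
apply: (@rnorm_center_le g r) => //.
- move=> z zs z0; have [B' fB'] := fdiff z zs.
  eexists; apply: near_cdiff (cdiff_invZ z0 (cdiffB_cst (f 0) fB')).
    apply/cnbhs_rnormP; exists (rnorm z); first exact: rnorm_gt0.
    move=> w; rewrite /g; case: eqP => // ->.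
    by rewrite sub0r rnormN ltxx.
  by rewrite /g (negbTE z0).
- move=> e e0; have [d d0 dP] := cdiffP fB e0; exists d => // w wd.
  rewrite g0 /g; case: eqVneq => [_|w0]; first by rewrite subrr rnorm0 ltW.
  have := dP w; rewrite subr0 => /(_ wd) H.
  rewrite -(ler_pM2l (rnorm_gt0 w0)) -rnormZ [leRHS]mulrC.
  by rewrite scalerBr scalerA divff// scale1r.
- move=> z [zs zb]; have z0 : z != 0.
    apply: contraPneq zb => -> /=; case; lra.
  rewrite /g (negbTE z0) rnormZ rnormV mulrC.
  rewrite ler_pM ?invr_ge0 ?rnorm_ge0//.
    rewrite (le_trans (ler_rnormB _ _))// (_ : 2 * M = M + M); last by ring.
    by rewrite lerD// fM.
  have rz : r <= rnorm z.
    have r2 : - r + 2 * r = r by ring.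
    have re := ger_rnormRe z; have im := ger_rnormIm z.
    case: zb => /= zr; [apply: le_trans re|apply: le_trans re|apply: le_trans im|apply: le_trans im];
      by rewrite zr ?r2 ?normrN ger0_norm// ltW.
  by rewrite lef_pV2 ?posrE// (lt_le_trans r0).
Qed.

End CauchyEstimate.

(** * Estimates on bounded holomorphic maps *)

Section Estimates.
Context {R : realType} {E V : normedModType R[i]}.
Local Notation C := R[i].
Implicit Types (u : E -> V) (x y h k : E).

(** All that the estimates use of holomorphy: complex derivatives along lines, with no linearity in
    the direction h. *)
Definition line_diff u y :=
  forall h, exists B, cdiff (fun t => u (y + t *: h)) 0 B.

Lemma cdiffB (f g : C -> V) z A B :
  cdiff f z A -> cdiff g z B -> cdiff (fun t => f t - g t) z (A - B).
Proof.
move=> [phi phiA fphi] [psi psiB gpsi]; exists (fun t => phi t - psi t).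
  exact: cvgB.
apply: filterS2 fphi gpsi => t -> ->.
by rewrite scalerBr !opprD !addrA (ACl (1*3*2*4)).
Qed.

Lemma cdiff_translate (f : C -> V) t z B :
  cdiff f (t + z) B -> cdiff (fun s => f (t + s)) z B.
Proof.
move=> [phi /cvg_rnormP phiB /cnbhs_rnormP[d d0 fphi]].
have tE w : t + w - (t + z) = w - z by rewrite opprD addrACA subrr add0r.
exists (fun s => phi (t + s)).
  apply/cvg_rnormP => e /phiB/cnbhs_rnormP[d' d'0 dP].
  by apply/cnbhs_rnormP; exists d' => // w wd; apply: dP; rewrite tE.
by apply/cnbhs_rnormP; exists d => // w wd; rewrite fphi tE.
Qed.

(** Cauchy's estimate for t |-> u(x + t h) on squares of half-side r/(5|h|): if |t||h| <= r/2, the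
    points stay in the ball since 1/2 + 2/5 < 1, and the derivative is at most 4M / (r/(5|h|)) =
    20M|h|/r. A mean value inequality on [0, 1] concludes. *)
Lemma lipschitz_of_bounded u x (r M : R) h : 0 < r ->
  (forall y, rnorm (y - x) < r -> line_diff u y /\ rnorm (u y) <= M) ->
  rnorm h <= r / 4 -> rnorm (u (x + h) - u x) <= 20 * M / r * rnorm h.
Proof.
move=> r0 uP hr.
have [->|h0] := eqVneq h 0; first by rewrite addr0 subrr !rnorm0 mulr0.
have nh0 := rnorm_gt0 h0.
pose f t := u (x + t *: h).
have fd t : rnorm t * rnorm h < r -> exists B, cdiff f t B.
  move=> th; have [|ud _] := uP (x + t *: h); first by rewrite addrAC subrr add0r rnormZ.
  have [B uB] := ud h; exists B; apply: cdiff_shift.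
  by rewrite /f (_ : (fun s => _) = (fun s => u (x + t *: h + s *: h)))//;
    apply/funext => s; rewrite scalerDl addrA.
have fB t B : rnorm t * rnorm h <= r / 2 -> cdiff f t B -> rnorm B <= 20 * M / r * rnorm h.
  move=> th ftB.
  have s0 : 0 < r / (5 * rnorm h) by rewrite divr_gt0// mulr_gt0.
  have sq z : square (corner (r / (5 * rnorm h))) (2 * (r / (5 * rnorm h))) z ->
      rnorm (t + z) * rnorm h < r.
    move=> zs; have : rnorm z <= 2 * (r / (5 * rnorm h)).
      move: zs; rewrite /square/= => -[/andP[? ?] /andP[? ?]].
      rewrite (le_trans (ler_rnormReIm _))//.
      rewrite (_ : 2 * _ = r / (5 * rnorm h) + r / (5 * rnorm h)); last by ring.
      by rewrite lerD// ler_norml; apply/andP; split; lra.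
    rewrite -(ler_pM2r nh0) => zh.
    have -> : r = r / 2 + 2 * (r / (5 * rnorm h)) * rnorm h + r / 10.
      by field; rewrite gt_eqF.
    have := ler_rnormD t z; rewrite -(ler_pM2r nh0) mulrDl => tz.
    have : 0 < r / 10 by rewrite divr_gt0.
    lra.
  have -> : 20 * M / r * rnorm h = 4 * M / (r / (5 * rnorm h)).
    by field; rewrite !gt_eqF.
  apply: (@cauchy_derivative _ _ (fun s => f (t + s))) => //.
  - by move=> z /sq/fd[B' fB']; exists B'; exact: cdiff_translate.
  - by move=> z /sq tz; have [|//] := uP (x + (t + z) *: h); rewrite addrAC subrr add0r rnormZ.
  - by apply: cdiff_translate; rewrite addr0.
set K := 20 * M / r * rnorm h.
apply/ler_addgt0Pl => e e0; rewrite leNgt; apply/negP => bad.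
(* A segment is bisected under the guise of a square: [P] looks at the bottom side only, and one of
   the two bottom quarters inherits it. *)
pose P (a : C) (k : R) := (e + K) * k < rnorm (f (a + k%:C%C) - f a).
have [|||z zs zP] := @bisection R P 0 1 _ _ _ => //.
- by rewrite /P mulr1 add0r /f scale1r scale0r addr0.
- move=> a k k0 Pk; apply: contrapT => noq.
  have q1 : ~ P a (k / 2) by move=> ?; apply: noq; exists a; rewrite ?inE ?eqxx.
  have q2 : ~ P (a + (k / 2)%:C%C) (k / 2).
    by move=> ?; apply: noq; exists (a + (k / 2)%:C%C); rewrite ?inE ?eqxx ?orbT.
  move: Pk q1 q2; rewrite /P => + /negP + /negP; rewrite -!leNgt -addrA -rmorphD -splitr.
  have := ler_rdistD (f (a + (k / 2)%:C%C)) (f (a + k%:C%C)) (f a); lra.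
(* [square_rdist] gives |z| <= 2 in the unit square, whence the assumption |h| <= r/4. *)
have zh : rnorm z * rnorm h <= r / 2.
  have : rnorm z <= 2 * 1.
    rewrite -[z]subr0; apply: square_rdist zs _.
    by split => /=; apply/andP; split; lra.
  rewrite -(ler_pM2r nh0); lra.
have [|B zB] := fd z; first lra.
have BK := fB z B zh zB.
(* Both ends of the bad segment are within 2k of z, so the two errors add up to e k/2, less than the
   excess e k. *)
have [|d d0 dP] := cdiffP zB (e := e / 8); first by rewrite divr_gt0.
have [|a [k [/andP[k0 kd] _ az]]] := zP (d / 4); first by rewrite divr_gt0.
have aa : square a k a by split; apply/andP; split; lra.
have ak : square a k (a + k%:C%C).
  by case: (a) => p q; split => /=; apply/andP; split; lra.
have d1 := square_rdist aa az; have d2 := square_rdist ak az.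
apply/negP; rewrite -leNgt.
have -> : f (a + k%:C%C) - f a =
   (f (a + k%:C%C) - f z - (a + k%:C%C - z) *: B) - (f a - f z - (a - z) *: B) + k%:C%C *: B.
  have -> : k%:C%C *: B = (a + k%:C%C - z) *: B - (a - z) *: B.
    by rewrite -scalerBl; congr (_ *: _); ring.
  rewrite !opprB !addrA.
  by rewrite [RHS](ACl (1*6*(5*2)*(7*3)*(4*8)))/= !subrr !addr0.
have e1 : rnorm (f (a + k%:C%C) - f z - (a + k%:C%C - z) *: B) <= e / 8 * (2 * k).
  by rewrite (le_trans (dP _ _)) ?ler_wpM2l//; lra.
have e2 : rnorm (f a - f z - (a - z) *: B) <= e / 8 * (2 * k).
  by rewrite (le_trans (dP _ _)) ?ler_wpM2l//; lra.
have e3 : rnorm (k%:C%C *: B) <= K * k.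
  by rewrite rnormZ rnormC (ger0_norm (ltW k0)) mulrC ler_wpM2r// ltW.
have := ler_rnormD (f (a + k%:C%C) - f z - (a + k%:C%C - z) *: B - (f a - f z - (a - z) *: B)) (k%:C%C *: B).
have := ler_rnormB (f (a + k%:C%C) - f z - (a + k%:C%C - z) *: B) (f a - f z - (a - z) *: B).
have : 0 < e * k by rewrite mulr_gt0.
lra.
Qed.

End Estimates.

Section SecondOrder.
Context {R : realType} {E V : normedModType R[i]}.
Local Notation C := R[i].
Implicit Types (u : E -> V) (x y h k : E).

Lemma rnorm_nat n : rnorm (n%:R : C) = n%:R.
Proof. by rewrite -(rmorph_nat (real_complex R)) rnormC normr_nat. Qed.

Lemma rnorm_exp2 j : rnorm (2 ^+ j : C) = 2 ^+ j.
Proof. by rewrite -natrX rnorm_nat natrX. Qed.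

(** The Lipschitz bound is used twice with radius r/2: it bounds y |-> u(y + h) - u(y) by 40M|h|/r
    near x, then applies to that map. Hence 1600 = 40^2, and r/8 = (r/2)/4. *)
Lemma second_difference_le u x (r M : R) h k : 0 < r ->
  (forall y, rnorm (y - x) < r -> line_diff u y /\ rnorm (u y) <= M) ->
  rnorm h <= r / 8 -> rnorm k <= r / 8 ->
  rnorm (u (x + h + k) - u (x + h) - (u (x + k) - u x)) <=
  1600 * M / r ^+ 2 * (rnorm h * rnorm k).
Proof.
move=> r0 uP hr kr; have r20 : 0 < r / 2 by rewrite divr_gt0.
have -> : u (x + h + k) - u (x + h) - (u (x + k) - u x) =
    (u (x + k + h) - u (x + k)) - (u (x + h) - u x).
  by rewrite (addrAC x h) !opprB !addrA [LHS](ACl (1*4*3*2)).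
have -> : 1600 * M / r ^+ 2 * (rnorm h * rnorm k) =
    20 * (20 * M / (r / 2) * rnorm h) / (r / 2) * rnorm k.
  by field; rewrite gt_eqF.
apply: (@lipschitz_of_bounded _ _ _ (fun y => u (y + h) - u y)) => //; last by lra.
move=> y yx.
have yhx : rnorm (y + h - x) < r.
  by rewrite addrAC (le_lt_trans (ler_rnormD _ _))//; lra.
have yx' : rnorm (y - x) < r by lra.
split.
  move=> v; have [A uA] := (uP _ yhx).1 v; have [B uB] := (uP _ yx').1 v.
  exists (A - B); have -> : (fun t => u (y + t *: v + h) - u (y + t *: v)) =
    (fun t => u (y + h + t *: v) - u (y + t *: v)).
    by apply/funext => t; rewrite addrAC.
  exact: cdiffB.
apply: lipschitz_of_bounded => //; last by lra.
move=> z zy; apply: uP; have := ler_rdistD y z x; lra.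
Qed.

(* Summing the dyadic defects: sum_j 2^j K |h|^2 / 4^j. *)
Lemma dyadic_defect_le (D : E -> V) (r K : R) h j :
  (forall k, rnorm k <= r -> rnorm (D k - 2 *: D (2^-1 *: k)) <= K * rnorm k ^+ 2) ->
  rnorm h <= r ->
  rnorm (D h - 2 ^+ j *: D (2 ^- j *: h)) <= 2 * (1 - 2 ^- j) * K * rnorm h ^+ 2.
Proof.
move=> DP; elim: j h => [|j IH] h hr.
  by rewrite !expr0 !invr1 !scale1r !subrr rnorm0 mulr0 !mul0r.
have h2 : rnorm (2^-1 *: h) = rnorm h / 2.
  by rewrite rnormZ rnormV rnorm_nat mulrC.
have h2r : rnorm (2^-1 *: h) <= r by rewrite h2; have := rnorm_ge0 h; lra.
have := IH _ h2r; rewrite h2 => IHh.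
have -> : D h - 2 ^+ j.+1 *: D (2 ^- j.+1 *: h) = D h - 2 *: D (2^-1 *: h) +
    2 *: (D (2^-1 *: h) - 2 ^+ j *: D (2 ^- j *: (2^-1 *: h))).
  by rewrite scalerBr addrA subrK !scalerA -exprS -invfM -exprSr.
rewrite (le_trans (ler_rnormD _ _))// rnormZ.
have -> : rnorm (2 : C) = 2 by rewrite rnorm_nat.
have -> : 2 ^- j.+1 = 2 ^- j / 2 :> R by rewrite exprSr invfM mulrC.
have := DP _ hr; move: IHh.
lra.
Qed.

(** With B the derivative along h, increments along w h differ from w B by at most K|h|^2/2 when |w|
    <= 1: dyadic defects are summed, and 2^j (u(x + 2^-j w h) - u(x)) tends to w B. The cases w = z
    and w = 1 add up to K|h|^2. *)
Lemma homogeneous_defect_le u x (r M : R) h (z : C) : 0 < r ->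
  (forall y, rnorm (y - x) < r -> line_diff u y /\ rnorm (u y) <= M) ->
  rnorm h <= r / 8 -> rnorm z <= 1 ->
  rnorm (u (x + z *: h) - u x - z *: (u (x + h) - u x)) <=
  1600 * M / r ^+ 2 * rnorm h ^+ 2.
Proof.
move=> r0 uP hr z1; set K := 1600 * M / r ^+ 2.
have [|ux _] := uP x; first by rewrite subrr rnorm0.
have [B hB] := ux h.
pose D k := u (x + k) - u x.
have half k : 2^-1 *: k + 2^-1 *: k = k by rewrite -scalerDl -[2^-1]mul1r -splitr scale1r.
have r2 k : rnorm (2^-1 *: k) = rnorm k / 2.
  by rewrite rnormZ rnormV rnorm_nat mulrC.
have DP k : rnorm k <= r / 8 -> rnorm (D k - 2 *: D (2^-1 *: k)) <= K / 4 * rnorm k ^+ 2.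
  move=> kr; have := @second_difference_le u x r M (2^-1 *: k) (2^-1 *: k) r0 uP.
  rewrite r2 -(addrA x) half => H.
  have -> : D k - 2 *: D (2^-1 *: k) = u (x + k) - u (x + 2^-1 *: k) - (u (x + 2^-1 *: k) - u x).
    rewrite /D scaler_nat mulr2n opprD !opprB !addrA.
    by rewrite [LHS](ACl (1*4*5*6*(3*2)))/= subrr addr0.
  have -> : K / 4 * rnorm k ^+ 2 = K * (rnorm k / 2 * (rnorm k / 2)) by field.
  by have := rnorm_ge0 k => ?; apply: H; lra.
have M0 : 0 <= K.
  have [|_] := uP x; first by rewrite subrr rnorm0.
  move/(le_trans (rnorm_ge0 _)) => M0; apply: divr_ge0; last exact: sqr_ge0.
  by apply: mulr_ge0 M0; exact: ler0n.
clearbody K.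
have lim (w : C) : rnorm w <= 1 -> rnorm (D (w *: h) - w *: B) <= K / 2 * rnorm h ^+ 2.
  move=> w1; apply/ler_addgt0Pl => e e0.
  have [d d0 dP] := cdiffP hB e0.
  have [j jd] : exists j : nat, d^-1 < 2 ^+ j.
    have [j jP] : exists j : nat, d^-1 < j%:R by eexists; exact: truncnS_gt.
    by exists j; rewrite (lt_trans jP)// -natrX ltr_nat ltn_expl.
  have wh : rnorm (w *: h) <= rnorm h by rewrite rnormZ ler_piMl// rnorm_ge0.
  have whr : rnorm (w *: h) <= r / 8 by rewrite (le_trans wh).
  have p0 : 0 < 2 ^+ j :> R by rewrite exprn_gt0.
  have := dyadic_defect_le j DP whr.
  have j2 : rnorm (2 ^- j * w : C) <= 2 ^- j.
    rewrite rnormM rnormV rnorm_exp2.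
    by rewrite ler_piMr// invr_ge0 ltW.
  have jd' : rnorm (2 ^- j * w - 0 : C) < d.
    by rewrite subr0 (le_lt_trans j2)// -[d]invrK ltf_pV2 ?posrE ?invr_gt0.
  have := dP _ jd'; rewrite subr0 scale0r addr0 => H1 H2.
  have -> : D (w *: h) - w *: B = D (w *: h) - 2 ^+ j *: D (2 ^- j *: (w *: h)) +
     2 ^+ j *: (u (x + (2 ^- j * w) *: h) - u x - (2 ^- j * w) *: B).
    have -> : u (x + (2 ^- j * w) *: h) - u x = D (2 ^- j *: (w *: h)) by rewrite /D scalerA.
    move: (D _) (D _) => p q.
    by rewrite scalerBr scalerA mulrA divff ?expf_neq0 ?pnatr_eq0// mul1r addrA subrK.
  rewrite (le_trans (ler_rnormD _ _))// rnormZ addrC lerD//.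
    rewrite rnorm_exp2 -ler_pdivlMl// (le_trans H1)// mulrC ler_wpM2r// ltW//.
  rewrite (le_trans H2)//.
  have whh : rnorm (w *: h) ^+ 2 <= rnorm h ^+ 2 by rewrite lerXn2r ?nnegrE ?rnorm_ge0.
  rewrite (@le_trans _ _ (K / 2 * rnorm (w *: h) ^+ 2))//; last first.
    by rewrite ler_wpM2l// divr_ge0.
  rewrite ler_wpM2r ?exprn_ge0 ?rnorm_ge0//.
  have : 0 <= 2 ^- j * K by rewrite mulr_ge0// invr_ge0 ltW.
  lra.
have -> : u (x + z *: h) - u x - z *: (u (x + h) - u x) =
    D (z *: h) - z *: B - z *: (D (1 *: h) - 1 *: B).
  by rewrite !scale1r (scalerBr z _ B) opprB addrA subrK.
have l1 := lim 1; have lz := lim z z1.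
rewrite (le_trans (ler_rnormB _ _))// rnormZ.
have {}l1 : rnorm (D (1 *: h) - 1 *: B) <= K / 2 * rnorm h ^+ 2.
  by apply: l1; rewrite (rnorm_nat 1).
have : rnorm z * rnorm (D (1 *: h) - 1 *: B) <= 1 * (K / 2 * rnorm h ^+ 2).
  by rewrite ler_pM ?rnorm_ge0.
lra.
Qed.

End SecondOrder.

(** * Differentiability recovered from the estimates *)

Section Differentiability.
Context {R : realType}.
Local Notation C := R[i].

Lemma rnorm1 : rnorm (1 : C) = 1.
Proof. exact: (rnorm_nat 1). Qed.

Lemma differentiable_line (E V : normedModType C) (u : E -> V) y :
  differentiable u y -> line_diff u y.
Proof.
move=> /diff_derivable uy h; have /cvg_ex[B /cvg_rnormP uB] := uy h.
pose phi (t : C) := if t == 0 then B else t^-1 *: (u (y + t *: h) - u y).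
exists B, phi.
  apply/cvg_rnormP => e e0; have := uB e e0.
  rewrite near_withinE => /nbhs_rnormP[d d0 dP].
  apply/cnbhs_rnormP; exists d => // t td; rewrite /phi.
  case: eqVneq => [_|t0]; first by rewrite subrr rnorm0.
  by have := dP t td t0; rewrite /= [t *: h + y]addrC.
apply: nearW => t; rewrite /phi subr0 scale0r addr0; case: eqVneq => [->|t0].
  by rewrite !scale0r !addr0.
by rewrite scalerA divff// scale1r subrKC.
Qed.

Lemma near_half_pow (c d : R) : 0 < d -> \forall j \near \oo, c * 2 ^- j < d.
Proof.
move=> d0; have [c0|c0] := leP c 0.
  apply: nearW => j; rewrite (le_lt_trans _ d0)// mulr_le0_ge0// invr_ge0 exprn_ge0//.
have [n nP] : exists n : nat, c / d < n%:R by eexists; exact: truncnS_gt.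
near=> j.
rewrite ltr_pdivrMr ?exprn_gt0// mulrC -ltr_pdivrMr//.
rewrite (lt_le_trans nP)// -natrX ler_nat.
by rewrite (@leq_trans j)//; [near: j; exact: nbhs_infty_ge|rewrite ltnW// ltn_expl].
Unshelve. all: by end_near. Qed.

Lemma geometric_cvg (V : completeNormedModType C) (s : nat -> V) (c : R) :
  (forall j i, rnorm (s j - s (j + i)%N) <= c * 2 ^- j) -> cvg (s @ \oo).
Proof.
move=> sP; apply/cauchy_cvgP/cauchyP => e e0.
have e'0 : 0 < complex.Re e by move: e0; rewrite ltcE => /andP[].
near \oo => j.
exists (s j); exists j => // i /= ji.
rewrite -ball_normE /= rnormE -(RRe_real (gtr0_real e0)) ltcR.
rewrite -(subnKC ji) (le_lt_trans (sP _ _))//.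
by near: j; exact: near_half_pow.
Unshelve. all: by end_near. Qed.

Lemma rnorm_half_pow (V : normedModType C) (h : V) j :
  rnorm ((2 ^- j : C) *: h) = rnorm h * 2 ^- j.
Proof. by rewrite rnormZ rnormV rnorm_exp2 mulrC. Qed.

(** The differential is the limit l(h) of 2^j (u(x + 2^-j h) - u(x)), a Cauchy sequence since its
    successive terms differ by second differences. Small second differences make l additive, the
    homogeneity defect makes it complex linear, the Lipschitz bound makes it continuous, and the
    summed dyadic defects bound the remainder by K|h|^2/2. *)
Lemma differentiable_of_defects (E : normedModType C) (V : completeNormedModType C)
    (u : E -> V) x (r K L : R) :
  0 < r -> 0 <= K ->
  (forall h, rnorm h <= r -> rnorm (u (x + h) - u x) <= L * rnorm h) ->
  (forall h k, rnorm h <= r -> rnorm k <= r ->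
    rnorm (u (x + h + k) - u (x + h) - (u (x + k) - u x)) <= K * (rnorm h * rnorm k)) ->
  (forall h (z : C), rnorm h <= r -> rnorm z <= 1 ->
    rnorm (u (x + z *: h) - u x - z *: (u (x + h) - u x)) <= K * rnorm h ^+ 2) ->
  differentiable u x.
Proof.
move=> r0 K0 uL uSD uH.
pose D h := u (x + h) - u x.
pose S (D : E -> V) h j := (2 ^+ j : C) *: D ((2 ^- j : C) *: h).
have two0 : 2 != 0 :> C by rewrite pnatr_eq0.
have half k : (2^-1 : C) *: k + (2^-1 : C) *: k = k :> E.
  by rewrite -scalerDl -[2^-1]mul1r -splitr scale1r.
have DSD h k : rnorm h <= r -> rnorm k <= r ->
    rnorm (D (h + k) - D h - D k) <= K * (rnorm h * rnorm k).
  move=> hr kr; rewrite (le_trans _ (uSD h k hr kr))// le_eqVlt; apply/orP; left.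
  rewrite /D (addrA x) !opprB !addrA; apply/eqP; congr (rnorm _).
  by rewrite [LHS](ACl (1*4*5*6*(3*2)))/= subrr addr0.
have {}uH h (z : C) : rnorm h <= r -> rnorm z <= 1 ->
    rnorm (D (z *: h) - z *: D h) <= K * rnorm h ^+ 2 by exact: uH.
have uD h : u (h + x) = u x + D h by rewrite /D addrC subrKC.
have {uSD}uL h : rnorm h <= r -> rnorm (D h) <= L * rnorm h by exact: uL.
clearbody D; set s := S D.
have DP k : rnorm k <= r -> rnorm (D k - 2 *: D (2^-1 *: k)) <= K / 4 * rnorm k ^+ 2.
  move=> kr; have k2 : rnorm ((2^-1 : C) *: k) = rnorm k / 2.
    by have := rnorm_half_pow k 1; rewrite !expr1.
  have := DSD (2^-1 *: k) (2^-1 *: k); rewrite half k2 => H.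
  have -> : K / 4 * rnorm k ^+ 2 = K * (rnorm k / 2 * (rnorm k / 2)) by field.
  rewrite scaler_nat mulr2n opprD addrA.
  by have := rnorm_ge0 k => ?; apply: H; lra.
have DK h j : rnorm h <= r -> rnorm (D h - s h j) <= K / 2 * rnorm h ^+ 2.
  move=> hr; rewrite (le_trans (dyadic_defect_le j DP hr))//.
  rewrite ler_wpM2r ?exprn_ge0 ?rnorm_ge0//.
  have : 0 <= 2 ^- j * K by rewrite mulr_ge0// invr_ge0 exprn_ge0.
  lra.
have near_r h : \forall j \near \oo, rnorm ((2 ^- j : C) *: h) <= r.
  near=> j; rewrite rnorm_half_pow ltW//; near: j; exact: near_half_pow.
have s_cvg_small h : rnorm h <= r -> cvg (s h @ \oo).
  move=> hr; apply: (@geometric_cvg _ _ (K / 2 * rnorm h ^+ 2)) => j i.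
  have jr : rnorm ((2 ^- j : C) *: h) <= r.
    rewrite rnorm_half_pow (le_trans _ hr)// ler_piMr ?rnorm_ge0//.
    by rewrite invf_le1 ?exprn_gt0// exprn_ege1// ler1n.
  have -> : s h j - s h (j + i)%N = (2 ^+ j : C) *: (D (2 ^- j *: h) - s (2 ^- j *: h) i).
    by rewrite /s /S scalerBr !scalerA exprD invfM [X in _ - _ *: D (X *: _)]mulrC.
  rewrite rnormZ rnorm_exp2 -ler_pdivlMl ?exprn_gt0//.
  rewrite (le_trans (DK _ _ jr))// rnorm_half_pow le_eqVlt; apply/orP; left; apply/eqP.
  by field; rewrite expf_neq0.
(* For a large h, the sequence is 2^n times that of the small vector 2^-n h, shifted by n. *)
have s_cvg h : cvg (s h @ \oo).
  near \oo => n.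
  have nr : rnorm ((2 ^- n : C) *: h) <= r by near: n; exact: near_r.
  have /cvg_ex[l sl] := s_cvg_small _ nr.
  apply/cvg_ex; exists ((2 ^+ n : C) *: l).
  rewrite -(cvg_shiftn n).
  have -> : (fun m => s h (m + n)%N) = (fun m => (2 ^+ n : C) *: s (2 ^- n *: h) m).
    by apply/funext => m; rewrite /s /S !scalerA addnC exprD invfM [X in _ *: D (X *: _)]mulrC.
  exact: cvgZl_tmp.
pose l h := lim (s h @ \oo).
have sl h : s h @ \oo --> l h by exact: s_cvg.
have lin1 (a : C) h k : rnorm a <= 1 -> l (a *: h + k) = a *: l h + l k.
  move=> a1; apply/eqP; rewrite -subr_eq0; apply/eqP.
  have c0 : (s (a *: h + k) j - (a *: s h j + s k j)) @[j --> \oo] --> (0 : V).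
    apply/cvg_rnormP => e e0; near=> j.
    have hr : rnorm ((2 ^- j : C) *: h) <= r by near: j; exact: near_r.
    have kr : rnorm ((2 ^- j : C) *: k) <= r by near: j; exact: near_r.
    have ahr : rnorm (a *: ((2 ^- j : C) *: h)) <= rnorm ((2 ^- j : C) *: h).
      by rewrite rnormZ ler_piMl// rnorm_ge0.
    rewrite subr0.
    (* An additivity defect plus a homogeneity defect at scale 2^-j: both are O(4^-j), against the
       factor 2^j. *)
    have -> : s (a *: h + k) j - (a *: s h j + s k j) = (2 ^+ j : C) *:
      ((D (a *: (2 ^- j *: h) + 2 ^- j *: k) - D (a *: (2 ^- j *: h)) - D (2 ^- j *: k)) +
       (D (a *: (2 ^- j *: h)) - a *: D (2 ^- j *: h))).
      have sC (W : lmodType C) (b : C) (v : W) : b *: (a *: v) = a *: (b *: v).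
        by rewrite !scalerA mulrC.
      rewrite /s /S (scalerDr (2 ^- j)) sC -[a *: (_ *: D _)]sC -scalerDr -scalerBr.
      by congr (_ *: _); rewrite opprD !addrA [RHS](ACl (1*5*3*(4*2)))/= subrr addr0.
    rewrite rnormZ rnorm_exp2.
    have H1 := DSD _ _ (le_trans ahr hr) kr.
    have H2 := uH _ _ hr a1.
    apply: (@le_lt_trans _ _ ((K * (rnorm h * rnorm k + rnorm h ^+ 2)) * 2 ^- j)).
      rewrite -ler_pdivlMl ?exprn_gt0// (le_trans (ler_rnormD _ _))//.
      apply: (@le_trans _ _ (K * (rnorm ((2 ^- j : C) *: h) * rnorm ((2 ^- j : C) *: k))
         + K * rnorm ((2 ^- j : C) *: h) ^+ 2)).
        rewrite lerD// (le_trans H1)// ler_wpM2l// ler_wpM2r ?rnorm_ge0//.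
      rewrite !rnorm_half_pow le_eqVlt; apply/orP; left; apply/eqP; field.
      by rewrite expf_neq0.
    by near: j; exact: near_half_pow.
  have c1 : (s (a *: h + k) j - (a *: s h j + s k j)) @[j --> \oo] -->
      l (a *: h + k) - (a *: l h + l k).
    by apply: cvgB => //; apply: cvgD => //; exact: cvgZl_tmp.
  exact: cvg_unique c1 c0.
have l0 : l 0 = 0.
  have := @lin1 1 0 0; rewrite rnorm1 !scale1r addr0 => /(_ (lexx 1)) /eqP.
  by rewrite -subr_eq subrr eq_sym => /eqP.
have lZ (a : C) h : l (a *: h) = a *: l h.
  have [a1|/ltW a1] := leP (rnorm a) 1; first by rewrite -[a *: h]addr0 lin1// l0 addr0.
  have a0 : a != 0 by apply: contraTneq a1 => ->; rewrite rnorm0 -ltNge.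
  have : l (a^-1 *: (a *: h) + 0) = a^-1 *: l (a *: h) + l 0.
    by apply: lin1; rewrite rnormV invf_le1// (lt_le_trans _ a1).
  rewrite l0 !addr0 scalerA mulVf// scale1r => ->.
  by rewrite scalerA divff// scale1r.
have lin : linear l by move=> a h k; rewrite -(scale1r (a *: h)) lin1 ?rnorm1// scale1r lZ.
pose Lm : {linear E -> V} := HB.pack l (GRing.isLinear.Build C E V *:%R l lin).
have lim_le h (v : V) (c : R) : (\forall j \near \oo, rnorm (v - s h j) <= c) ->
    rnorm (v - l h) <= c.
  move=> vc; apply/ler_addgt0Pl => e e0.
  have /cvg_rnormP/(_ e e0) sle := sl h.
  near \oo => j.
  have H1 : rnorm (v - s h j) <= c by near: j.
  have H2 : rnorm (s h j - l h) < e by near: j.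
  by have := ler_rdistD (s h j) v (l h); lra.
have lD h : rnorm h <= r -> rnorm (D h - l h) <= K / 2 * rnorm h ^+ 2.
  by move=> hr; apply: lim_le; apply: nearW => j; exact: DK.
have lL h : rnorm (l h) <= L * rnorm h.
  rewrite -rnormN -sub0r; apply: lim_le; near=> j.
  rewrite sub0r rnormN /s /S rnormZ rnorm_exp2 -ler_pdivlMl ?exprn_gt0//.
  rewrite (le_trans (uL _ _))//; first by near: j; exact: near_r.
  by rewrite rnorm_half_pow mulrA mulrC.
have Lc : continuous Lm.
  move=> y; apply/cvg_rnormP => e e0.
  have L10 : 0 < `|L| + 1 by rewrite ltr_wpDl.
  apply/nbhs_rnormP; exists (e / (`|L| + 1)); first by rewrite divr_gt0.
  move=> z zy; rewrite -linearB /= (le_lt_trans (lL _))//.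
  rewrite ltr_pdivlMr// mulrC in zy.
  apply: le_lt_trans zy; rewrite ler_wpM2r ?rnorm_ge0//.
  by rewrite (le_trans (ler_norm _))// lerDl.
have uE : u \o shift x = cst (u x) + Lm +o_ 0 id.
  apply/eqaddoP => e e0.
  have e'0 : 0 < complex.Re e by move: e0; rewrite ltcE => /andP[].
  have K10 : 0 < K + 1 by rewrite ltr_wpDl.
  apply/nbhs_rnormP; exists (Num.min r (complex.Re e / (K + 1))).
    by rewrite lt_min r0 divr_gt0.
  move=> h; rewrite subr0 lt_min => /andP[/ltW hr he].
  rewrite ltr_pdivlMr// mulrC in he.
  rewrite /= !rnormE -(RRe_real (gtr0_real e0)) -rmorphM lecR /=.
  have -> : ((u \o shift x) - (cst (u x) + l)) h = D h - l h.
    by rewrite !fctE /= uD opprD addrA [u x + _]addrC addrK.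
  rewrite (le_trans (lD _ hr))// expr2 mulrA ler_wpM2r ?rnorm_ge0//.
  have := rnorm_ge0 h; nra.
apply/diff_locallyP; rewrite (diff_unique Lc uE); split => //.
Unshelve. all: by end_near. Qed.

End Differentiability.

(** * The Hilbert space l2 *)

Section DotTheory.
Context {C : numClosedFieldType} (U : lmodType C) (f : {dot U for (@Num.conj C)}).

Lemma dot_cauchy_schwarz u v : `|f u v| ^+ 2 <= f u u * f v v.
Proof.
have [->|v0] := eqVneq v 0; first by rewrite !linear0r normr0 expr0n.
have vv : 0 < f v v by rewrite dnorm_gt0.
pose a := f u v / f v v; pose w := u - a *: v.
have ow : f w v = 0.
  by rewrite /w linearBl /= linearZl_LR /= divfK ?subrr// gt_eqF.
have -> : f u u = f w w + `|a| ^+ 2 * f v v.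
  rewrite -{1 2}(subrK (a *: v) u) -/w hnormDd /= -?dnormZ//.
  by rewrite linearZr_LR /= ow mulr0.
rewrite mulrDl normf_div expr_div_n (gtr0_norm vv) -mulrA -expr2 divfK ?expf_neq0 ?gt_eqF//.
by rewrite lerDr mulr_ge0// ?dnorm_ge0.
Qed.

Lemma dot_triangle u v : sqrtC (f (u + v) (u + v)) <= sqrtC (f u u) + sqrtC (f v v).
Proof.
have su := dnorm_ge0 f u; have sv := dnorm_ge0 f v.
rewrite -ler_sqr ?nnegrE ?addr_ge0 ?sqrtC_ge0 ?dnorm_ge0// sqrrD !sqrtCK dnormD.
rewrite [leRHS]addrAC lerD2l.
have -> : f u v + (f u v)^* = 'Re (f u v) *+ 2.
  by rewrite ReE -[RHS]mulr_natr divfK ?pnatr_eq0.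
rewrite ler_wMn2r//; rewrite (le_trans (real_ler_norm (Creal_Re _)))//.
rewrite (le_trans (leif_normC_Re_Creal _))//.
rewrite -ler_sqr ?nnegrE ?mulr_ge0 ?sqrtC_ge0// exprMn !sqrtCK.
exact: dot_cauchy_schwarz.
Qed.

End DotTheory.

Section ComplexLimits.
Context {R : realType}.
Local Notation C := R[i].

Lemma complex_cauchy_cvg (T : Type) (F : set_system T) {PF : ProperFilter F} (f : T -> C) :
  (forall e : R, 0 < e -> exists a, \forall t \near F, rnorm (f t - a) < e) ->
  exists l, forall e : R, 0 < e -> \forall t \near F, rnorm (f t - l) < e.
Proof.
move=> fF.
have part (p : C -> R) : (forall z w, `|p z - p w| <= rnorm (z - w)) -> cvg (p \o f @ F).
  move=> pP; apply/cauchy_cvgP/cauchyP => e e0; have [a aF] := fF e e0.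
  exists (p a); apply: filterS aF => t ta.
  by rewrite -ball_normE /= distrC (le_lt_trans (pP _ _)).
have /cvg_ex[x /= /cvgrPdist_lt xF] := part (@complex.Re R)
  ltac:(by move=> z w; rewrite -ReB ger_rnormRe).
have /cvg_ex[y /= /cvgrPdist_lt yF] := part (@complex.Im R)
  ltac:(by move=> z w; rewrite -ImB ger_rnormIm).
exists (Complex x y) => e e0; have e20 : 0 < e / 2 by rewrite divr_gt0.
apply: filterS2 (xF _ e20) (yF _ e20) => t tx ty.
rewrite (le_lt_trans (ler_rnormReIm _))// ReB ImB /= [ltRHS]splitr.
by rewrite distrC [X in _ + X]distrC ltrD.
Qed.

End ComplexLimits.

Section SquareSummable.
(* Sequences supported in D: D = setT gives l2, and D = {i < N} gives C^N. *)
Context {R : realType} (D : set nat).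
Local Notation C := R[i].
Implicit Types x y : nat -> C.

Definition sqsum x n : R := \sum_(i < n) rnorm (x i) ^+ 2.

Definition square_summable x :=
  (exists B, forall n, sqsum x n <= B) /\ forall i, ~ D i -> x i = 0.

Definition l2_pred : pred (nat -> C) := fun x => `[< square_summable x >].

Lemma l2_predP x : reflect (square_summable x) (x \in l2_pred).
Proof. exact: asboolP. Qed.

Lemma l2_submod_closed : submod_closed l2_pred.
Proof.
split=> [|a x y /l2_predP[[B xB] xD] /l2_predP[[B' yB'] yD]].
  apply/l2_predP; split=> //; exists 0 => n.
  by rewrite /sqsum big1// => i _; rewrite rnorm0 expr0n.
apply/l2_predP; split=> [|i iD]; last first.
  by rewrite /= !fctE xD// yD// scaler0 addr0.
exists (2 * rnorm a ^+ 2 * B + 2 * B') => n.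
apply: (@le_trans _ _ (2 * rnorm a ^+ 2 * sqsum x n + 2 * sqsum y n)); last first.
  by rewrite lerD// ler_wpM2l// mulr_ge0// sqr_ge0.
rewrite /sqsum !mulr_sumr -big_split ler_sum// => i _ /=.
rewrite !fctE.
have := ler_rnormD (a *: x i) (y i); rewrite rnormM.
have := rnorm_ge0 (a *: x i + y i).
move: (rnorm (_ + _)) (rnorm a) (rnorm (x i)) (rnorm (y i)) => p q r s p0 pq.
have : 0 <= (q * r - s) ^+ 2 by exact: sqr_ge0.
have : p ^+ 2 <= (q * r + s) ^+ 2 by rewrite lerXn2r ?nnegrE// (le_trans p0).
lra.
Qed.

HB.instance Definition _ := GRing.isSubmodClosed.Build C (nat -> C) l2_pred
  l2_submod_closed.

Record l2 := L2 { l2_val :> nat -> C; l2_valP : l2_val \in l2_pred }.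

HB.instance Definition _ := [isSub for l2_val].
HB.instance Definition _ := [Choice of l2 by <:].
HB.instance Definition _ := [SubChoice_isSubLmodule of l2 by <:].

End SquareSummable.

Section L2Hilbert.
Context {R : realType} {D : set nat}.
Local Notation C := R[i].
Local Notation l2 := (@l2 R D).
Implicit Types x y z : l2.

Lemma l2E x y (a : C) i : ((a *: x + y : l2) i = a * x i + y i) * ((x + y : l2) i = x i + y i)
  * ((x - y : l2) i = x i - y i) * ((a *: x : l2) i = a * x i) * ((0 : l2) i = 0).
Proof. by []. Qed.

Lemma l2P x y : (forall i, x i = y i) -> x = y.
Proof. by move=> xy; apply/val_inj/funext. Qed.

Lemma l2_eq0 x i : ~ D i -> x i = 0.
Proof. by have /l2_predP[_] := l2_valP x; apply. Qed.

Lemma sqsum_ge0 (x : nat -> C) n : 0 <= sqsum x n.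
Proof. by apply: sumr_ge0 => i _; exact: sqr_ge0. Qed.

Lemma sqsum_le (x : nat -> C) m n : (m <= n)%N -> sqsum x m <= sqsum x n.
Proof.
move=> mn; rewrite /sqsum -(big_mkord xpredT (fun i => rnorm (x i) ^+ 2)).
rewrite -(big_mkord xpredT (fun i => rnorm (x i) ^+ 2)) (big_cat_nat (leq0n m) mn)//=.
by rewrite lerDl sumr_ge0// => i _; exact: sqr_ge0.
Qed.

Lemma sqsum_cvg x : cvg (sqsum x @ \oo).
Proof.
have /l2_predP[[B xB] _] := l2_valP x.
apply: nondecreasing_is_cvgn; first by move=> m n; exact: sqsum_le.
by exists B => _ [n _ <-].
Qed.

Definition dotsum x y n : C^o := \sum_(i < n) x i * (y i)^*.

Lemma dotsum_self x n : dotsum x x n = (sqsum x n)%:C%C.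
Proof.
rewrite /dotsum /sqsum rmorph_sum; apply: eq_bigr => i _.
by rewrite -normCK rnormE rmorphXn.
Qed.

(** Termwise |x y| <= |x|^2 + |y|^2, so the series of the inner product is Cauchy because the two
    series of squares are. *)
Lemma dotsum_dist x y m n : (m <= n)%N ->
  rnorm (dotsum x y n - dotsum x y m) <= sqsum x n - sqsum x m + (sqsum y n - sqsum y m).
Proof.
move=> mn; rewrite /dotsum /sqsum.
have S (W : zmodType) (F : nat -> W) : \sum_(i < n) F i - \sum_(i < m) F i = \sum_(m <= i < n) F i.
  by rewrite -!(big_mkord xpredT F) (big_cat_nat (leq0n m) mn)//= addrAC subrr add0r.
rewrite (S C^o (fun i => x i * (y i)^*)) (S _ (fun i => rnorm (x i) ^+ 2)).
rewrite (S _ (fun i => rnorm (y i) ^+ 2)) -big_split (le_trans (rnorm_sum _ _ _))//.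
apply: ler_sum => i _ /=; rewrite rnormM.
have -> : rnorm (y i)^* = rnorm (y i) by rewrite /rnorm norm_conjC.
have := sqr_ge0 (rnorm (x i) - rnorm (y i)).
have := sqr_ge0 (rnorm (x i) + rnorm (y i)).
lra.
Qed.

Lemma dotsum_cvg x y : cvg (dotsum x y @ \oo).
Proof.
have [|l lP] := @complex_cauchy_cvg R nat \oo _ (dotsum x y); last first.
  by apply/cvg_ex; exists l; apply/cvg_rnormP.
move=> e e0; have e20 : 0 < e / 2 by rewrite divr_gt0.
have /cvg_ex[a /= /cvgrPdist_lt xa] := @sqsum_cvg x.
have /cvg_ex[b /= /cvgrPdist_lt yb] := @sqsum_cvg y.
have [N _ NP] : \forall n \near \oo, `|a - sqsum x n| < e / 4 /\ `|b - sqsum y n| < e / 4.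
  by apply: filterI; [apply: xa|apply: yb]; rewrite divr_gt0.
exists (dotsum x y N); exists N => // n /= Nn.
rewrite (le_lt_trans (dotsum_dist _ _ Nn))//.
have [] := NP N (leqnn N); have [] := NP n Nn; rewrite !ltr_norml.
move=> /andP[? ?] /andP[? ?] /andP[? ?] /andP[? ?]; lra.
Qed.

Definition l2_inner x y : C := lim (dotsum x y @ \oo).

Lemma l2_inner_cvg x y : dotsum x y @ \oo --> (l2_inner x y : C^o).
Proof. exact: dotsum_cvg. Qed.

Lemma l2_innerP x y (l : C) : (dotsum x y @ \oo --> (l : C^o)) -> l2_inner x y = l.
Proof. by move=> xl; apply: cvg_unique (@l2_inner_cvg x y) xl. Qed.

Lemma l2_inner_linearl y : GRing.linear_for *%R (l2_inner ^~ y).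
Proof.
move=> a x z; apply: l2_innerP.
have -> : dotsum (a *: x + z) y = (fun n => a *: dotsum x y n + dotsum z y n).
  apply/funext => n; rewrite /dotsum scaler_sumr -big_split; apply: eq_bigr => i _ /=.
  by rewrite mulrDl -mulrA.
by apply: cvgD; [apply: cvgZl_tmp|]; exact: l2_inner_cvg.
Qed.

Lemma l2_inner_herm x y : l2_inner x y = (-1) ^+ false * (l2_inner y x)^*.
Proof.
rewrite expr0 mul1r; apply: l2_innerP; apply/cvg_rnormP => e e0.
have /cvg_rnormP/(_ e e0) := @l2_inner_cvg y x; apply: filterS => n.
have -> : dotsum x y n = (dotsum y x n)^*.
  rewrite /dotsum rmorph_sum; apply: eq_bigr => i _.
  by rewrite rmorphM /= conjCK mulrC.
by rewrite /rnorm -rmorphB norm_conjC.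
Qed.

Lemma l2_inner_linearr x : GRing.linear_for (@Num.conj C \; *%R) (l2_inner x).
Proof.
move=> a y z; rewrite [LHS]l2_inner_herm [l2_inner x y]l2_inner_herm.
rewrite [l2_inner x z]l2_inner_herm !expr0 !mul1r l2_inner_linearl /=.
by rewrite rmorphD rmorphM.
Qed.

HB.instance Definition _ := bilinear_isBilinear.Build C l2 l2 C *%R
  (@Num.conj C \; *%R) l2_inner (l2_inner_linearl, l2_inner_linearr).

HB.instance Definition _ := isHermitianSesquilinear.Build C l2 false (@Num.conj C)
  l2_inner l2_inner_herm.

Lemma sqsum_le_inner x n : (sqsum x n)%:C%C <= l2_inner x x.
Proof.
have /cvg_ex[a /= xa] := @sqsum_cvg x.
have -> : l2_inner x x = a%:C%C.
  apply: l2_innerP; apply/cvg_rnormP => e e0.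
  move/cvgrPdist_lt : xa => /(_ e e0); apply: filterS => m.
  by rewrite dotsum_self -rmorphB rnormC distrC.
rewrite lecR; rewrite -(cvg_lim _ xa)//.
apply: nondecreasing_cvgn_le; last exact: sqsum_cvg.
by move=> i j; exact: sqsum_le.
Qed.

Lemma inner_le_sqsum x (B : R) : (forall n, sqsum x n <= B) -> l2_inner x x <= B%:C%C.
Proof.
move=> xB; have /cvg_ex[a /= xa] := @sqsum_cvg x.
have -> : l2_inner x x = a%:C%C.
  apply: l2_innerP; apply/cvg_rnormP => e e0.
  move/cvgrPdist_lt : xa => /(_ e e0); apply: filterS => m.
  by rewrite dotsum_self -rmorphB rnormC distrC.
rewrite lecR -(cvg_lim _ xa)//; apply: limr_le; first exact: sqsum_cvg.
exact: nearW.
Qed.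

Lemma l2_inner_gt0 x : x != 0 -> 0 < l2_inner x x.
Proof.
move=> x0; have [i xi] : exists i, x i != 0.
  apply: contrapT => /forallNP xz; move/negP : x0; apply; apply/eqP/l2P => i.
  by apply/eqP/negPn/negP; exact: xz.
apply: lt_le_trans (sqsum_le_inner x i.+1).
by rewrite ltcR /sqsum big_ord_recr /= ltr_wpDl ?exprn_gt0 ?rnorm_gt0// sqsum_ge0.
Qed.

HB.instance Definition _ := isDotProduct.Build C l2 l2_inner l2_inner_gt0.

Definition l2_norm x : C := sqrtC (l2_inner x x).

Lemma l2_normD x y : l2_norm (x + y) <= l2_norm x + l2_norm y.
Proof. exact: (dot_triangle l2_inner). Qed.

Lemma l2_normZ (a : C) x : l2_norm (a *: x) = `|a| * l2_norm x.
Proof.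
by rewrite /l2_norm (dnormZ l2_inner) sqrtCM ?nnegrE ?exprn_ge0// ?sqrCK.
Qed.

Lemma l2_norm_eq0 x : l2_norm x = 0 -> x = 0.
Proof. by move=> /eqP; rewrite (sqrt_dnorm_eq0 l2_inner) => /eqP. Qed.

HB.instance Definition _ := Lmodule_isNormed.Build C l2 l2_normD l2_normZ l2_norm_eq0.

Lemma l2_inner_norm x : l2_inner x x = `|x| ^+ 2.
Proof. by rewrite -[RHS]/(l2_norm x ^+ 2) sqrtCK. Qed.

Lemma sqsum_le_rnorm x n : sqsum x n <= rnorm x ^+ 2.
Proof.
by rewrite -lecR rmorphXn /= -rnormE -l2_inner_norm sqsum_le_inner.
Qed.

Lemma rnorm_le_sqsum x (B : R) : 0 <= B -> (forall n, sqsum x n <= B ^+ 2) -> rnorm x <= B.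
Proof.
move=> B0 /inner_le_sqsum; rewrite l2_inner_norm rnormE -rmorphXn lecR.
by rewrite ler_sqr ?nnegrE ?rnorm_ge0.
Qed.

Lemma coord_le_rnorm x i : rnorm (x i) <= rnorm x.
Proof.
rewrite -ler_sqr ?nnegrE ?rnorm_ge0// (le_trans _ (sqsum_le_rnorm x i.+1))//.
by rewrite /sqsum big_ord_recr /= lerDr sqsum_ge0.
Qed.

(** The limit is taken coordinatewise. Bounds on partial sums of squares survive coordinatewise
    limits; this puts the limit in l2 and also gives convergence in norm. *)
Lemma l2_complete (F : set_system l2) : ProperFilter F -> cauchy F -> cvg F.
Proof.
move=> PF /cauchyP Fc.
have Fr (e : R) : 0 < e -> exists a : l2, \forall x \near F, rnorm (x - a) < e.
  move=> e0; have [|a aF] := Fc e%:C%C; first by rewrite ltcR.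
  by exists a; apply: filterS aF => x; rewrite -ball_normE /= distrC rnormE ltcR.
have [a aP] : {a : nat -> C & forall i (e : R), 0 < e ->
    \forall x \near F, rnorm ((x : l2) i - a i) < e}.
  apply: (@choice _ _ (fun i (l : C) => forall e : R, 0 < e ->
    \forall x \near F, rnorm ((x : l2) i - l) < e)) => i.
  apply: complex_cauchy_cvg => e /Fr[b bF]; exists (b i).
  by apply: filterS bF => x; apply: le_lt_trans; have := coord_le_rnorm (x - b) i.
have sq_le (b : l2) (e : R) : 0 < e -> (\forall x \near F, rnorm (x - b) < e) ->
    forall n, sqsum (fun i => a i - b i) n <= e ^+ 2.
  move=> e0 bF n.
  have aF : sqsum (fun i => (x : l2) i - b i) n @[x --> F] --> sqsum (fun i => a i - b i) n.
    elim: n => [|n IH].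
      by rewrite /sqsum big_ord0; under eq_fun do rewrite big_ord0; exact: cvg_cst.
    rewrite /sqsum big_ord_recr /=; under eq_fun do rewrite big_ord_recr /=.
    apply: cvgD => //.
    have cF : rnorm ((x : l2) n - b n) @[x --> F] --> rnorm (a n - b n).
      apply/cvgrPdist_lt => d d0; apply: filterS (aP n d d0) => x xa.
      apply: le_lt_trans xa; rewrite ler_norml.
      have H1 := ler_rdistD (x n) (a n) (b n).
      have H2 := ler_rdistD (a n) (x n) (b n).
      by rewrite (rdistC (a n) (x n)) in H1; apply/andP; split; lra.
    by rewrite expr2; under eq_fun do rewrite expr2; apply: cvgM.
  rewrite -(cvg_lim _ aF)//; apply: limr_le; first by apply/cvg_ex; exists (sqsum (fun i => a i - b i) n).
  apply: filterS bF => x xb; rewrite (le_trans (sqsum_le_rnorm (x - b) n))//.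
  by rewrite lerXn2r ?nnegrE ?rnorm_ge0 ?ltW.
have a_l2 : a \in l2_pred D.
  have [b bF] := Fr 1 ltr01.
  have ab : a - l2_val b \in l2_pred D.
    apply/l2_predP; split; first by exists (1 ^+ 2) => n; exact: sq_le.
    move=> i iD; rewrite !fctE l2_eq0// subr0; apply: rnorm_eq0.
    apply/eqP; rewrite eq_le rnorm_ge0 andbT; apply/ler_addgt0Pl => e e0.
    have [x xe] := filter_ex (aP i e e0).
    by rewrite addr0 ltW//; rewrite (l2_eq0 x iD) sub0r rnormN in xe.
  by rewrite -(subrK (l2_val b) a) rpredD// l2_valP.
have ab (b : l2) (e : R) : 0 < e -> (\forall x \near F, rnorm (x - b) < e) ->
    rnorm (L2 a_l2 - b) <= e.
  by move=> e0 bF; apply: rnorm_le_sqsum; [exact: ltW|exact: sq_le].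
apply/cvg_ex; exists (L2 a_l2) => P /nbhs_rnormP[e e0 eP].
have e20 : 0 < e / 2 by rewrite divr_gt0.
have [b bF] := Fr _ e20; apply: filterS (bF) => x xb; apply: eP.
rewrite (le_lt_trans (ler_rdistD b _ _))// [ltRHS]splitr ltr_leD//.
by rewrite rdistC ab.
Qed.

HB.instance Definition _ := Uniform_isComplete.Build l2 l2_complete.

Definition l2_hilbert : hilbert R := @Hilbert R l2 l2_inner l2_inner_norm.

End L2Hilbert.

(** * Positive semidefinite kernels *)

Section PositiveKernels.
Context {R : realType} {T : Type}.
Local Notation C := R[i].
Implicit Types (k : T -> T -> C) (s t o : T) (l : seq (C * T)).

Definition quad k l : C :=
  \sum_(p <- l) \sum_(q <- l) p.1 * q.1^* * k p.2 q.2.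

Definition psd k := forall l, 0 <= quad k l.

Lemma quad2 k (a b : C) s t : quad k [:: (a, s); (b, t)] =
  a * a^* * k s s + a * b^* * k s t + (b * a^* * k t s + b * b^* * k t t).
Proof. by rewrite /quad !big_cons !big_nil /= !addr0. Qed.

Lemma psd_diag_ge0 k s : psd k -> 0 <= k s s.
Proof.
by move=> /(_ [:: (1, s)]); rewrite /quad !big_cons !big_nil /= conjC1 !mul1r !addr0.
Qed.

(** [psd] contains no symmetry; it comes by polarization from the form being real at the
    coefficients (1, 1) and (i, 1). *)
Lemma psd_herm k s t : psd k -> k t s = (k s t)^*.
Proof.
move=> kP; have ks := psd_diag_ge0 s kP; have kt := psd_diag_ge0 t kP.
have r : k s s + k t t \is Num.real by rewrite rpredD ?ger0_real.
have := kP [:: (1, s); (1, t)]; rewrite quad2 conjC1 !mul1r => H1; have {H1} := ger0_real H1.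
have -> : k s s + k s t + (k t s + k t t) = k s t + k t s + (k s s + k t t) by ring.
rewrite (rpredDr _ r) => /conj_Creal.
have := kP [:: ('i, s); (1, t)]; rewrite quad2 conjC1 conjCi !mulr1 !mul1r => H2; have {H2} := ger0_real H2.
have -> : 'i * - 'i * k s s + 'i * k s t + (- 'i * k t s + k t t) =
   'i * (k s t - k t s) + (k s s + k t t).
  by rewrite mulrN -expr2 sqrCi; ring.
rewrite (rpredDr _ r) => /conj_Creal.
rewrite !rmorphM !rmorphB !rmorphD /= conjCi mulNr -mulrN => /(mulfI (neq0Ci C)).
move: (k s t) (k t s) => x y H1 H2.
have : 2 * y = 2 * x^*.
  have -> : 2 * y = (x + y) - (x - y) by ring.
  by rewrite -H2 -H1; ring.
by move=> /mulfI; apply; rewrite pnatr_eq0.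
Qed.

Lemma psd_cauchy_schwarz k s t : psd k -> `|k s t| ^+ 2 <= k s s * k t t.
Proof.
move=> kP; have ks := psd_diag_ge0 s kP; have kt := psd_diag_ge0 t kP.
have H (a b : C) : a \is Num.real -> b \is Num.real ->
    0 <= a ^+ 2 * k s s - 2 * a * b * `|k s t| ^+ 2 + b ^+ 2 * `|k s t| ^+ 2 * k t t.
  move=> ar br; have := kP [:: (a, s); (- b * k s t, t)].
  rewrite quad2 (psd_herm s t)// rmorphM rmorphN /= (conj_Creal ar) (conj_Creal br) normCK.
  by congr (0 <= _); ring.
have q0 : 0 <= `|k s t| ^+ 2 by rewrite exprn_ge0.
have [kt0|kt0] := eqVneq (k t t) 0; last first.
  have ktp : 0 < k t t by rewrite lt_def kt0.
  have := H (k t t) 1 (ger0_real kt) (real1 _).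
  have -> : k t t ^+ 2 * k s s - 2 * k t t * 1 * `|k s t| ^+ 2 + 1 ^+ 2 * `|k s t| ^+ 2 * k t t
     = k t t * (k s s * k t t - `|k s t| ^+ 2) by ring.
  by rewrite pmulr_rge0// subr_ge0.
rewrite kt0 mulr0; rewrite le_eqVlt; apply/orP; left.
apply: contraT => st0; have stp : 0 < `|k s t| ^+ 2 by rewrite lt_def st0.
(* When k(t, t) = 0 the form is affine in b, and this b gives it the value -1. *)
have := H 1 ((k s s + 1) / (2 * `|k s t| ^+ 2)) (real1 _)
  ltac:(by rewrite ger0_real// divr_ge0 ?addr_ge0 ?mulr_ge0).
rewrite kt0 mulr0 addr0 expr1n mul1r mulr1.
have -> : k s s - 2 * ((k s s + 1) / (2 * `|k s t| ^+ 2)) * `|k s t| ^+ 2 = -1.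
  by field; move: st0; rewrite expf_eq0.
by rewrite oppr_ge0 ler10.
Qed.

(* When k o o = 0, division by 0 makes this k itself. *)
Definition schur k o s t := k s t - k s o * k o t / k o o.

(** When k(o, o) is nonzero, the Schur complement at [l] is the value of k at [l] enlarged by o with
    the coefficient - S / k(o, o), which minimizes the form. *)
Lemma schur_psd k o : psd k -> psd (schur k o).
Proof.
move=> kP l; have ko := psd_diag_ge0 o kP.
pose S := \sum_(p <- l) p.1 * k p.2 o.
have SE : \sum_(p <- l) p.1^* * k o p.2 = S^*.
  rewrite rmorph_sum; apply: eq_bigr => p _.
  by rewrite rmorphM /= (psd_herm p.2 o).
have -> : quad (schur k o) l = quad k l - S * S^* / k o o.
  rewrite -SE /S mulr_suml mulr_suml /quad -sumrB; apply: eq_bigr => p _.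
  rewrite mulr_sumr mulr_suml -sumrB; apply: eq_bigr => q _.
  by rewrite /schur; ring.
have [ko0|ko0] := eqVneq (k o o) 0; first by rewrite ko0 invr0 mulr0 subr0.
have := kP ((- S / k o o, o) :: l).
rewrite /quad !big_cons /=.
have -> : \sum_(q <- l) - S / k o o * q.1^* * k o q.2 = - S / k o o * S^*.
  by rewrite -SE mulr_sumr; apply: eq_bigr => q _; rewrite mulrA.
have -> : \sum_(j <- l) \sum_(q <- ((- S / k o o, o) :: l)) j.1 * q.1^* * k j.2 q.2 =
    S * (- S / k o o)^* + quad k l.
  rewrite /S mulr_suml -big_split; apply: eq_bigr => p _ /=.
  by rewrite big_cons /=; congr (_ + _); ring.
rewrite rmorphM rmorphN fmorphV /= (conj_Creal (ger0_real ko)).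
by rewrite -/(quad k l); congr (0 <= _); field.
Qed.

End PositiveKernels.

(** * Cholesky factorization of a kernel along a dense sequence *)

Section Kolmogorov.
Context {R : realType} {T : Type}.
Local Notation C := R[i].
Variables (k : T -> T -> C) (s : nat -> T).
Hypothesis kP : psd k.

(** If k is a Gram kernel, this is the Gram kernel of the vectors projected away from those of s_0,
    ..., s_(n-1); [kfactor t m] is then the m-th Gram-Schmidt coordinate of t, which is 0 when s_m
    brings no new direction. *)
Fixpoint residual n := if n is m.+1 then schur (residual m) (s m) else k.

Definition kfactor t m : C :=
  residual m t (s m) / sqrtC (residual m (s m) (s m)).

Lemma residual_psd n : psd (residual n).
Proof. by elim: n => // n IH; exact: schur_psd. Qed.

Lemma residualS n t u :
  residual n t u = residual n.+1 t u + kfactor t n * (kfactor u n)^*.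
Proof.
have sn := psd_diag_ge0 (s n) (residual_psd n).
rewrite /= /schur /kfactor; set o := s n; rewrite (psd_herm u o (residual_psd n)).
have so : (sqrtC (residual n o o))^* = sqrtC (residual n o o).
  by rewrite conj_Creal// ger0_real// sqrtC_ge0.
rewrite rmorphM fmorphV /= so mulrACA -invfM -expr2 sqrtCK.
by rewrite subrK.
Qed.

Lemma residual_sum n t u :
  k t u = \sum_(m < n) kfactor t m * (kfactor u m)^* + residual n t u.
Proof.
elim: n => [|n IH]; first by rewrite big_ord0 add0r.
by rewrite IH residualS big_ord_recr /= addrA addrAC.
Qed.

Lemma residual_diag_le m n t : (m <= n)%N -> residual n t t <= residual m t t.
Proof.
move=> /subnK <-; elim: (n - m)%N => // i IH.
by apply: le_trans IH; rewrite addSn [leRHS]residualS lerDl mul_conjC_ge0.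
Qed.

(** Step j annihilates the diagonal entry at s_j, monotonicity keeps it at 0, and Cauchy-Schwarz
    extends this to the whole column. *)
Lemma residual_vanish j n t : (j < n)%N -> residual n t (s j) = 0.
Proof.
move=> jn; have sj0 : residual n (s j) (s j) = 0.
  apply/eqP; rewrite eq_le (psd_diag_ge0 _ (residual_psd n)) andbT.
  rewrite (le_trans (residual_diag_le _ jn))//= /schur.
  have [->|o0] := eqVneq (residual j (s j) (s j)) 0; first by rewrite !mul0r subr0.
  by rewrite mulfK// subrr.
apply/eqP; rewrite -normr_eq0 -sqrf_eq0 eq_le exprn_ge0// andbT.
by rewrite (le_trans (psd_cauchy_schwarz _ _ (residual_psd n)))// sj0 mulr0.
Qed.

(** The squared distance between the vectors of t and u, when k is a Gram kernel. *)
Definition kdist t u := k t t - k t u - (k u t - k u u).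

(** The residual at s_j being 0, the left side is the squared distance from t to s_j for the
    residual kernel, and squared distances decrease with n. *)
Lemma residual_le_kdist j n t : (j < n)%N -> residual n t t <= kdist t (s j).
Proof.
move=> jn; pose D n := residual n t t - residual n t (s j) -
  (residual n (s j) t - residual n (s j) (s j)).
have -> : residual n t t = D n.
  have H := residual_vanish _ jn.
  by rewrite /D (psd_herm t (s j) (residual_psd n)) !H conjC0 !subr0.
have : D 0%N = kdist t (s j) by [].
move=> <-; elim: n {jn} => // n; apply: le_trans.
rewrite /D !(residualS n).
have -> (a b c d x y x' y' : C) : a + x * x' - (b + x * y') - (c + y * x' - (d + y * y')) =
   a - b - (c - d) + (x - y) * (x' - y') by ring.
by rewrite lerDl -rmorphB mul_conjC_ge0.
Qed.

(** The first alternative serves the points outside [Om], where the kernel is extended by 0. *)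
Hypothesis s_dense : forall t (e : R), 0 < e ->
  k t t <= e%:C%C \/ exists j, kdist t (s j) <= e%:C%C.

Lemma residual_cvg0 t (e : R) : 0 < e -> \forall n \near \oo, residual n t t <= e%:C%C.
Proof.
move=> e0; have [kt|[j jP]] := s_dense t e0.
  by apply: nearW => n; exact: le_trans (residual_diag_le t (leq0n n)) kt.
exists j.+1 => // n jn.
by rewrite (le_trans (residual_le_kdist _ jn)).
Qed.

Lemma kfactor_l2 t : kfactor t \in l2_pred setT.
Proof.
apply/l2_predP; split; last by move=> i; case.
exists (complex.Re (k t t)) => n.
rewrite -lecR (RRe_real (ger0_real (psd_diag_ge0 t kP))) (residual_sum n t t).
rewrite rmorph_sum (eq_bigr (fun m : 'I_n => kfactor t m * (kfactor t m)^*)).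
  by rewrite lerDl psd_diag_ge0//; exact: residual_psd.
by move=> i _; rewrite /= -normCK rnormE rmorphXn.
Qed.

Definition kvec t : @l2 R setT := L2 (kfactor_l2 t).

Lemma kvec_inner t u : l2_inner (kvec t) (kvec u) = k t u.
Proof.
apply: l2_innerP; apply/cvg_rnormP => e e0.
near=> n.
have -> : dotsum (kvec t) (kvec u) n - k t u = - residual n t u.
  by rewrite (residual_sum n) opprD addrA subrr add0r.
rewrite rnormN.
have r2 : rnorm (residual n t u) ^+ 2 <= (e / 2) ^+ 2.
  rewrite -lecR rmorphXn /= -rnormE.
  rewrite (le_trans (psd_cauchy_schwarz _ _ (residual_psd n)))//.
  rewrite rmorphM ler_pM ?psd_diag_ge0//; try exact: residual_psd.
    by near: n; apply: residual_cvg0; rewrite divr_gt0.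
  by near: n; apply: residual_cvg0; rewrite divr_gt0.
have {}r2 : rnorm (residual n t u) <= e / 2.
  by rewrite -ler_sqr ?nnegrE ?rnorm_ge0// divr_ge0// ltW.
by rewrite (le_lt_trans r2)// ltr_pdivrMr// ltr_pMr// ltr1n.
Unshelve. all: by end_near. Qed.

End Kolmogorov.

(** * Tuples of matrices *)

Section TupleNorms.
Context {R : realType}.
Local Notation C := R[i].

Lemma rnorm_mx_entry m n (M : 'M[C]_(m, n)) i j : rnorm (M i j) <= rnorm M.
Proof.
rewrite -lecR -!rnormE [leRHS]/Num.norm/= mx_normE -[leLHS]nngE num_le.
exact: (le_bigmax _ _ (i, j)).
Qed.

Lemma rnorm_mx_le_sum m n (M : 'M[C]_(m, n)) :
  rnorm M <= \sum_i \sum_j rnorm (M i j).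
Proof.
have [M0|/mx_norm_neq0[[i j] Mij]] := eqVneq (mx_norm M) 0.
  rewrite (_ : rnorm M = 0); last by rewrite /rnorm [`|M|]M0.
  apply: sumr_ge0 => i _; apply: sumr_ge0 => j _.
  exact: rnorm_ge0.
rewrite (_ : rnorm M = rnorm (M i j)); last by rewrite /rnorm [`|M|]Mij.
rewrite (bigD1 i)//= (bigD1 j)//= -addrA lerDl addr_ge0//.
  by apply: sumr_ge0 => j' _; exact: rnorm_ge0.
by apply: sumr_ge0 => i' _; apply: sumr_ge0 => j' _; exact: rnorm_ge0.
Qed.

Lemma family_rnormE (I : finType) (V : normedModType C) (x : family_of I V) :
  rnorm x = \sum_i rnorm (x i).
Proof.
apply: complexI; rewrite -rnormE rmorph_sum /=.
by apply: eq_bigr => i _; rewrite rnormE.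
Qed.

Lemma rnorm_family_entry (I : finType) (V : normedModType C) (x : family_of I V) i :
  rnorm (x i) <= rnorm x.
Proof.
rewrite family_rnormE (bigD1 i)//= lerDl.
by apply: sumr_ge0 => j _; exact: rnorm_ge0.
Qed.

End TupleNorms.

Section CompactNeighbourhoods.
Context {R : realType} (d n : nat).
Local Notation C := R[i].
Local Notation E := (@mxtuple R d n).

Lemma complex_box_compact (c : R) :
  compact [set z : C^o | `|complex.Re z| <= c /\ `|complex.Im z| <= c].
Proof.
have cR : compact (`[- c, c] `*` `[- c, c] : set (R * R)).
  by apply: compact_setX; exact: segment_compact.
have -> : [set z : C^o | `|complex.Re z| <= c /\ `|complex.Im z| <= c] =
    (fun p : R * R => (Complex p.1 p.2 : C^o)) @` (`[- c, c] `*` `[- c, c]).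
  apply/seteqP; split=> [[x y] /= [xc yc]|_ [[x y] /= [xc yc] <-]] /=.
    by exists (x, y) => //=; rewrite !in_itv /= -!ler_norml.
  by rewrite !in_itv /= -!ler_norml in xc yc.
apply: continuous_compact => //; apply: continuous_subspaceT => -[x y].
apply/cvg_rnormP => e e0; have e20 : 0 < e / 2 by rewrite divr_gt0.
have [xe ye] : (\forall p \near (x, y), `|p.1 - x| < e / 2) /\
               (\forall p \near (x, y), `|p.2 - y| < e / 2).
  split.
    have /cvgrPdist_lt/(_ _ e20) : fst p @[p --> (x, y)] --> x by exact: cvg_fst.
    by apply: filterS => p; rewrite distrC.
  have /cvgrPdist_lt/(_ _ e20) : snd p @[p --> (x, y)] --> y by exact: cvg_snd.
  by apply: filterS => p; rewrite distrC.
apply: filterS2 xe ye => p px py.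
by rewrite (le_lt_trans (ler_rnormReIm _))// ReB ImB /= [ltRHS]splitr ltrD.
Qed.

(** Row vectors make Tychonoff's theorem applicable to all the entries of a tuple at once. *)
Definition tuple_of_row (v : 'rV[C^o]_#|{: 'I_d * ('I_n * 'I_n)}|) : E :=
  [ffun a => \matrix_(i, j) (v ord0 (enum_rank (a, (i, j))) : C)].

Lemma tuple_rnorm_le (y : E) (c : R) : (forall a i j, rnorm (y a i j) <= c) ->
  rnorm y <= c *+ n *+ n *+ d.
Proof.
have cst (k : nat) (z : R) : \sum_(i < k) z = z *+ k by rewrite sumr_const card_ord.
move=> yc; rewrite family_rnormE -cst.
apply: ler_sum => a _; rewrite (le_trans (rnorm_mx_le_sum _))//.
rewrite -cst; apply: ler_sum => i _.
by rewrite -cst; apply: ler_sum => j _; exact: yc.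
Qed.

Lemma tuple_entry_le (y : E) a i j : rnorm (y a i j) <= rnorm y.
Proof. exact: le_trans (rnorm_mx_entry _ _ _) (rnorm_family_entry _ _). Qed.

Lemma tuple_entryB (x y : E) a i j : (x - y) a i j = x a i j - y a i j.
Proof. by rewrite /family_fun !ffunE !mxE. Qed.

Lemma tuple_of_row_continuous : continuous tuple_of_row.
Proof.
move=> v; apply/(@cvg_rnormP R _ _ (nbhs_filter v)) => e e0.
have M0 : 0 < (n * n * d).+1%:R :> R by rewrite ltr0n.
apply/(@nbhs_rnormP R ('rV[C]_#|{: 'I_d * ('I_n * 'I_n)}|)).
exists (e / (n * n * d).+1%:R); first by rewrite divr_gt0.
move=> w wv; rewrite (@le_lt_trans _ _ (rnorm (w - v : 'rV[C]__) *+ n *+ n *+ d))//.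
  apply: tuple_rnorm_le => a i j; rewrite tuple_entryB /family_fun !ffunE !mxE.
  by have := rnorm_mx_entry (w - v : 'rV[C]__) ord0 (enum_rank (a, (i, j))); rewrite !mxE.
rewrite -!mulrnA -mulr_natr; rewrite ltr_pdivlMr// in wv.
by apply: le_lt_trans wv; rewrite ler_wpM2l ?rnorm_ge0// ler_nat mulnA.
Qed.

Lemma tuple_ball_compact (x : E) (r : R) : 0 < r -> exists2 K : set E, compact K &
  exists2 e, 0 < e & forall y, (rnorm (y - x) < e -> K y) /\ (K y -> rnorm (y - x) < r).
Proof.
move=> r0; have M0 : 0 < (2 * (n * n * d).+1)%:R :> R by rewrite ltr0n muln_gt0.
(* There are n * n * d entries, each of modulus at most 2e; the successor makes the final inequality
   strict and the denominator nonzero. *)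
pose e := r / (2 * (n * n * d).+1)%:R; have e0 : 0 < e by rewrite divr_gt0.
pose B := [set v : 'rV[C^o]_#|{: 'I_d * ('I_n * 'I_n)}| |
  forall i, [set z : C^o | `|complex.Re z| <= e /\ `|complex.Im z| <= e] (v ord0 i)].
have cB : compact B.
  by apply: (@rV_compact C^o _ (fun=> [set z : C^o | _ /\ _])) => _; exact: complex_box_compact.
exists ((fun v => x + tuple_of_row v) @` B).
  apply: continuous_compact cB; apply: continuous_subspaceT => v.
  apply/(@cvg_rnormP R _ _ (nbhs_filter v)) => c c0.
  have /(@cvg_rnormP R _ _ (nbhs_filter v))/(_ _ c0) := @tuple_of_row_continuous v.
  by apply: (@filterS _ _ (nbhs_filter v)) => w; rewrite opprD addrACA subrr add0r.
exists e => // y; split=> [yx|[v vB <-]].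
  exists (\row_k ((y - x) (enum_val k).1 (enum_val k).2.1 (enum_val k).2.2)).
    move=> k; rewrite !mxE /=; set a := (enum_val k).1.
    have ze := le_lt_trans (tuple_entry_le (y - x) a (enum_val k).2.1 (enum_val k).2.2) yx.
    by split; [apply: le_trans (ger_rnormRe _) (ltW ze)|apply: le_trans (ger_rnormIm _) (ltW ze)].
  rewrite /= (_ : tuple_of_row _ = y - x) ?subrKC//.
  by apply/ffunP => a; apply/matrixP => i j; rewrite [in LHS]ffunE !mxE enum_rankK.
rewrite addrAC subrr add0r.
apply: (@le_lt_trans _ _ ((2 * e) *+ n *+ n *+ d)).
  apply: tuple_rnorm_le => a i j; rewrite /family_fun ffunE mxE.
  rewrite (le_trans (ler_rnormReIm _))// (_ : 2 * e = e + e); last by ring.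
  by have [] := vB (enum_rank (a, (i, j))) => ? ?; rewrite lerD.
have -> : 2 * e = r / (n * n * d).+1%:R.
  by rewrite /e natrM; move: ((n * n * d).+1%:R : R) (ltr0Sn R (n * n * d)) => m m0; field; rewrite gt_eqF.
rewrite -!mulrnA -(mulr_natr (_ / _)) ?mulnA mulrAC ltr_pdivrMr ?ltr0n//.
by rewrite ltr_pM2l// ltr_nat.
Qed.

Lemma tuple_dense : exists q : nat -> E, forall (x : E) (e : R), 0 < e ->
  exists j, rnorm (q j - x) < e.
Proof.
pose Q := {ffun 'I_d -> 'M[rat * rat]_n}.
pose emb (f : Q) : E := [ffun a => \matrix_(i, j)
  Complex (ratr (f a i j).1 : R) (ratr (f a i j).2)].
exists (fun j => if unpickle j is Some f then emb f else 0) => x e e0.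
have M0 : 0 < (2 * (n * n * d).+1)%:R :> R by rewrite ltr0n muln_gt0.
pose c := e / (2 * (n * n * d).+1%:R); have c0 : 0 < c by rewrite divr_gt0// mulr_gt0.
have ratP (y : R) : exists p : rat, `|ratr p - y| <= c.
  have [|p] := @rat_in_itvoo R (y - c) (y + c); first lra.
  by rewrite in_itv /= => /andP[? ?]; exists p; rewrite ler_norml; apply/andP; split; lra.
have [g gP] := choice ratP.
exists (pickle ([ffun a => \matrix_(i, j)
  (g (complex.Re (x a i j)), g (complex.Im (x a i j)))] : Q)).
rewrite pickleK (@le_lt_trans _ _ ((2 * c) *+ n *+ n *+ d))//.
  apply: tuple_rnorm_le => a i j; rewrite tuple_entryB [emb]lock /family_fun -lock.
  rewrite [X in X - _](_ : _ = Complex (ratr (g (complex.Re (x a i j)))) (ratr (g (complex.Im (x a i j))))).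
    rewrite (le_trans (ler_rnormReIm _))// ReB ImB /= (_ : 2 * c = c + c); last by ring.
    by rewrite lerD// gP.
  by rewrite /emb ffunE mxE ffunE mxE.
have -> : 2 * c = e / (n * n * d).+1%:R.
  by rewrite /c; move: ((n * n * d).+1%:R : R) (ltr0Sn R (n * n * d)) => m m0; field; rewrite gt_eqF.
rewrite -!mulrnA -(mulr_natr (_ / _)) ?mulnA mulrAC ltr_pdivrMr ?ltr0n//.
by rewrite ltr_pM2l// ltr_nat.
Qed.

End CompactNeighbourhoods.

(** * Limits of positive hereditary functions *)

Section GramForms.
Context {R : realType}.
Local Notation C := R[i].

Definition comb (T : Type) (V : lmodType C) (f : T -> V) (l : seq (C * T)) : V :=
  \sum_(p <- l) p.1 *: f p.2.

Lemma inner_comb (T : Type) (H : hilbert R) (f : T -> H) l :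
  inner H (comb f l) (comb f l) = quad (fun s t => inner H (f s) (f t)) l.
Proof.
rewrite /comb linear_sumlz /quad; apply: eq_bigr => p _.
rewrite linear_sumr; apply: eq_bigr => q _.
by rewrite linearZl_LR linearZr_LR /= mulrA.
Qed.

Lemma rnorm_comb_sqr (T : Type) (H : hilbert R) (f : T -> H) l :
  (rnorm (comb f l) ^+ 2)%:C%C = quad (fun s t => inner H (f s) (f t)) l.
Proof. by rewrite -inner_comb inner_norm rnormE rmorphXn. Qed.

Lemma quad_sum (T : Type) (I : finType) (k : I -> T -> T -> C) l :
  quad (fun s t => \sum_i k i s t) l = \sum_i quad (k i) l.
Proof.
rewrite /quad [RHS]exchange_big; apply: eq_bigr => p _.
by rewrite [RHS]exchange_big; apply: eq_bigr => q _; rewrite mulr_sumr.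
Qed.

Lemma quad_map (T T' : Type) (g : T -> T') (k : T' -> T' -> C) l :
  quad k [seq (p.1, g p.2) | p <- l] = quad (fun s t => k (g s) (g t)) l.
Proof. by rewrite /quad big_map; apply: eq_bigr => p _; rewrite big_map. Qed.

(** The square of the sum of the |c_p|: the factor by which a uniform error on a kernel is amplified
    in [quad]. *)
Definition mass (T : Type) (l : seq (C * T)) : R :=
  \sum_(p <- l) \sum_(q <- l) rnorm p.1 * rnorm q.1.

Lemma mass_ge0 (T : Type) (l : seq (C * T)) : 0 <= mass l.
Proof.
by apply: sumr_ge0 => p _; apply: sumr_ge0 => q _; rewrite mulr_ge0 ?rnorm_ge0.
Qed.

Lemma quad_dist (T : eqType) (k k' : T -> T -> C) (l : seq (C * T)) (e : R) :
  (forall p q, p \in l -> q \in l -> rnorm (k p.2 q.2 - k' p.2 q.2) <= e) ->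
  rnorm (quad k l - quad k' l) <= e * mass l.
Proof.
move=> kk'; rewrite /quad /mass -sumrB mulr_sumr (le_trans (rnorm_sum _ _ _))//.
rewrite big_seq [leRHS]big_seq; apply: ler_sum => p pl.
rewrite -sumrB mulr_sumr (le_trans (rnorm_sum _ _ _))//.
rewrite big_seq [leRHS]big_seq; apply: ler_sum => q ql.
rewrite -mulrBr rnormM rnormM mulrC.
have -> : rnorm (q.1^*) = rnorm q.1 by rewrite /rnorm norm_conjC.
by rewrite ler_wpM2r ?kk'// mulr_ge0 ?rnorm_ge0.
Qed.

Lemma ge0_approx (z : C) :
  (forall e : R, 0 < e -> exists2 w : C, 0 <= w & rnorm (z - w) <= e) -> 0 <= z.
Proof.
move=> zP; rewrite lecE /=; apply/andP; split.
  rewrite -normr_eq0 eq_le normr_ge0 andbT; apply/ler_addgt0Pl => e e0.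
  have [w /ger0_Im w0 zw] := zP e e0; rewrite addr0.
  by have := le_trans (ger_rnormIm _) zw; rewrite ImB w0 subr0.
apply/ler_addgt0Pl => e e0; have [w w0 zw] := zP e e0.
have := le_trans (ger_rnormRe _) zw; rewrite ReB ler_norml.
move: w0; rewrite lecE /= => /andP[_ ?] /andP[? ?]; lra.
Qed.

End GramForms.

(** * Restriction to one level and approximation of its kernel *)

Section Levels.
Context {R : realType} (d : nat) (n : nat).
Local Notation E n := (@mxtuple R d n.+1).

(** The graded set that is K at level n and empty elsewhere; the type of pairs depends on the level,
    hence the transport. *)
Definition at_level (K : set (E n * E n)) m : set (E m * E m) :=
  if pselect (n = m) is left e then eq_rect n (fun m => set (E m * E m)) K m e
  else set0.
Arguments at_level : clear implicits.

Lemma at_levelE K : at_level K n = K.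
Proof. by rewrite /at_level; case: pselect => // e; rewrite (eq_axiomK e). Qed.

Lemma at_level_neq K m : n <> m -> at_level K m = set0.
Proof. by rewrite /at_level; case: pselect. Qed.

Lemma at_level_finitely_compact (Om : forall n, set (E n)) (K : set (E n * E n)) :
  K `<=` Om n `*` Om n -> compact K -> finitely_compact Om (at_level K).
Proof.
move=> KOm cK; split.
- move=> m; have [<-|nm] := pselect (n = m); first by rewrite at_levelE.
  by rewrite at_level_neq// => p [].
- move=> m; have [<-|nm] := pselect (n = m); first by rewrite at_levelE.
  by rewrite at_level_neq//; exact: compact0.
- exists n.+1 => m nm; rewrite at_level_neq// => nm'.
  by rewrite nm' ltnn in nm.
Qed.

End Levels.

Section Extension.
Context {R : realType} (d : nat) (Om : forall n, set (@mxtuple R d n.+1)).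
Arguments Om : clear implicits.
Local Notation C := R[i].
Local Notation E n := (@mxtuple R d n.+1).

(* Extension by 0 outside Om, which spares the dependent arguments of A. *)
Definition ext (A : box_fun Om) n (x y : E n) : 'M[C]_n.+1 :=
  match pselect (Om n x), pselect (Om n y) with
  | left xP, left yP => A n (exist _ x (mem_set xP)) (exist _ y (mem_set yP))
  | _, _ => 0
  end.

Lemma ext_val A n (x y : Om n) : ext A (val x) (val y) = A n x y.
Proof.
rewrite /ext; case: pselect => [xP|]; last by case; exact: set_valP.
case: pselect => [yP|]; last by case; exact: set_valP.
by congr (A n _ _); exact: val_inj.
Qed.

Lemma ext_out A n (x y : E n) : ~ Om n x \/ ~ Om n y -> ext A x y = 0.
Proof.
by rewrite /ext; case: pselect => // xP; case: pselect => // yP [].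
Qed.

Lemma ext_in A n (x y : E n) : Om n x -> Om n y ->
  exists x' y' : Om n, [/\ val x' = x, val y' = y & ext A x y = A n x' y'].
Proof.
move=> xP yP; exists (exist _ x (mem_set xP)), (exist _ y (mem_set yP)).
by rewrite -ext_val.
Qed.

Lemma closure_approx (S : set (box_fun Om)) A : closure S A ->
  forall K (e : R), finitely_compact Om K -> 0 < e ->
  exists2 B, S B & forall n x y, K n (x, y) -> rnorm (ext A x y - ext B x y) < e.
Proof.
move=> SA K e Kc e0.
have [|B [SB AB]] := SA (xsection (unif_close K e%:C%C) A).
  apply: nbhs_entourage; exists K, e%:C%C; split => //.
  by rewrite ltcR.
exists B => // n x y Kxy; have [KOm _ _] := Kc.
have [/= xO yO] := KOm n _ Kxy.
have [x' [y' [xE yE ->]]] := ext_in A xO yO; rewrite -xE -yE ext_val.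
rewrite -ltcR -rnormE; move: AB; rewrite /xsection /= inE => AB.
by apply: AB; rewrite xE yE.
Qed.

End Extension.

Section LevelKernel.
Context {R : realType} (d : nat) (Om : forall n, set (@mxtuple R d n.+1)).
Arguments Om : clear implicits.
Local Notation C := R[i].
Local Notation E n := (@mxtuple R d n.+1).
Context (A : box_fun Om) (n : nat).
Hypothesis A_clo : closure (pos_cone Om) A.
Local Notation T := (E n * 'I_n.+1)%type.

(* With (x, i) standing for the i-th column of u(x), this is the Gram matrix of
   the columns when A = u(y)^* u(x). *)
Definition level_kernel (p q : T) : C := ext A p.1 q.1 q.2 p.2.

(** The value 0 outside [Om] matches [ext], so that forms can be compared at arbitrary points of the
    level. *)
Definition column (H : hilbert R) (u : E n -> hop n.+1 H) (p : T) (k : 'I_n.+1) : H :=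
  if pselect (Om n p.1) then u p.1 (k, p.2) else 0.

Definition column_kernel (H : hilbert R) (u : E n -> hop n.+1 H) (p q : T) : C :=
  \sum_k inner H (column u p k) (column u q k).

Lemma level_approx (K : set (E n * E n)) (e : R) :
  K `<=` Om n `*` Om n -> compact K -> 0 < e ->
  exists (H : hilbert R) (u : forall n, E n -> hop n.+1 H), Hol Om H u /\
    forall x y, K (x, y) -> rnorm (ext A x y - adj_mul (u n y) (u n x)) < e.
Proof.
move=> KOm cK e0.
have [B [H [u [uH ->]]] AB] := closure_approx A_clo (at_level_finitely_compact KOm cK) e0.
exists H, u; split=> // x y Kxy; have [/= xO yO] := KOm _ Kxy.
have := AB n x y; rewrite at_levelE => /(_ Kxy).
by have [x' [y' [<- <- ->]]] := ext_in (hereditary Om u u) xO yO.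
Qed.

Lemma column_kernelE (H : hilbert R) (u : E n -> hop n.+1 H) (p q : T) :
  Om n p.1 -> Om n q.1 -> column_kernel u p q = adj_mul (u q.1) (u p.1) q.2 p.2.
Proof.
move=> pO qO; rewrite mxE; apply: eq_bigr => k _.
by rewrite /column; case: pselect => [?|//]; case: pselect => [?|//].
Qed.

(** A single approximant serves two purposes: it is precise at the finitely many pairs of points of
    [l], and within 1 of A on the diagonal of K, whence its boundedness. Both sets of pairs are put
    into one compact set. *)
Lemma quad_approx (l : seq (C * T)) (K : set (E n)) (e : R) :
  K `<=` Om n -> compact K -> 0 < e ->
  exists (H : hilbert R) (u : forall n, E n -> hop n.+1 H), [/\ Hol Om H u,
    rnorm (quad level_kernel l - quad (column_kernel (u n)) l) <= e &
    forall y, K y -> rnorm (ext A y y - adj_mul (u n y) (u n y)) < 1].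
Proof.
move=> KO cK e0.
pose F := [set p : E n * E n | p \in [seq (a.2.1, b.2.1) | a <- l, b <- l]] `&`
  (Om n `*` Om n).
pose K0 := (fun y => (y, y)) @` K `|` F.
have K0O : K0 `<=` Om n `*` Om n.
  by move=> p [[y Ky <-]|[_ pO]]; [split => /=; exact: KO|exact: pO].
have cK0 : compact K0.
  apply: compactU.
    apply: continuous_compact cK; apply: continuous_subspaceT => y.
    move=> P [[P1 P2] /= [P1y P2y] PP].
    apply: (@filterS _ _ (nbhs_filter y)) (@filterI _ _ (nbhs_filter y) _ _ P1y P2y).
    by move=> z [P1z P2z]; exact: (PP (z, z)).
  apply: finite_compact; apply: sub_finite_set (@subIsetl _ _ _) _.
  exact: finite_seq.
have m0 : 0 < mass l + 1 by rewrite ltr_wpDl// mass_ge0.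
have [|H [u [uH uA]]] := @level_approx K0 (Num.min 1 (e / (mass l + 1))) K0O cK0.
  by rewrite lt_min ltr01 divr_gt0.
exists H, u; split=> //; last first.
  move=> y Ky; have Kyy : K0 (y, y) by left; exists y.
  by apply: lt_le_trans (uA _ _ Kyy) _; rewrite ge_min lexx.
rewrite (le_trans (@quad_dist _ _ _ _ _ (e / (mass l + 1)) _))//; last first.
  by rewrite mulrAC ler_pdivrMr// ler_wpM2l ?lerDl// ltW.
have ee : 0 <= e / (mass l + 1) by rewrite divr_ge0 ?ltW.
move=> p q pl ql.
have [[pO qO]|nO] := pselect (Om n p.2.1 /\ Om n q.2.1).
  rewrite column_kernelE// /level_kernel.
  have -> : ext A p.2.1 q.2.1 q.2.2 p.2.2 - adj_mul (u n q.2.1) (u n p.2.1) q.2.2 p.2.2 =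
    (ext A p.2.1 q.2.1 - adj_mul (u n q.2.1) (u n p.2.1)) q.2.2 p.2.2 by rewrite !mxE.
  rewrite (le_trans (rnorm_mx_entry _ _ _))// ltW//.
  apply: lt_le_trans (uA _ _ _) _; last by rewrite ge_min lexx orbT.
  by right; split => //=; apply/allpairsP; exists (p, q).
have nO' : ~ Om n p.2.1 \/ ~ Om n q.2.1 by apply/not_andP.
rewrite /level_kernel ext_out// mxE /column_kernel big1 ?subrr ?rnorm0// => k _.
rewrite /column; case: pselect => [pO|?]; last by rewrite linear0l.
by case: pselect => [qO|?]; [case: nO|rewrite linear0r].
Qed.

Lemma quad_column (H : hilbert R) (u : E n -> hop n.+1 H) l :
  quad (column_kernel u) l = (\sum_k rnorm (comb (column u ^~ k) l) ^+ 2)%:C%C.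
Proof.
rewrite quad_sum rmorph_sum; apply: eq_bigr => k _ /=.
by rewrite rnorm_comb_sqr.
Qed.

Lemma level_psd : psd level_kernel.
Proof.
move=> l; apply: ge0_approx => e e0.
have [|H [u [_ uA _]]] := @quad_approx l set0 e _ (@compact0 _) e0; first by move=> ? [].
exists (quad (column_kernel (u n)) l) => //.
by rewrite quad_column ler0c sumr_ge0// => k _; exact: sqr_ge0.
Qed.

End LevelKernel.

Lemma bounded_on_compact (R : realType) (W V : normedModType R[i]) (f : W -> V) (K : set W) :
  compact K -> (forall y, K y -> {for y, continuous f}) ->
  exists M : R, forall y, K y -> rnorm (f y) <= M.
Proof.
move=> cK fc.
have : compact ((fun y => rnorm (f y)) @` K).
  apply: continuous_compact => //; apply: continuous_in_subspaceT => y /set_mem Ky.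
  apply/cvgrPdist_lt => e e0.
  have /cvg_rnormP/(_ e e0) := fc y Ky; apply: filterS => z zy.
  rewrite (le_lt_trans _ zy)// ler_norml.
  have := ler_rnormD (f z - f y) (f y); have := ler_rnormD (f y - f z) (f z).
  rewrite !subrK (rdistC (f y)) => H1 H2; apply/andP; split; lra.
move=> /compact_bounded[M [Mr MP]]; exists (M + 1) => y Ky.
have := MP (M + 1); rewrite ltrDl ltr01 => /(_ isT (rnorm (f y))) H.
by rewrite (le_trans (ler_norm _))// H//; exists y.
Qed.

(** * Transfer of estimates to the limit kernel *)

Section LevelFactorization.
Context {R : realType} (d : nat) (Om : forall n, set (@mxtuple R d n.+1)).
Arguments Om : clear implicits.
Local Notation C := R[i].
Local Notation E n := (@mxtuple R d n.+1).
Context (A : box_fun Om) (n : nat).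
Hypothesis A_clo : closure (pos_cone Om) A.
Hypothesis Om_open : open (Om n).
Local Notation T := (E n * 'I_n.+1)%type.
Local Notation kA := (@level_kernel R d Om A n).

Lemma diag_entry (H : hilbert R) (u : hop n.+1 H) i :
  adj_mul u u i i = (\sum_k rnorm (u (k, i)) ^+ 2)%:C%C.
Proof.
rewrite mxE rmorph_sum; apply: eq_bigr => k _ /=.
by rewrite inner_norm rnormE rmorphXn.
Qed.

(** A fixed approximant [u0], bounded on K by continuity, bounds the diagonal of A there, hence that
    of every kernel within 1 of A on the diagonal. The 2 in M1 + 2 counts these two
    approximations. *)
Lemma column_bound (K : set (E n)) : K `<=` Om n -> compact K -> exists M : R,
  forall (H : hilbert R) (u : E n -> hop n.+1 H),
  (forall y, K y -> rnorm (ext A y y - adj_mul (u y) (u y)) < 1) ->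
  forall y k i, K y -> rnorm (u y (k, i)) <= M.
Proof.
move=> KO cK.
have [H0 [u0 [u0H _ u0A]]] := quad_approx A_clo [::] KO cK (@ltr01 R).
have [|M0 M0P] := @bounded_on_compact _ _ _ (u0 n) K cK.
  by move=> y Ky; apply: differentiable_continuous; apply: u0H; exact: KO.
pose M1 := (M0 ^+ 2) *+ n.+1.
have M1_ge0 : 0 <= M1 by rewrite mulrn_wge0// sqr_ge0.
exists (M1 + 2) => H u uA y k i Ky.
have e0 : rnorm (adj_mul (u0 n y) (u0 n y) i i) <= M1.
  rewrite diag_entry rnormC ger0_norm ?sumr_ge0// => [|j _]; last exact: sqr_ge0.
  rewrite /M1 -[X in _ *+ X]card_ord -sumr_const; apply: ler_sum => j _.
  rewrite lerXn2r ?nnegrE ?rnorm_ge0//.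
    by rewrite (le_trans _ (M0P y Ky))// rnorm_ge0.
  exact: le_trans (rnorm_family_entry _ _) (M0P y Ky).
have d0 : rnorm (ext A y y i i - adj_mul (u0 n y) (u0 n y) i i) <= 1.
  have := le_trans (rnorm_mx_entry _ i i) (ltW (u0A y Ky)).
  by rewrite [X in rnorm X](_ : _ = ext A y y i i - adj_mul (u0 n y) (u0 n y) i i)// !mxE.
have d1 : rnorm (ext A y y i i - adj_mul (u y) (u y) i i) <= 1.
  have := le_trans (rnorm_mx_entry _ i i) (ltW (uA y Ky)).
  by rewrite [X in rnorm X](_ : _ = ext A y y i i - adj_mul (u y) (u y) i i)// !mxE.
have eu : rnorm (adj_mul (u y) (u y) i i) <= M1 + 2.
  have := ler_rdistD (ext A y y i i) (adj_mul (u y) (u y) i i) (adj_mul (u0 n y) (u0 n y) i i).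
  have := ler_rnormD (adj_mul (u y) (u y) i i - adj_mul (u0 n y) (u0 n y) i i) (adj_mul (u0 n y) (u0 n y) i i).
  rewrite subrK (rdistC _ (ext A y y i i)) => H1 H2; lra.
have : rnorm (u y (k, i)) ^+ 2 <= M1 + 2.
  apply: le_trans eu; rewrite diag_entry rnormC ger0_norm ?sumr_ge0// => [|j _]; last exact: sqr_ge0.
  by rewrite (bigD1 k)//= lerDl sumr_ge0// => j _; exact: sqr_ge0.
(* The bound is on the square; a norm above 1 is at most its square. *)
have [u1|u1] := leP (rnorm (u y (k, i))) 1; first by move=> _; lra.
by apply: le_trans; rewrite expr2 ler_peMr ?rnorm_ge0 ?ltW.
Qed.

Lemma cdiff_family (I : finType) (V : normedModType C) (f : C -> family_of I V) z B c :
  cdiff f z B -> cdiff (fun t => f t c) z (B c).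
Proof.
move=> [phi phiB fphi]; exists (fun t => phi t c).
  apply/cvg_rnormP => e e0; have /cvg_rnormP/(_ e e0) := phiB.
  apply: filterS => t; apply: le_lt_trans.
  by have := rnorm_family_entry (phi t - B) c; rewrite /family_fun !ffunE.
apply: filterS fphi => t ->.
by rewrite /family_fun !ffunE.
Qed.

Lemma line_diff_family (I : finType) (V W : normedModType C) (f : V -> family_of I W) y c :
  line_diff f y -> line_diff (fun x => f x c) y.
Proof. by move=> fy h; have [B /(cdiff_family c) fB] := fy h; exists (B c). Qed.

(** Any bound on a combination that holds for all maps bounded by M near x, holomorphic along lines
    and valued in any Hilbert space, passes to the kernel of A. It applies to each of the n + 1
    components of a column of an approximant, hence the factor n + 1. *)
Lemma local_transfer x : Om n x -> exists r M : R, [/\ 0 < r, 0 <= M,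
  (forall y, rnorm (y - x) < r -> Om n y) &
  forall (i : 'I_n.+1) (l : seq (C * E n)) (b : R),
    (forall p, p \in l -> rnorm (p.2 - x) < r) ->
    (forall (H : hilbert R) (f : E n -> H),
      (forall y, rnorm (y - x) < r -> line_diff f y /\ rnorm (f y) <= M) ->
      rnorm (comb f l) <= b) ->
    quad kA [seq (p.1, (p.2, i)) | p <- l] <= (n.+1%:R * b ^+ 2)%:C%C].
Proof.
move=> xO.
have /nbhs_rnormP[r0 r00 r0O] : nbhs x (Om n) by exact: open_nbhs_nbhs.
have [K cK [r r_gt0 rK]] := tuple_ball_compact x r00.
have KO : K `<=` Om n by move=> y Ky; apply: r0O; exact: (rK y).2.
have [M0 M0P] := column_bound KO cK; pose M := `|M0|.
exists r, M; split; [exact: r_gt0|exact: normr_ge0|by move=> y /(rK y).1; exact: KO|].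
move=> i l b lr fb.
set l' := map _ _.
have : forall e : R, 0 < e -> quad kA l' <= (n.+1%:R * b ^+ 2 + e)%:C%C.
  move=> e e0; have [H [u [uH ul uA]]] := quad_approx A_clo l' KO cK e0.
  have ub : quad (column_kernel Om (u n)) l' <= (n.+1%:R * b ^+ 2)%:C%C.
    have -> : n.+1%:R * b ^+ 2 = \sum_(k < n.+1) b ^+ 2.
      by rewrite sumr_const card_ord mulr_natl.
    rewrite quad_column lecR; apply: ler_sum => k _.
    have -> : comb (column Om (u n) ^~ k) l' = comb (fun y => column Om (u n) (y, i) k) l.
      by rewrite /comb big_map.
    have : rnorm (comb (fun y => u n y (k, i)) l) <= b.
      apply: fb => y yx; split; last by rewrite (le_trans (M0P _ _ uA _ _ _ _)) ?ler_norm//; exact: (rK y).1.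
      apply: line_diff_family; apply: differentiable_line; apply: uH.
      by apply: KO; exact: (rK y).1.
    have -> : comb (fun y => u n y (k, i)) l = comb (fun y => column Om (u n) (y, i) k) l.
      rewrite /comb big_seq [RHS]big_seq; apply: eq_bigr => p /lr pr.
      by rewrite /column /=; case: pselect => // -[]; apply: KO; exact: (rK _).1.
    by move=> cb; rewrite lerXn2r ?nnegrE ?rnorm_ge0// (le_trans (rnorm_ge0 _) cb).
  have A0 := level_psd A_clo l'.
  have U0 : 0 <= quad (column_kernel Om (u n)) l'.
    by rewrite quad_column ler0c sumr_ge0// => k _; exact: sqr_ge0.
  move: A0 U0 ub ul; rewrite !lecE/= => /andP[/eqP -> A0] /andP[/eqP u0 U0] /andP[_ ub] ul.
  rewrite eqxx /=; have := le_trans (ger_rnormRe _) ul; rewrite ReB ler_norml.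
  by move=> /andP[_]; lra.
move=> le_e; have A0 := level_psd A_clo l'.
rewrite lecE /= (ger0_Im A0) eqxx /=; apply/ler_addgt0Pl => e /le_e.
by rewrite lecE /= => /andP[_]; rewrite addrC.
Qed.

End LevelFactorization.

Section LevelVectors.
Context {R : realType} (d : nat) (Om : forall n, set (@mxtuple R d n.+1)).
Arguments Om : clear implicits.
Local Notation C := R[i].
Local Notation E n := (@mxtuple R d n.+1).
Context (A : box_fun Om) (n : nat).
Hypothesis A_clo : closure (pos_cone Om) A.
Hypothesis Om_open : open (Om n).
Local Notation T := (E n * 'I_n.+1)%type.
Local Notation kA := (@level_kernel R d Om A n).

Lemma comb_seq2 (V : lmodType C) (f : E n -> V) (a b : C) x y :
  comb f [:: (a, x); (b, y)] = a *: f x + b *: f y.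
Proof. by rewrite /comb !big_cons big_nil addr0. Qed.

Lemma comb_seq4 (V : lmodType C) (f : E n -> V) (a b c e : C) x y z t :
  comb f [:: (a, x); (b, y); (c, z); (e, t)] = a *: f x + (b *: f y + (c *: f z + e *: f t)).
Proof. by rewrite /comb !big_cons big_nil addr0. Qed.

Lemma kdist_quad (s t : T) : kdist kA s t = quad kA [:: (1, s); (-1, t)].
Proof. by rewrite quad2 /kdist rmorphN conjC1; ring. Qed.

(** The Lipschitz bound, transferred to the combination of x and y with coefficients 1 and -1, turns
    density of a sequence of tuples into density for [kdist]. *)
Lemma level_kernel_dense : exists s : nat -> T, forall t (e : R), 0 < e ->
  kA t t <= e%:C%C \/ exists j, kdist kA t (s j) <= e%:C%C.
Proof.
have [q qP] := @tuple_dense R d n.+1.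
exists (fun j => if unpickle j is Some (a, i) then (q a, i) else (q 0%N, ord0 : 'I_n.+1)).
move=> [x i] e e0; have [xO|xO] := pselect (Om n x); last first.
  by left; rewrite /level_kernel ext_out; [rewrite mxE ler0c ltW|left].
right; have [r [M [r0 M0 rO rP]]] := local_transfer A_clo Om_open xO.
pose L := 20 * M / r.
have L0 : 0 <= L.
  by apply: divr_ge0 (ltW r0); apply: mulr_ge0 M0; exact: ler0n.
pose c := n.+1%:R * L ^+ 2 + 1.
have c0 : 0 < c by rewrite ltr_wpDl// mulr_ge0// sqr_ge0.
(* r/4 for the Lipschitz bound, 1 to replace a squared distance by the distance, e/c to conclude. *)
have [|a xa] := qP x (Num.min (r / 4) (Num.min 1 (e / c))).
  by rewrite !lt_min ltr01 !divr_gt0.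
exists (pickle (a, i)); rewrite pickleK kdist_quad.
move: xa; rewrite !lt_min => /and3P[xr x1 xe].
set y := q a in xr x1 xe *; have xy0 := rnorm_ge0 (y - x).
have := rP i [:: (1, x); (-1, y)] (L * rnorm (y - x)) => /=.
move=> H; apply: le_trans (H _ _) _.
- move=> p; rewrite !inE => /orP[] /eqP -> /=; first by rewrite subrr rnorm0.
  lra.
- move=> H' f fP; rewrite comb_seq2 scale1r scaleN1r rdistC.
  have := lipschitz_of_bounded (h := y - x) r0 fP; rewrite subrKC; apply.
  exact: ltW.
rewrite lecR exprMn mulrA.
have y2 : rnorm (y - x) ^+ 2 <= rnorm (y - x) by rewrite expr2 ler_piMr// ltW.
apply: (@le_trans _ _ (c * rnorm (y - x))); last by rewrite mulrC -ler_pdivlMr// ltW.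
have Lc : n.+1%:R * L ^+ 2 <= c by rewrite /c lerDl.
apply: ler_pM Lc y2; last exact: sqr_ge0.
by apply: mulr_ge0; [exact: ler0n|exact: sqr_ge0].
Qed.

(** Increments, second differences and homogeneity defects are combinations of two or four values,
    with coefficients 1, -1, z and -z, so each estimate on bounded holomorphic maps transfers to [w]
    and [differentiable_of_defects] applies. *)
Lemma level_vectors : exists w : T -> @l2 R setT,
  (forall s t, l2_inner (w s) (w t) = kA s t) /\
  forall i x, Om n x -> differentiable (fun y => w (y, i)) x.
Proof.
have [s sP] := level_kernel_dense.
pose w := kvec s (level_psd A_clo).
have wP p q : l2_inner (w p) (w q) = kA p q by exact: kvec_inner.
exists w; split=> [|i x xO]; first exact: wP.
have [r [M [r0 M0 rO rP]]] := local_transfer A_clo Om_open xO.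
pose f y : @l2_hilbert R setT := w (y, i).
have fP (l : seq (C * E n)) (b : R) : 0 <= b -> (forall p, p \in l -> rnorm (p.2 - x) < r) ->
    (forall (H : hilbert R) (f : E n -> H),
      (forall y, rnorm (y - x) < r -> line_diff f y /\ rnorm (f y) <= M) ->
      rnorm (comb f l) <= b) -> rnorm (comb f l) <= n.+1%:R * b.
  move=> b0 lr lb; have := rP i l b lr lb.
  have <- : (rnorm (comb f l) ^+ 2)%:C%C = quad kA [seq (p.1, (p.2, i)) | p <- l].
    rewrite rnorm_comb_sqr (quad_map (fun y => (y, i))) /quad; apply: eq_bigr => p _.
    by apply: eq_bigr => q _; rewrite -wP.
  rewrite lecR => H.
  rewrite -ler_sqr ?nnegrE ?rnorm_ge0 ?mulr_ge0// (le_trans H)//.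
  (* Bounding n + 1 by its square avoids a square root in the constant. *)
  rewrite exprMn ler_wpM2r ?sqr_ge0//.
  by rewrite expr2 ler_peMl// ler1n.
pose L := 20 * M / r; pose K := 1600 * M / r ^+ 2.
have L0 : 0 <= L by apply: divr_ge0 (ltW r0); apply: mulr_ge0 M0; exact: ler0n.
have K0 : 0 <= K by apply: divr_ge0 (sqr_ge0 _); apply: mulr_ge0 M0; exact: ler0n.
have r80 : 0 < r / 8 by rewrite divr_gt0.
have dx h : rnorm h <= r / 8 -> rnorm (x + h - x) < r.
  by move=> hr; rewrite addrAC subrr add0r; lra.
have xx : rnorm (x - x) < r by rewrite subrr rnorm0.
apply: (@differentiable_of_defects R (E n) (@l2_hilbert R setT) f x (r / 8)
  (n.+1%:R * K) (n.+1%:R * L) r80).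
- exact: mulr_ge0 (ler0n _ _) K0.
- move=> h hr.
  have -> : f (x + h) - f x = comb f [:: (1, x + h); (-1, x)].
    by rewrite comb_seq2 scale1r scaleN1r.
  rewrite -mulrA; apply: fP; first exact: mulr_ge0 L0 (rnorm_ge0 _).
    by move=> p; rewrite !inE => /orP[] /eqP ->; [exact: dx|exact: xx].
  move=> H g gP; rewrite comb_seq2 scale1r scaleN1r.
  apply: lipschitz_of_bounded r0 gP _; apply: le_trans hr _; lra.
- move=> h k hr kr.
  have -> : f (x + h + k) - f (x + h) - (f (x + k) - f x) =
      comb f [:: (1, x + h + k); (-1, x + h); (-1, x + k); (1, x)].
    by rewrite comb_seq4 !scale1r !scaleN1r opprB !addrA (addrAC _ (- f (x + k))).
  rewrite -mulrA; apply: fP; first exact: mulr_ge0 K0 (mulr_ge0 (rnorm_ge0 _) (rnorm_ge0 _)).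
    move=> p; rewrite !inE => /or4P[] /eqP ->; [|exact: dx|exact: dx|exact: xx].
    rewrite -(addrA x) addrAC subrr add0r (le_lt_trans (ler_rnormD _ _))//; lra.
  move=> H g gP; rewrite comb_seq4 !scale1r !scaleN1r.
  have := second_difference_le r0 gP hr kr.
  by rewrite opprB !addrA (addrAC _ (- g (x + k))).
- move=> h z hr z1.
  have -> : f (x + z *: h) - f x - z *: (f (x + h) - f x) =
      comb f [:: (1, x + z *: h); (-1, x); (- z, x + h); (z, x)].
    by rewrite comb_seq4 scale1r scaleN1r scalerBr scaleNr opprB !addrA (addrAC _ (- (z *: _))).
  rewrite -mulrA; apply: fP; first exact: mulr_ge0 K0 (sqr_ge0 _).
    move=> p; rewrite !inE => /or4P[] /eqP ->; [apply: dx|exact: xx|exact: dx|exact: xx].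
    by rewrite rnormZ (le_trans _ hr)// ler_piMl ?rnorm_ge0.
  move=> H g gP; rewrite comb_seq4 scale1r scaleN1r.
  have := homogeneous_defect_le r0 gP hr z1.
  by rewrite scalerBr scaleNr opprB !addrA (addrAC _ (- (z *: _))).
Qed.

End LevelVectors.

(** * Differentiability of families, coordinate by coordinate *)

Section DifferentiableFamilies.
Context {R : realType}.
Local Notation C := R[i].

Lemma contraction_differentiable (V W : normedModType C) (f : {linear V -> W}) :
  (forall v, rnorm (f v) <= rnorm v) -> forall x, differentiable f x.
Proof.
move=> fP x; apply: linear_differentiable => y.
apply/cvg_rnormP => e e0; apply/nbhs_rnormP; exists e => // v vy.
by rewrite -linearB (le_lt_trans (fP _)).
Qed.

Section Family.
Context (I : finType) (V : normedModType C).

Definition family_proj (c : I) (x : family_of I V) : V := x c.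

Lemma family_proj_linear c : linear (family_proj c).
Proof. by move=> a x y; rewrite /family_proj /family_fun !ffunE. Qed.

HB.instance Definition _ c :=
  GRing.isLinear.Build C (family_of I V) V *:%R (family_proj c) (family_proj_linear c).

Definition family_inj (c : I) (v : V) : family_of I V :=
  [ffun c' => if c' == c then v else 0].

Lemma family_inj_linear c : linear (family_inj c).
Proof.
move=> a v w; apply/ffunP => c'; rewrite !ffunE.
by case: eqP; rewrite ?scaler0 ?addr0.
Qed.

HB.instance Definition _ c :=
  GRing.isLinear.Build C V (family_of I V) *:%R (family_inj c) (family_inj_linear c).

Lemma rnorm_family_inj c v : rnorm (family_inj c v) = rnorm v.
Proof.
rewrite family_rnormE (bigD1 c)//= big1 ?addr0 => [|c' c'c].
  by rewrite /family_fun ffunE eqxx.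
by rewrite /family_fun ffunE (negbTE c'c) rnorm0.
Qed.

Lemma family_sum (x : family_of I V) : x = \sum_c family_inj c (x c).
Proof.
apply/ffunP => c; rewrite sum_ffunE (bigD1 c)//= big1 ?addr0 => [|c' c'c].
  by rewrite ffunE eqxx.
by rewrite ffunE eq_sym (negbTE c'c).
Qed.

Lemma differentiable_family (E : normedModType C) (f : E -> family_of I V) x :
  (forall c, differentiable (fun y => f y c) x) -> differentiable f x.
Proof.
move=> fc.
have -> : f = (fun y => \sum_c family_inj c (f y c)).
  by apply/funext => y; exact: family_sum.
elim: (index_enum I) => [|c r IH].
  under eq_fun do rewrite big_nil.
  exact: differentiable_cst.
under eq_fun do rewrite big_cons.
apply: (@differentiableD _ _ _ (fun y => family_inj c (f y c))
  (fun y => \sum_(j <- r) family_inj j (f y j))) => //.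
apply: (@differentiable_comp _ _ _ _ (fun y => f y c) (family_inj c)) => //.
by apply: contraction_differentiable => v; rewrite rnorm_family_inj.
Qed.

Lemma differentiable_proj (E : normedModType C) (f : E -> family_of I V) x c :
  differentiable f x -> differentiable (fun y => f y c) x.
Proof.
move=> fx; apply: (@differentiable_comp _ _ _ _ f (family_proj c)) => //.
by apply: contraction_differentiable => v; exact: rnorm_family_entry.
Qed.

End Family.
End DifferentiableFamilies.

Section Factorization.
Context {R : realType} (d : nat) (Om : forall n, set (@mxtuple R d n.+1)).
Arguments Om : clear implicits.
Local Notation C := R[i].
Local Notation E n := (@mxtuple R d n.+1).
Hypothesis Om_open : finitely_open Om.

Lemma closure_pos_cone (A : box_fun Om) : closure (pos_cone Om) A ->
  exists u, Hol Om (@l2_hilbert R setT) u /\ A = hereditary Om u u.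
Proof.
move=> A_clo.
have Oo n : open (Om n) by exact: Om_open.
pose w n := projT1 (cid (level_vectors A_clo (Oo n))).
have wP n := projT2 (cid (level_vectors A_clo (Oo n))).
(* The columns of A are realized in a single row of u. *)
pose u n (y : E n) : hop n.+1 (@l2_hilbert R setT) :=
  [ffun p : 'I_n.+1 * 'I_n.+1 => if p.1 == ord0 then w n (y, p.2) else 0].
exists u; split.
  move=> n x xO; apply: differentiable_family => -[k j].
  have [k0|k0] := eqVneq k ord0.
    rewrite (_ : (fun y => _) = (fun y => w n (y, j))); last first.
      by apply/funext => y; rewrite /family_fun ffunE /= k0 eqxx.
    exact: (wP n).2.
  rewrite (_ : (fun y => _) = (fun=> 0)); last first.
    by apply/funext => y; rewrite /family_fun ffunE /= (negbTE k0).
  exact: differentiable_cst.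
apply: functional_extensionality_dep => n; apply/funext => x; apply/funext => y.
apply/matrixP => i j.
rewrite -ext_val /hereditary mxE (bigD1 ord0)//= big1 ?addr0 => [|k k0]; last first.
  by rewrite /family_fun !ffunE /= (negbTE k0) linear0l.
by rewrite /family_fun !ffunE /= (wP n).1.
Qed.

End Factorization.

(** * Approximation by finite-dimensional kernels *)

Section Truncation.
Context {R : realType} (N : nat).
Local Notation C := R[i].
Local Notation H := (@l2_hilbert R setT).
Local Notation HN := (@l2_hilbert R [set i | (i < N)%N]).

Lemma truncate_l2 (x : H) :
  (fun i => if (i < N)%N then (x : l2 setT) i else 0) \in l2_pred [set i | (i < N)%N].
Proof.
apply/l2_predP; split=> [|i /= /negP/negbTE -> //].
exists (rnorm x ^+ 2) => n; apply: le_trans (sqsum_le_rnorm _ n).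
by apply: ler_sum => i _; case: ifP => // _; rewrite rnorm0 expr0n sqr_ge0.
Qed.

(** The target is a space of its own and not a subspace of l2, since [pre_Her] requires the whole
    Hilbert space to be finite dimensional. *)
Definition truncate (x : H) : HN := L2 (truncate_l2 x).

Lemma truncate_linear : linear truncate.
Proof.
move=> a x y; apply: l2P => i; rewrite !l2E /=.
by case: ifP => // _; rewrite mulr0 addr0.
Qed.

HB.instance Definition _ := GRing.isLinear.Build C H HN *:%R truncate truncate_linear.

Lemma rnorm_truncate x : rnorm (truncate x) <= rnorm x.
Proof.
apply: rnorm_le_sqsum; first exact: rnorm_ge0.
move=> n; apply: le_trans (sqsum_le_rnorm x n).
by apply: ler_sum => i _ /=; case: ifP => // _; rewrite rnorm0 expr0n sqr_ge0.
Qed.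

Lemma inner_truncate x y : inner HN (truncate x) (truncate y) = dotsum x y N.
Proof.
apply: l2_innerP; apply/cvg_rnormP => e e0; exists N => // n /= Nn.
rewrite (_ : dotsum _ _ n = dotsum x y N) ?subrr ?rnorm0//.
rewrite /dotsum -(big_mkord xpredT (fun i => l2_val (truncate x) i * (l2_val (truncate y) i)^*)).
rewrite -(big_mkord xpredT (fun i => l2_val x i * (l2_val y i)^*)).
rewrite (big_cat_nat (leq0n N) Nn)//= [X in _ + X = _]big1_seq ?addr0 => [|i].
  by apply: eq_big_nat => i /= iN; rewrite iN.
by rewrite mem_index_iota leqNgt => /and3P[_ /negbTE -> _]; rewrite mul0r.
Qed.

Lemma truncated_finite_dim : finite_dim HN.
Proof.
have dP (i : 'I_N) : (fun j => (j == i :> nat)%:R : C) \in l2_pred [set i | (i < N)%N].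
  apply/l2_predP; split=> [|j /= /negP jN]; last first.
    by case: eqP => // ji; rewrite ji ltn_ord in jN.
  exists 1 => n; rewrite /sqsum.
  have [ni|ni] := leqP n i.
    rewrite big1 ?ler01// => j _; rewrite (_ : (j == i :> nat) = false) ?rnorm0 ?expr0n//.
    by apply/negbTE; rewrite neq_ltn (leq_trans (ltn_ord j) ni).
  rewrite (bigD1 (Ordinal ni))//= eqxx rnorm1 expr1n big1 ?addr0// => j ji.
  by rewrite (_ : (j == i :> nat) = false) ?rnorm0 ?expr0n//; apply/negbTE.
exists N, (fun i => L2 (dP i)) => x; exists (fun i => (x : l2 _) i).
apply: l2P => j.
have sumE (r : seq 'I_N) (F : 'I_N -> HN) :
    l2_val (\sum_(i <- r) F i) j = \sum_(i <- r) l2_val (F i) j.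
  by elim: r => [|i r IH]; rewrite ?big_nil// !big_cons -IH.
have cE (i : 'I_N) : l2_val (l2_val x i *: (L2 (dP i) : HN)) j = l2_val x i * (j == i :> nat)%:R by [].
rewrite sumE (eq_bigr _ (fun i _ => cE i)).
have [jN|jN] := leqP N j.
  rewrite l2_eq0 => [|/=]; last by apply/negP; rewrite -leqNgt.
  rewrite big1// => i _; rewrite (_ : (j == i :> nat) = false) ?mulr0//.
  by apply/negbTE; rewrite neq_ltn (leq_trans (ltn_ord i) jN) orbT.
rewrite (bigD1 (Ordinal jN))//= eqxx mulr1 big1 ?addr0// => i ij.
rewrite (_ : (j == i :> nat) = false) ?mulr0//.
by apply/negbTE; rewrite eq_sym.
Qed.

End Truncation.

Section Approximation.
Context {R : realType}.
Local Notation C := R[i].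

Lemma rnorm_inner (H : hilbert R) (x y : H) : rnorm (inner H x y) <= rnorm x * rnorm y.
Proof.
rewrite -ler_sqr ?nnegrE ?mulr_ge0 ?rnorm_ge0// -lecR.
have sq (V : normedModType C) (v : V) : (rnorm v ^+ 2)%:C%C = `|v| ^+ 2.
  by rewrite rmorphXn /= -rnormE.
rewrite exprMn (rmorphM _ (rnorm x ^+ 2)) /= (sq C^o) !sq -!inner_norm.
exact: dot_cauchy_schwarz.
Qed.

Lemma inner_dist (H : hilbert R) (x y x0 y0 : H) :
  rnorm (inner H x y - inner H x0 y0) <=
  rnorm (x - x0) * rnorm y + rnorm x0 * rnorm (y - y0).
Proof.
have -> : inner H x y - inner H x0 y0 = inner H (x - x0) y + inner H x0 (y - y0).
  by rewrite linearBl linearBr /= addrA subrK.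
by rewrite (le_trans (ler_rnormD _ _))// lerD ?rnorm_inner.
Qed.

Lemma mx_rnorm_le m (M : 'M[C]_m) (c : R) : (forall i j, rnorm (M i j) <= c) ->
  rnorm M <= (m * m)%:R * c.
Proof.
have cst (k : nat) (z : R) : \sum_(i < k) z = z *+ k by rewrite sumr_const card_ord.
move=> Mc; rewrite (le_trans (rnorm_mx_le_sum _))// mulr_natl mulrnA -cst.
by apply: ler_sum => i _; rewrite -cst; apply: ler_sum => j _.
Qed.

Lemma adj_mul_dist m (H : hilbert R) (T S T0 S0 : hop m H) :
  rnorm (adj_mul S T - adj_mul S0 T0) <=
  (m * m)%:R * (m%:R * (rnorm (T - T0) * rnorm S + rnorm T0 * rnorm (S - S0))).
Proof.
apply: mx_rnorm_le => i j; rewrite !mxE -sumrB (le_trans (rnorm_sum _ _ _))//.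
rewrite mulr_natl -[X in _ *+ X]card_ord -sumr_const; apply: ler_sum => k _.
rewrite (le_trans (inner_dist _ _ _ _))//.
have B (U U0 : hop m H) p : rnorm (U p - U0 p) <= rnorm (U - U0).
  by have := rnorm_family_entry (U - U0) p; rewrite /family_fun !ffunE.
by rewrite lerD// ler_pM ?rnorm_ge0 ?B ?rnorm_family_entry.
Qed.

Local Notation H := (@l2_hilbert R setT).

Definition truncate_hop N m (T : hop m H) : hop m (@l2_hilbert R [set i | (i < N)%N]) :=
  [ffun p => truncate N (T p)].

Lemma rnorm_truncate_hop N m (T : hop m H) : rnorm (truncate_hop N T) <= rnorm T.
Proof.
rewrite !family_rnormE; apply: ler_sum => p _.
by rewrite [in X in X <= _]/family_fun ffunE rnorm_truncate.
Qed.

Lemma truncate_hopB N m (T S : hop m H) :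
  truncate_hop N (T - S) = truncate_hop N T - truncate_hop N S.
Proof. by apply/ffunP => p; rewrite /family_fun !ffunE linearB. Qed.

Lemma adj_mul_truncate_cvg m (T S : hop m H) (e : R) : 0 < e -> \forall N \near \oo,
  rnorm (adj_mul S T - adj_mul (truncate_hop N S) (truncate_hop N T)) < e.
Proof.
move=> e0; have M0 : 0 < (m * m * m).+1%:R :> R by rewrite ltr0n.
pose e' := e / (m * m * m).+1%:R; have e'0 : 0 < e' by rewrite divr_gt0.
have : \forall N \near \oo, forall q : 'I_m * ('I_m * 'I_m),
    rnorm (inner H (T (q.1, q.2.1)) (S (q.1, q.2.2)) -
      dotsum (T (q.1, q.2.1)) (S (q.1, q.2.2)) N) < e'.
  apply: filter_forall => q.
  have /cvg_rnormP/(_ e' e'0) := @l2_inner_cvg R setT (T (q.1, q.2.1)) (S (q.1, q.2.2)).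
  by apply: filterS => N; rewrite rdistC.
apply: filterS => N NP.
rewrite (@le_lt_trans _ _ ((m * m)%:R * (m%:R * e')))//.
  apply: mx_rnorm_le => i j; rewrite !mxE -sumrB (le_trans (rnorm_sum _ _ _))//.
  rewrite mulr_natl -[X in _ *+ X]card_ord -sumr_const; apply: ler_sum => k _.
  rewrite ![in X in _ - inner _ X _]ffunE [in X in _ - inner _ _ X]ffunE inner_truncate.
  exact: ltW (NP (k, (j, i))).
by rewrite mulrA -natrM /e' mulrCA gtr_pMr// ltr_pdivrMr// mul1r ltr_nat.
Qed.

(** Truncation is a contraction, so the truncated products obey the Lipschitz estimate of the
    original one with the same constant for all N; convergence at (T0, S0) thus spreads to a
    neighbourhood. *)
Lemma adj_mul_truncate_near m (T0 S0 : hop m H) (e : R) : 0 < e ->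
  exists2 dl : R, 0 < dl & \forall N \near \oo, forall T S : hop m H,
    rnorm (T - T0) < dl -> rnorm (S - S0) < dl ->
    rnorm (adj_mul S T - adj_mul (truncate_hop N S) (truncate_hop N T)) < e.
Proof.
move=> e0; pose c : R := (m * m)%:R * m%:R.
have c0 : 0 <= c by rewrite mulr_ge0.
pose X := rnorm T0 + rnorm S0 + 1.
have X0 : 0 <= X by rewrite !addr_ge0 ?rnorm_ge0.
have cX0 : 0 <= c * X by rewrite mulr_ge0.
have D0 : 0 < 4 * (c * X) + 1 by rewrite ltr_wpDl// mulr_ge0.
exists (Num.min 1 (e / (4 * (c * X) + 1))); first by rewrite lt_min ltr01 divr_gt0.
have e20 : 0 < e / 2 by rewrite divr_gt0.
apply: filterS (adj_mul_truncate_cvg T0 S0 e20) => N NP T S.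
set dl := e / _; have min_lt (z : R) : z < Num.min 1 dl -> z < 1 /\ z < dl.
  by rewrite lt_min => /andP[].
move=> /min_lt[T1 Td] /min_lt[S1 Sd].
have dl0 : 0 < dl by rewrite divr_gt0.
have dlE : dl * (4 * (c * X)) <= e by rewrite mulrAC ler_pdivrMr// ler_pM2l// lerDl.
have bound (H' : hilbert R) (T' S' T0' S0' : hop m H') :
    rnorm (T' - T0') <= rnorm (T - T0) -> rnorm (S' - S0') <= rnorm (S - S0) ->
    rnorm S' <= rnorm S -> rnorm T0' <= rnorm T0 ->
    rnorm (adj_mul S' T' - adj_mul S0' T0') <= c * (dl * X).
  move=> h1 h2 h3 h4; apply: le_trans (adj_mul_dist _ _ _ _) _.
  rewrite mulrA ler_wpM2l//.
  have SS : rnorm S' <= rnorm S0 + 1.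
    rewrite (le_trans h3)// -{1}(subrK S0 S) (le_trans (ler_rnormD _ _))//.
    by rewrite addrC lerD2l ltW.
  have p1 : rnorm (T' - T0') * rnorm S' <= dl * (rnorm S0 + 1).
    by apply: ler_pM; [exact: rnorm_ge0|exact: rnorm_ge0|exact: le_trans h1 (ltW Td)|exact: SS].
  have p2 : rnorm T0' * rnorm (S' - S0') <= rnorm T0 * dl.
    by apply: ler_pM; [exact: rnorm_ge0|exact: rnorm_ge0|exact: h4|exact: le_trans h2 (ltW Sd)].
  rewrite [leRHS](_ : _ = dl * (rnorm S0 + 1) + rnorm T0 * dl); last by rewrite /X; ring.
  exact: lerD p1 p2.
have cdl : c * (dl * X) <= e / 4.
  rewrite ler_pdivlMr// (le_trans _ dlE)// le_eqVlt; apply/orP; left; apply/eqP; ring.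
have b1 := bound H T S T0 S0 (lexx _) (lexx _) (lexx _) (lexx _).
have b2 : rnorm (adj_mul (truncate_hop N S) (truncate_hop N T) -
    adj_mul (truncate_hop N S0) (truncate_hop N T0)) <= c * (dl * X).
  by apply: bound; rewrite -?truncate_hopB rnorm_truncate_hop.
(* Moving to (T0, S0) and back costs e/4 each, by the choice of [dl]; truncating there costs e/2. *)
have -> : e = e / 4 + (e / 2 + e / 4) by field.
apply: le_lt_trans (ler_rdistD (adj_mul S0 T0) _ _) _.
apply: ler_ltD; first exact: le_trans b1 cdl.
apply: le_lt_trans (ler_rdistD (adj_mul (truncate_hop N S0) (truncate_hop N T0)) _ _) _.
by apply: ltr_leD => //; rewrite rdistC; exact: le_trans b2 cdl.
Qed.

End Approximation.

Section ConeInHer.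
Context {R : realType} (d : nat) (Om : forall n, set (@mxtuple R d n.+1)).
Arguments Om : clear implicits.
Local Notation C := R[i].
Local Notation E n := (@mxtuple R d n.+1).
Local Notation H := (@l2_hilbert R setT).
Context (u : forall n, E n -> hop n.+1 H).
Arguments u : clear implicits.
Hypothesis u_hol : Hol Om H u.

Lemma truncate_uniform n (K : set (E n * E n)) (e : R) :
  compact K -> K `<=` Om n `*` Om n -> 0 < e -> \forall N \near \oo, forall p, K p ->
    rnorm (adj_mul (u n p.2) (u n p.1) -
      adj_mul (truncate_hop N (u n p.2)) (truncate_hop N (u n p.1))) < e.
Proof.
move=> cK KO e0.
have u_near x0 (dl : R) : Om n x0 -> 0 < dl -> nbhs x0 [set x | rnorm (u n x - u n x0) < dl].
  move=> xO d0; have ux := @differentiable_continuous _ _ _ x0 (u n) (u_hol xO).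
  by have /(@cvg_rnormP R _ _ (nbhs_filter x0))/(_ _ d0) := ux.
apply: ((compact_near_coveringP K).1 cK nat \oo) => -[x0 y0] Kp.
have [/= xO yO] := KO _ Kp.
have [dl d0 dP] := adj_mul_truncate_near (u n x0) (u n y0) e0.
exists ([set x | rnorm (u n x - u n x0) < dl] `*` [set y | rnorm (u n y - u n y0) < dl],
  [set N | forall T S : hop n.+1 H, rnorm (T - u n x0) < dl -> rnorm (S - u n y0) < dl ->
    rnorm (adj_mul S T - adj_mul (truncate_hop N S) (truncate_hop N T)) < e]).
  split => //=; exists ([set x | rnorm (u n x - u n x0) < dl], [set y | rnorm (u n y - u n y0) < dl]) => //.
  by split; exact: u_near.
by move=> [[x y] N] /= [[xd yd]]; apply.
Qed.

Lemma truncate_hol N : Hol Om (@l2_hilbert R [set i | (i < N)%N])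
  (fun n y => truncate_hop N (u n y)).
Proof.
move=> n x xO; apply: differentiable_family => p.
rewrite (_ : (fun y => _) = truncate N \o (fun y => u n y p)); last first.
  by apply/funext => y; rewrite /truncate_hop /family_fun ffunE.
apply: differentiable_comp; first by apply: differentiable_proj; exact: u_hol.
by apply: contraction_differentiable => v; exact: rnorm_truncate.
Qed.

Lemma hereditary_in_Her : Her Om (hereditary Om u u).
Proof.
move=> U; rewrite -nbhs_entourageE => -[W [K [e [[KO cK [N0 K0]] e0 KW]]] WU].
have e'0 : 0 < complex.Re e by move: e0; rewrite ltcE => /andP[].
have tu n := truncate_uniform (cK n) (KO n) e'0.
have [N NP] : exists N, forall n p, K n p -> rnorm (adj_mul (u n p.2) (u n p.1) -
      adj_mul (truncate_hop N (u n p.2)) (truncate_hop N (u n p.1))) < complex.Re e.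
  (* K is empty from level N0 on, so finitely many ranks of truncation are to be dominated by a
     single one. *)
  have /(_ N0) [m mP] : forall n0, exists m, forall N, (m <= N)%N -> forall n p, (n < n0)%N ->
      K n p -> rnorm (adj_mul (u n p.2) (u n p.1) -
      adj_mul (truncate_hop N (u n p.2)) (truncate_hop N (u n p.1))) < complex.Re e.
    elim=> [|n0 [m mP]]; first by exists 0%N.
    have [m' _ m'P] := tu n0; exists (maxn m m') => N; rewrite geq_max => /andP[mN m'N] n p.
    rewrite ltnS leq_eqVlt => /predU1P[nn0|nn0]; last exact: mP.
    by subst n; exact: m'P.
  exists m => n p Kp; apply: (mP m (leqnn m)) => //.
  by rewrite ltnNge; apply/negP => /K0 Kn; rewrite Kn in Kp.
exists (hereditary Om (fun n y => truncate_hop N (u n y)) (fun n y => truncate_hop N (u n y))).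
split.
  exists (@l2_hilbert R [set i | (i < N)%N]); split; first exact: truncated_finite_dim.
  by exists (fun n y => truncate_hop N (u n y)), (fun n y => truncate_hop N (u n y));
    split => //; exact: truncate_hol.
apply: WU; rewrite /xsection /= inE; apply: KW => n x y Kxy /=.
by rewrite rnormE -(RRe_real (gtr0_real e0)) ltcR; exact: NP _ _ Kxy.
Qed.

End ConeInHer.

Theorem theorem5p1 (R : realType) (d : nat)
    (Om : forall n : nat, set (@mxtuple R d n.+1)) (Om_open : finitely_open Om) :
  pos_cone Om `<=` Her Om /\ closed (pos_cone Om : set (subspace (Her Om))).
Proof.
split=> [A /subset_closure A_clo|].
  have [u [uH ->]] := closure_pos_cone Om_open A_clo.
  exact: hereditary_in_Her.
(* The cone is closed among all functions on the box product, hence relatively to [Her Om]. *)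
apply: closed_subspaceW => A /(closure_pos_cone Om_open)[u [uH ->]].
by exists (@l2_hilbert R setT), u.
Qed.
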